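(* Let $L\in(1,2)$. Given $s^i\in\mathcal S\cap\mathcal V$, let $s^{i+1}\in\mathcal V$ be the solution of the linearized problem with $s^{i+1}(0)=s_0$, and let $s^{i+1}_{h\tau}\in\mathcal V$ denote an approximation of $s^{i+1}$ (an arbitrary element of $\mathcal V$). With \begin{align*} \mathcal E(s^i)&:=\Big(\|\mathcal R(s^i)\|^2_{L^2(0,T;H^{-1}(\Omega))}+L^2\|s^i(0)-s_0\|^2\Big)^{1/2},\\ \mathcal E^{\mathrm H}_{\mathrm{disc}}(s^{i+1}_{h\tau})&:=\Big(\|\mathcal R_{\mathrm{lin}}(s^{i+1}_{h\tau},s^i)\|^2_{L^2(0,T;H^{-1}(\Omega))}+L^2\|s^{i+1}_{h\tau}(0)-s_0\|^2\Big)^{1/2},\\ \mathcal E^i_{\mathrm{lin}}&:=\|s^{i+1}_{h\tau}-s^i\|_{\mathcal V}, \end{align*} one has the reliability and efficiency bounds $$\mathcal E(s^i)\le\mathcal E^{\mathrm H}_{\mathrm{disc}}(s^{i+1}_{h\tau})+L\,\mathcal E^i_{\mathrm{lin}}\qquad\text{and}\qquad \mathcal E^{\mathrm H}_{\mathrm{disc}}(s^{i+1}_{h\tau})\le\mathcal E(s^i)+L\,\mathcal E^i_{\mathrm{lin}}.$$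
   Context: Domain: $\Omega\subset\mathbb R^d$ is a bounded open domain with Lipschitz boundary, $T>0$, $Q=(0,T]\times\Omega$. $(\cdot,\cdot)$ and $\|\cdot\|$ are the inner product and norm of $L^2(\Omega)$; $\langle\cdot,\cdot\rangle$ is the duality pairing between $H^{-1}(\Omega)$ and $H^1_0(\Omega)$; $\nabla$ is the spatial gradient. $\|g\|_{H^{-1}(\Omega)}=\sup_{0\ne\varphi\in H^1_0(\Omega)}\langle g,\varphi\rangle/\|\nabla\varphi\|$. Nonlinearities and data: $b,B:\mathbb R\to\mathbb R$ are Lipschitz continuous and non-decreasing, $b(0)=0$, $|B(s)-B(r)|\le|s-r|$ and $|b(s)-b(r)|\le|s-r|$ for all $s,r$, and $(b+B)(s)-(b+B)(r)\ge s-r$ for $s\ge r$. (They come from a degenerate nonlinearity $\Phi$ via $B=\Phi\circ b$ on $[0,\infty)$.) $f\in L^2(Q)$, $u_0\in L^2(\Omega)$, and $s_0\in L^2(\Omega)$ satisfies $b(s_0)=u_0$. Spaces: $\mathcal S=\{s\in L^2(Q): b(s)\in H^1(0,T;H^{-1}(\Omega)),\ B(s)\in L^2(0,T;H^1_0(\Omega))\}$ and $\mathcal V=L^2(0,T;H^1_0(\Omega))\cap H^1(0,T;H^{-1}(\Omega))$ (continuously embedded in $C([0,T];L^2(\Omega))$), with norm $$\|v\|_{\mathcal V}^2=\int_0^T\big(\|\nabla v(t)\|^2+\|\partial_t v(t)\|^2_{H^{-1}(\Omega)}\big)\,dt+\|v(T)\|^2.$$ Residuals, as elements of $L^2(0,T;H^{-1}(\Omega))$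 acting on $\varphi\in L^2(0,T;H^1_0(\Omega))$: $\mathcal R(s)(\varphi)=\int_0^T\langle\partial_t b(s),\varphi\rangle+\int_0^T(\nabla B(s),\nabla\varphi)-\int_0^T(f,\varphi)$ for $s\in\mathcal S$; $\mathcal R_{\mathrm H}(s)(\varphi)=\int_0^T\langle\partial_t s,\varphi\rangle+\int_0^T(\nabla s,\nabla\varphi)$ for $s\in\mathcal V$; $\mathcal R_{\mathrm{lin}}(s,\bar s)=L\,\mathcal R_{\mathrm H}(s-\bar s)+\mathcal R(\bar s)$ for $s\in\mathcal V$, $\bar s\in\mathcal S\cap\mathcal V$. The dual norm is $\|\mathcal F\|_{L^2(0,T;H^{-1}(\Omega))}=\sup\{\mathcal F(\varphi):\varphi\in L^2(0,T;H^1_0(\Omega)),\ \int_0^T\|\nabla\varphi\|^2=1\}$. Linearized problem ($L$-scheme): given $s^i$, find $s^{i+1}\in\mathcal V$ with $s^{i+1}(0)=s_0$ and $\mathcal R_{\mathrm{lin}}(s^{i+1},s^i)=0$. *)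

(* Defs.v *)
From HB Require Import structures.
From mathcomp Require Import all_boot all_order all_algebra.
From mathcomp Require Import all_classical all_reals all_analysis.

Set Implicit Arguments.
Unset Strict Implicit.
Unset Printing Implicit Defensive.
Import Order.TTheory GRing.Theory Num.Theory.
Import numFieldNormedType.Exports.
Local Open Scope classical_set_scope.
Local Open Scope ring_scope.

(* Functions on Omega are total functions on R^d of which only the restriction
   to Omega matters, and elements of L^2 are represented by measurable
   functions, equality in L^2 being equality almost everywhere. *)

(* R^n carries the sigma-algebra generated by the coordinates, that is, the
   Borel sigma-algebra. *)
Section rV_measurable.
Context {R : realType} (n : nat).

Let coord (i : 'I_n) (x : 'rV[R]_n) : measurableTypeR R := x 0 i.

Let rV_set0 : g_sigma_preimage coord set0.
Proof. exact: sigma_algebra0. Qed.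

Let rV_setC A : g_sigma_preimage coord A -> g_sigma_preimage coord (~` A).
Proof. exact: sigma_algebraC. Qed.

Let rV_bigcup (F : (set 'rV[R]_n)^nat) :
  (forall i, g_sigma_preimage coord (F i)) ->
  g_sigma_preimage coord (\bigcup_i (F i)).
Proof. exact: sigma_algebra_bigcup. Qed.

HB.instance Definition _ := @isMeasurable.Build default_measure_display
  'rV[R]_n (g_sigma_preimage coord) rV_set0 rV_setC rV_bigcup.

Lemma measurable_coord (i : 'I_n) :
  measurable_fun [set: 'rV[R]_n] (fun x => x 0 i : measurableTypeR R).
Proof.
move=> _ Y mY; rewrite setTI; apply: sub_sigma_algebra => /=.
rewrite -bigcup_seq/=; exists i => /=; first by rewrite mem_index_enum.
by exists Y => //; rewrite setTI.
Qed.

Lemma measurable_fun_rV d1 (T1 : measurableType d1) (f : T1 -> 'rV[R]_n) :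
  (forall i, measurable_fun [set: T1] (fun t => f t 0 i : measurableTypeR R)) ->
  measurable_fun [set: T1] f.
Proof.
move=> mf _ A mA.
suff /(_ A mA) : @measurable _ 'rV[R]_n `<=` [set B | measurable (f @^-1` B)].
  by rewrite setTI.
apply: smallest_sub.
  split => /=; first by rewrite preimage_set0.
  - by move=> B mB; rewrite setTD preimage_setC; exact: measurableC.
  - by move=> F mF; rewrite preimage_bigcup; exact: bigcup_measurable.
move=> B; rewrite -bigcup_seq/= => -[i _ [C mC <-]].
rewrite /= setTI; have := mf i measurableT C mC.
by rewrite setTI.
Qed.

End rV_measurable.

(* Lebesgue measure on R^n: the image of the product measure of R * R^(n-1). *)
Section lebesgue_rV.
Context {R : realType}.

Definition cons_rV n (p : measurableTypeR R * 'rV[R]_n) : 'rV[R]_n.+1 :=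
  row_mx (const_mx p.1 : 'rV[R]_1) p.2.

Definition uncons_rV n (v : 'rV[R]_n.+1) : measurableTypeR R * 'rV[R]_n :=
  (v 0 0, \row_i v 0 (rshift 1 i)).

Lemma cons_rVK n : cancel (@cons_rV n) (@uncons_rV n).
Proof.
move=> [x v]; rewrite /uncons_rV /cons_rV/=; congr pair.
  rewrite (_ : 0 = lshift n (0 : 'I_1)); last exact/val_inj.
  by rewrite (@row_mxEl _ 1 1 n) mxE.
by apply/rowP => i; rewrite mxE (@row_mxEr _ 1 1 n).
Qed.

Lemma measurable_cons_rV n : measurable_fun setT (@cons_rV n).
Proof.
apply: measurable_fun_rV => i; rewrite /cons_rV.
case: (@split_ordP 1 n i) => j ->.
  rewrite (_ : (fun t => _) = fst)//.
  by apply/funext => p; rewrite (@row_mxEl _ 1 1 n) mxE.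
rewrite (_ : (fun t => _) = (fun v : 'rV[R]_n => v 0 j) \o snd).
  by apply: measurableT_comp => //; exact: measurable_coord.
by apply/funext => p; rewrite (@row_mxEr _ 1 1 n).
Qed.

Lemma measurable_uncons_rV n : measurable_fun setT (@uncons_rV n).
Proof.
apply: measurable_fun_pair; first exact: measurable_coord.
apply: measurable_fun_rV => i.
rewrite (_ : (fun t => _) = (fun v : 'rV[R]_n.+1 => v 0 (rshift 1 i))).
  exact: measurable_coord.
by apply/funext => v; rewrite mxE.
Qed.

Section step.
Context n (m : {sigma_finite_measure set 'rV[R]_n -> \bar R}).

Definition lebesgue_rV_step : set 'rV[R]_n.+1 -> \bar R :=
  pushforward (lebesgue_measure \x m)%E (@cons_rV n).

Let mcons : measurable_fun setT (@cons_rV n) := @measurable_cons_rV n.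

Let step0 : lebesgue_rV_step set0 = 0%E.
Proof. by rewrite /lebesgue_rV_step /pushforward preimage_set0 measure0. Qed.

Let step_ge0 A : (0 <= lebesgue_rV_step A)%E.
Proof. exact: measure_ge0. Qed.

Let step_sigma_additive : semi_sigma_additive lebesgue_rV_step.
Proof.
move=> F mF tF mUF; rewrite /lebesgue_rV_step /pushforward preimage_bigcup.
apply: measure_semi_sigma_additive.
- by move=> k; rewrite -[X in measurable X]setTI; exact: mcons.
- apply/trivIsetP => /= i j _ _ ij; rewrite -preimage_setI.
  by move/trivIsetP : tF => /(_ _ _ _ _ ij) ->//; rewrite preimage_set0.
- by rewrite -preimage_bigcup -[X in measurable X]setTI; exact: mcons.
Qed.

HB.instance Definition _ := isMeasure.Build _ _ _ lebesgue_rV_step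
  step0 step_ge0 step_sigma_additive.

Let step_sigma_finite : sigma_finite setT lebesgue_rV_step.
Proof.
have /sigma_finiteP[F [FT ndF Foo]] :=
  sigma_finiteT (@lebesgue_measure R : {sigma_finite_measure set _ -> \bar R}).
have /sigma_finiteP[G [GT ndG Goo]] := sigma_finiteT m.
exists (fun k => @uncons_rV n @^-1` (F k `*` G k)).
  apply/seteqP; split=> // v _.
  have [i _ Fi] : (\bigcup_k F k) (uncons_rV v).1 by rewrite -FT.
  have [j _ Gj] : (\bigcup_k G k) (uncons_rV v).2 by rewrite -GT.
  exists (maxn i j) => //; split.
    by have /subsetPset := ndF _ _ (leq_maxl i j); apply.
  by have /subsetPset := ndG _ _ (leq_maxr i j); apply.
move=> k; have [mF ltF] := Foo k; have [mG ltG] := Goo k; split.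
  rewrite -[X in measurable X]setTI; apply: measurable_uncons_rV => //.
  exact: measurableX.
rewrite /lebesgue_rV_step /pushforward -comp_preimage.
rewrite (_ : _ \o _ = id); last by apply/funext => p; exact: cons_rVK.
rewrite preimage_id product_measure1E//.
by rewrite lte_mul_pinfty// ge0_fin_numE.
Qed.

HB.instance Definition _ := Measure_isSigmaFinite.Build _ _ _ lebesgue_rV_step
  step_sigma_finite.

End step.

Fixpoint lebesgue_rV n : {sigma_finite_measure set 'rV[R]_n -> \bar R} :=
  match n with
  | 0 => @dirac _ 'rV[R]_0 0 R
  | n'.+1 => lebesgue_rV_step (lebesgue_rV n')
  end.

End lebesgue_rV.

Section domain.
Context {R : realType} {d : nat}.
Implicit Types Omega : set 'rV[R]_d.

(* Near each boundary point, Omega is, in some orthonormal coordinate system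
   y *m Q, the set of points strictly above the graph of a Lipschitz function
   gamma of all the coordinates but the i-th. *)
Definition lipschitz_boundary Omega :=
  forall x, (closure Omega `\` interior Omega) x ->
  exists (r : R) (Q : 'M[R]_d) (i : 'I_d) (gamma : 'rV[R]_d.-1 -> R),
    [/\ 0 < r, Q *m Q^T = 1%:M, exists k, k.-lipschitz gamma &
      forall y, ball x r y ->
        Omega y <-> gamma (col' i (y *m Q)) < (y *m Q) 0 i].

Definition lipschitz_domain Omega :=
  [/\ Omega !=set0, open Omega, connected Omega, bounded_set Omega &
      lipschitz_boundary Omega].

End domain.

Definition L2 (R : realType) (disp : measure_display) (X : measurableType disp)
    (mu : {measure set X -> \bar R}) (D : set X) (f : X -> R) :=
  measurable_fun D f /\ mu.-integrable D (fun x => (f x ^+ 2)%:E).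

Section space.
Context {R : realType} {d : nat} (Omega : set 'rV[R]_d).
Local Notation E := 'rV[R]_d.
Local Notation mu := (@lebesgue_rV R d).

Definition dotL2 (u w : E -> R) : R := \int[mu]_(x in Omega) (u x * w x).

Definition normL2 (u : E -> R) : R := Num.sqrt (dotL2 u u).

Definition dotL2v (G H : 'I_d -> E -> R) : R := \sum_(i < d) dotL2 (G i) (H i).

Definition normL2v (G : 'I_d -> E -> R) : R := Num.sqrt (dotL2v G G).

Definition partial (i : 'I_d) (u : E -> R) : E -> R :=
  fun x => 'D_(delta_mx 0 i) u x.

Definition smooth (u : E -> R) :=
  forall (s : seq 'I_d) (x : E), differentiable (foldr partial u s) x.

Definition test_function (u : E -> R) :=
  [/\ smooth u, compact (closure [set x | u x != 0]) &
      closure [set x | u x != 0] `<=` Omega].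

Definition is_weak_grad (u : E -> R) (G : 'I_d -> E -> R) :=
  (forall i, L2 mu Omega (G i)) /\
  forall i phi, test_function phi ->
    dotL2 u (partial i phi) = - dotL2 (G i) phi.

Definition grad (u : E -> R) : 'I_d -> E -> R := get [set G | is_weak_grad u G].

Definition H1 (u : E -> R) := L2 mu Omega u /\ exists G, is_weak_grad u G.

Definition H10 (u : E -> R) :=
  H1 u /\ exists phi : nat -> E -> R, (forall n, test_function (phi n)) /\
    (fun n => normL2 (u \- phi n) + normL2v (grad (u \- phi n))) @ \oo --> 0.

Definition Hm1 (g : (E -> R) -> R) :=
  (forall (a : R) u w, H10 u -> H10 w ->
     g (fun x => a * u x + w x) = a * g u + g w) /\
  exists C, forall u, H10 u -> `|g u| <= C * normL2v (grad u).

Definition normHm1 (g : (E -> R) -> R) : R :=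
  sup [set g u / normL2v (grad u) | u in
    [set u | H10 u /\ ~ {ae mu, forall x, Omega x -> u x = 0}]].

End space.

Section space_time.
Context {R : realType} {d : nat} (Omega : set 'rV[R]_d) (T : R).
Local Notation E := 'rV[R]_d.
Local Notation mu := (@lebesgue_rV R d).
Local Notation lam := (@lebesgue_measure R).
Local Notation J := `]0, T[%classic.

Definition slice (v : R * E -> R) (t : R) : E -> R := fun x => v (t, x).

Definition L2Q (v : R * E -> R) :=
  L2 (lam \x mu)%E (`]0, T]%classic `*` Omega) v.

Definition is_gradQ (v : R * E -> R) (G : 'I_d -> R * E -> R) :=
  (forall i, L2Q (G i)) /\
  {ae lam, forall t, J t ->
     is_weak_grad Omega (slice v t) (fun i => slice (G i) t)}.

(* L^2(0,T;H^1_0), an element being represented by a function on Q *)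
Definition L2H10 (v : R * E -> R) :=
  [/\ L2Q v, {ae lam, forall t, J t -> H10 Omega (slice v t)} &
      exists G, is_gradQ v G].

(* nabla v(t), from a representative that is measurable on Q *)
Definition gradt (v : R * E -> R) (t : R) : 'I_d -> E -> R :=
  fun i => slice (get [set G | is_gradQ v G] i) t.

(* L^2(0,T;H^-1): as H^1_0 is separable, weak measurability is Bochner
   measurability. *)
Definition L2Hm1 (g : R -> (E -> R) -> R) :=
  [/\ forall t, J t -> Hm1 Omega (g t),
      forall u, H10 Omega u -> measurable_fun J (fun t => g t u) &
      lam.-integrable J (fun t => (normHm1 Omega (g t) ^+ 2)%:E)].

Definition test_time (eta : R -> R) :=
  [/\ forall n t, derivable (derive1n n eta) t 1,
      compact (closure [set t | eta t != 0]) &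
      closure [set t | eta t != 0] `<=` J].

(* Weak time derivative in L^2(0,T;H^-1), with L^2(Omega) embedded in H^-1 by
   u |-> (u, -). *)
Definition is_dt (v : R * E -> R) (g : R -> (E -> R) -> R) :=
  L2Hm1 g /\
  forall eta u, test_time eta -> H10 Omega u ->
    \int[lam]_(t in J) (derive1 eta t * dotL2 Omega (slice v t) u) =
    - \int[lam]_(t in J) (eta t * g t u).

Definition dt (v : R * E -> R) : R -> (E -> R) -> R := get [set g | is_dt v g].

(* The functions of L^2(Q), a subspace of L^2(0,T;H^-1), that are in
   H^1(0,T;H^-1). *)
Definition H1Hm1 (v : R * E -> R) := L2Q v /\ exists g, is_dt v g.

Definition spaceV (v : R * E -> R) := L2H10 v /\ H1Hm1 v.

Definition spaceS (b B : R -> R) (s : R * E -> R) :=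
  [/\ L2Q s, H1Hm1 (b \o s) & L2H10 (B \o s)].

Definition is_continuous_rep (v : R * E -> R) (V : R -> E -> R) :=
  [/\ forall t, t \in `[0, T] -> L2 mu Omega (V t),
      forall t, t \in `[0, T] ->
        (fun r => normL2 Omega (V r \- V t)) @
          within `[0, T]%classic (nbhs t) --> 0 &
      {ae lam, forall t, J t ->
        {ae mu, forall x, Omega x -> V t x = v (t, x)}}].

(* v(t) for v in spaceV, through the embedding in C([0,T];L^2(Omega)) *)
Definition trace (v : R * E -> R) (t : R) : E -> R :=
  get [set V | is_continuous_rep v V] t.

Definition normV (v : R * E -> R) : R :=
  Num.sqrt (\int[lam]_(t in J) (normL2v Omega (gradt v t) ^+ 2 +
                                normHm1 Omega (dt v t) ^+ 2) +
            normL2 Omega (trace v T) ^+ 2).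

Definition res (b B : R -> R) (f s phi : R * E -> R) : R :=
  \int[lam]_(t in J) dt (b \o s) t (slice phi t) +
  \int[lam]_(t in J) dotL2v Omega (gradt (B \o s) t) (gradt phi t) -
  \int[lam]_(t in J) dotL2 Omega (slice f t) (slice phi t).

Definition resH (s phi : R * E -> R) : R :=
  \int[lam]_(t in J) dt s t (slice phi t) +
  \int[lam]_(t in J) dotL2v Omega (gradt s t) (gradt phi t).

Definition reslin (b B : R -> R) (f : R * E -> R) (L : R)
    (s sbar phi : R * E -> R) : R :=
  L * resH (s \- sbar) phi + res b B f sbar phi.

Definition normL2Hm1 (F : (R * E -> R) -> R) : R :=
  sup [set F phi | phi in [set phi | L2H10 phi /\
    \int[lam]_(t in J) normL2v Omega (gradt phi t) ^+ 2 = 1]].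

End space_time.

Section estimators.
Context {R : realType} {d : nat} (Omega : set 'rV[R]_d) (T : R).
Context (b B : R -> R) (f : R * 'rV[R]_d -> R) (s0 : 'rV[R]_d -> R) (L : R).
Implicit Types si sht : R * 'rV[R]_d -> R.

Definition est si : R :=
  Num.sqrt (normL2Hm1 Omega T (res Omega T b B f si) ^+ 2 +
            L ^+ 2 * normL2 Omega (trace Omega T si 0 \- s0) ^+ 2).

Definition est_disc si sht : R :=
  Num.sqrt (normL2Hm1 Omega T (reslin Omega T b B f L sht si) ^+ 2 +
            L ^+ 2 * normL2 Omega (trace Omega T sht 0 \- s0) ^+ 2).

Definition est_lin si sht : R := normV Omega T (sht \- si).

End estimators.

(* Main.v *)
(* Put w := sht - si.  The functionals in the two estimators differ by
   L R_H(w) and the initial traces by w(0), so by the triangle inequality in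
   R^2 both bounds follow from ||R_H(w)||^2 + ||w(0)||^2 <= ||w||_V^2.

   For phi in L^2(0,T;H^1_0) and a real l, the definition of the dual norm and
   Young's inequality give, for almost every t,
     2 <dt w, w - l phi> <= ||dt w||^2_(H^-1) + ||grad (w - l phi)||^2.
   Integrating, and replacing the integral of 2 <dt w, w> by
   ||w(T)||^2 - ||w(0)||^2, yields
     2 l R_H(w)(phi) <= ||w||_V^2 - ||w(0)||^2 + l^2 ||grad phi||^2,
   and one takes l := R_H(w)(phi).

   The continuous representative and the energy identity are obtained without
   mollification in time.  By the du Bois-Reymond lemma and the separability
   of H^1_0, (w(t) - w(s), u) is the integral of <dt w, u> over ]s, t] for all u
   in H^1_0 and all s < t in a set G of full measure.  Summing
   ||w(r') - u||^2 - ||w(r) - u||^2 = (w(r') - w(r), w(r) + w(r') - 2 u) over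
   consecutive points r < r' of G, one in each cell of a fine partition of
   ]s, t] and such that ||grad (w(r) - u)||^2 is at most its mean over the cell,
   bounds | ||w(t) - u||^2 - ||w(s) - u||^2 | by the integral over ]s, t] of
     l ||dt w||^2_(H^-1) + (4 / l) ||grad (w - u)||^2.
   With u := w(r) for some r between s and t this gives a modulus of
   continuity of w in L^2.  With u constant on each of n equal cells of ]0, T]
   and close to w in L^2(0,T;H^1_0), letting l tend to 0 gives the identity. *)

Require Import Defs.
From HB Require Import structures.
From mathcomp Require Import all_boot all_order all_algebra.
From mathcomp Require Import ring lra.
From mathcomp Require Import all_classical all_reals all_analysis measurable_realfun.
Set Implicit Arguments.
Unset Strict Implicit.
Unset Printing Implicit Defensive.
Import Order.TTheory GRing.Theory Num.Theory.
Import numFieldNormedType.Exports.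
Local Open Scope classical_set_scope.
Local Open Scope ring_scope.

(** * Square-integrable functions *)

(** Formally, the Riesz isometry between H^1_0 and H^-1 turns the estimate of R_H into the identity
    ||R_H(w)||^2 = ||w||_V^2 - ||w(0)||^2: expanding the squared H^-1 norm of dt w minus the
    Laplacian of w leaves the cross term 2 <dt w, w>, an exact derivative in time. This explains the
    terminal value in the norm of V. The proof extracts the upper bound from Young's inequality, for
    one phi at a time.

    The objects [grad], [gradt], [dt] and [trace] are choices made by [get]. They can be handled
    only through uniqueness up to null sets, and a gradient chosen separately at each time carries
    no measurability in time. Quantities such as ||grad (v(t) - u)||^2 and <g(t), v(t)> are
    therefore replaced by integrable functions of t that agree with them almost everywhere. The
    energy argument is run over an abstract group with a bilinear form, where these choices are
    invisible.

    Partition points cannot be prescribed, since w(t) is known to lie in H^1_0 for almost every t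
    only; this is why they are selected inside the cells. *)

Section L2_theory.
Context {R : realType} {disp : measure_display} {X : measurableType disp}.
Variables (mu : {measure set X -> \bar R}) (D : set X) (mD : measurable D).
Implicit Types f g h : X -> R.

Definition dot f g : R := \int[mu]_(x in D) (f x * g x).

Lemma L2_mul f g : L2 mu D f -> L2 mu D g ->
  mu.-integrable D (EFin \o (fun x => f x * g x)).
Proof.
move=> [mf f2] [mg g2].
apply: (@le_integrable _ _ _ mu D mD _ (fun x => (f x ^+ 2)%:E + (g x ^+ 2)%:E)%E).
- by apply/measurable_EFinP; exact: measurable_funM.
- move=> x Dx /=; rewrite lee_fin normrM.
  rewrite [leRHS]ger0_norm ?addr_ge0 ?sqr_ge0//.
  rewrite -(real_normK (num_real (f x))) -(real_normK (num_real (g x))).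
  have := sqr_ge0 (`|f x| - `|g x|); nra.
- exact: integrableD.
Qed.

(** The combination [a * f + g] is the form in which linearity is stated throughout, as in the
    definition of [Hm1]; multiples, sums and differences are instances of it. *)
Lemma L2_comb a f g : L2 mu D f -> L2 mu D g -> L2 mu D (fun x => a * f x + g x).
Proof.
move=> Lf Lg; have [mf f2] := Lf; have [mg g2] := Lg.
split; first by apply: measurable_funD => //; exact: measurable_funM.
apply: (@eq_integrable _ _ _ mu D mD (fun x => (a ^+ 2)%:E * (f x ^+ 2)%:E +
    ((2 * a)%:E * (f x * g x)%:E + (g x ^+ 2)%:E))%E).
  by move=> x _; rewrite -!EFinM -!EFinD; congr EFin; ring.
apply: integrableD => //; first exact: integrableZl.
by apply: integrableD => //; apply: integrableZl => //; exact: L2_mul.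
Qed.

Lemma L2_0 : L2 mu D (fun=> 0).
Proof.
split=> //; apply: (eq_integrable mD (cst 0%E)); last exact: integrable0.
by move=> x _ /=; rewrite expr0n.
Qed.

Lemma L2_Z a f : L2 mu D f -> L2 mu D (fun x => a * f x).
Proof.
move=> Lf; have := L2_comb a Lf L2_0.
by under eq_fun do rewrite addr0.
Qed.

Lemma L2_D f g : L2 mu D f -> L2 mu D g -> L2 mu D (f \+ g).
Proof.
move=> Lf Lg; have := L2_comb 1 Lf Lg.
by under eq_fun do rewrite mul1r.
Qed.

Lemma L2_B f g : L2 mu D f -> L2 mu D g -> L2 mu D (f \- g).
Proof.
move=> Lf Lg; have := L2_comb (-1) Lg Lf.
by under eq_fun do rewrite mulN1r addrC.
Qed.

Lemma dotC f g : dot f g = dot g f.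
Proof. by apply: eq_Rintegral => x _; rewrite mulrC. Qed.

Lemma dot_ge0 f : 0 <= dot f f.
Proof. by apply: Rintegral_ge0 => x _; rewrite -expr2 sqr_ge0. Qed.

Lemma dot_combl a f g h : L2 mu D f -> L2 mu D g -> L2 mu D h ->
  dot (fun x => a * f x + g x) h = a * dot f h + dot g h.
Proof.
move=> Lf Lg Lh; rewrite /dot.
under eq_Rintegral do rewrite mulrDl -mulrA.
rewrite RintegralD//; last 2 first.
- have := integrableZl mD a (L2_mul Lf Lh); exact: eq_integrable.
- exact: L2_mul.
by rewrite RintegralZl//; exact: L2_mul.
Qed.

Lemma dot_combr a f g h : L2 mu D f -> L2 mu D g -> L2 mu D h ->
  dot h (fun x => a * f x + g x) = a * dot h f + dot h g.
Proof. by move=> *; rewrite dotC dot_combl// !(dotC h). Qed.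

Lemma dotDl f g h : L2 mu D f -> L2 mu D g -> L2 mu D h ->
  dot (f \+ g) h = dot f h + dot g h.
Proof.
move=> Lf Lg Lh; rewrite -[dot f h]mul1r -dot_combl//.
by apply: eq_Rintegral => x _ /=; rewrite mul1r.
Qed.

Lemma dotBl f g h : L2 mu D f -> L2 mu D g -> L2 mu D h ->
  dot (f \- g) h = dot f h - dot g h.
Proof.
move=> Lf Lg Lh; rewrite addrC -mulN1r -dot_combl//.
by apply: eq_Rintegral => x _ /=; rewrite mulN1r addrC.
Qed.

Lemma dotBr f g h : L2 mu D f -> L2 mu D g -> L2 mu D h ->
  dot h (f \- g) = dot h f - dot h g.
Proof. by move=> *; rewrite dotC dotBl// !(dotC h). Qed.

Lemma dot_sqB f g : L2 mu D f -> L2 mu D g ->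
  dot (f \- g) (f \- g) = dot f f - 2 * dot f g + dot g g.
Proof.
move=> Lf Lg; have LB := L2_B Lf Lg.
by rewrite dotBl// !dotBr// (dotC g f); ring.
Qed.

Lemma dot_sq_comb a f g : L2 mu D f -> L2 mu D g ->
  dot (fun x => a * f x + g x) (fun x => a * f x + g x) =
  a ^+ 2 * dot f f + 2 * a * dot f g + dot g g.
Proof.
move=> Lf Lg; have LB := L2_comb a Lf Lg.
by rewrite dot_combl// !dot_combr// (dotC g f); ring.
Qed.

End L2_theory.

(** Applied to the square of [x * f + g], this is Cauchy-Schwarz for a form that may be degenerate,
    which is why [a = 0] is treated separately. *)
Lemma disc_le0 {R : realType} (a b c : R) : 0 <= a ->
  (forall x, 0 <= x ^+ 2 * a + 2 * x * b + c) -> b ^+ 2 <= a * c.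
Proof.
move=> a0 H; have [a00|an0] := eqVneq a 0.
  rewrite a00 mul0r; have [->|bn0] := eqVneq b 0; first by rewrite expr0n.
  (* This argument gives the affine function [2 * x * b + c] the value -1. *)
  have := H ((- c - 1) / (2 * b)); rewrite a00 mulr0 add0r.
  have -> : 2 * ((- c - 1) / (2 * b)) * b = - c - 1 by field.
  lra.
have ap : 0 < a by rewrite lt_neqAle eq_sym an0.
have := H (- b / a).
have -> : (- b / a) ^+ 2 * a + 2 * (- b / a) * b + c = (a * c - b ^+ 2) / a by field.
by rewrite pmulr_lge0 ?invr_gt0// subr_ge0.
Qed.

Section L2_norm.
Context {R : realType} {disp : measure_display} {X : measurableType disp}.
Variables (mu : {measure set X -> \bar R}) (D : set X) (mD : measurable D).
Implicit Types f g h : X -> R.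
Local Notation dot := (dot mu D).

Lemma dot_CS f g : L2 mu D f -> L2 mu D g ->
  dot f g ^+ 2 <= dot f f * dot g g.
Proof.
move=> Lf Lg; apply: disc_le0; first exact: dot_ge0.
move=> x; rewrite -dot_sq_comb//; exact: dot_ge0.
Qed.

Lemma dot_young f g : L2 mu D f -> L2 mu D g ->
  2 * `|dot f g| <= dot f f + dot g g.
Proof.
move=> Lf Lg; have := dot_CS Lf Lg.
have := dot_ge0 mu D f; have := dot_ge0 mu D g.
rewrite -(real_normK (num_real (dot f g))).
move: (normr_ge0 (dot f g)); set a := dot f f; set b := dot g g; set c := `|_|.
move=> c0 b0 a0 h; have ab := sqr_ge0 (a - b).
rewrite -(@ler_pXn2r _ 2) ?nnegrE ?addr_ge0 ?mulr_ge0//.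
have -> : (2 * c) ^+ 2 = 4 * c ^+ 2 by ring.
by move: ab h; rewrite !expr2; lra.
Qed.

Lemma dot_le2 f g : L2 mu D f -> L2 mu D g ->
  dot (f \- g) (f \- g) <= 2 * dot f f + 2 * dot g g.
Proof.
move=> Lf Lg; rewrite dot_sqB//.
have := dot_young Lf Lg; have := lerNnormlW (lexx `|dot f g|); lra.
Qed.

Lemma dot_tri f g h : L2 mu D f -> L2 mu D g -> L2 mu D h ->
  dot (f \- h) (f \- h) <=
  2 * dot (f \- g) (f \- g) + 2 * dot (g \- h) (g \- h).
Proof.
move=> Lf Lg Lh.
have -> : f \- h = (f \- g) \- (h \- g).
  by apply/funext => x /=; ring.
have -> : dot (g \- h) (g \- h) = dot (h \- g) (h \- g).
  by apply: eq_Rintegral => x _ /=; ring.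
by apply: dot_le2; exact: L2_B.
Qed.

Lemma sqrt_dot_tri f g : L2 mu D f -> L2 mu D g ->
  Num.sqrt (dot (f \+ g) (f \+ g)) <= Num.sqrt (dot f f) + Num.sqrt (dot g g).
Proof.
move=> Lf Lg; rewrite -(@ler_pXn2r _ 2) ?nnegrE ?addr_ge0 ?sqrtr_ge0//.
rewrite sqr_sqrtr ?dot_ge0// sqrrD !sqr_sqrtr ?dot_ge0//.
have -> : dot (f \+ g) (f \+ g) = dot f f + 2 * dot f g + dot g g.
  rewrite dotDl ?(dotC _ _ f (f \+ g)) ?(dotC _ _ g (f \+ g)) ?dotDl//; last exact: L2_D.
  by rewrite (dotC _ _ g f); ring.
rewrite lerD2r lerD2l mulr_natl lerMn2r /=.
rewrite -sqrtrM ?dot_ge0//; apply: le_trans (ler_norm _) _.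
by rewrite -sqrtr_sqr ler_sqrt ?dot_CS// mulr_ge0 ?dot_ge0.
Qed.

Lemma dot_ae f f' g g' : L2 mu D f -> L2 mu D f' -> L2 mu D g -> L2 mu D g' ->
  {ae mu, forall x, D x -> f x = f' x} -> {ae mu, forall x, D x -> g x = g' x} ->
  dot f g = dot f' g'.
Proof.
move=> Lf Lf' Lg Lg' ff gg; congr fine; apply: ae_eq_integral => //.
- by have /measurable_int := L2_mul mD Lf Lg.
- by have /measurable_int := L2_mul mD Lf' Lg'.
- by move: ff gg; apply: filterS2 => x h1 h2 Dx; rewrite h1// h2.
Qed.

Lemma dot_eq0 f : L2 mu D f -> dot f f = 0 -> {ae mu, forall x, D x -> f x = 0}.
Proof.
move=> Lf /eqP; rewrite /=/dot/Rintegral => h.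
have If := L2_mul mD Lf Lf.
have : (\int[mu]_(x in D) `|(f x * f x)%:E| = 0)%E.
  rewrite (eq_integral (fun x => (f x * f x)%:E)); last first.
    by move=> x _; rewrite gee0_abs// lee_fin -expr2 sqr_ge0.
  by rewrite -[LHS](fineK (integrable_fin_num mD If)) (eqP h).
move=> /(ae_eq_integral_abs mu mD (measurable_int mu If)).
apply: filterS => x H Dx; have [] := H Dx; move=> /eqP.
by rewrite mulf_eq0 orbb => /eqP.
Qed.

Lemma dot_ae0 f g : L2 mu D f -> L2 mu D g ->
  {ae mu, forall x, D x -> f x = g x} -> dot (f \- g) (f \- g) = 0.
Proof.
move=> Lf Lg fg.
have -> : 0 = dot (fun=> 0) (fun=> 0).
  by rewrite /dot/=; under eq_Rintegral do rewrite mulr0; rewrite Rintegral_cst// mul0r.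
have fg0 : {ae mu, forall x, D x -> (f \- g) x = 0}.
  by move: fg; apply: filterS => x h Dx /=; rewrite h// subrr.
apply: dot_ae => //; [exact: L2_B|exact: L2_0|exact: L2_B|exact: L2_0].
Qed.

End L2_norm.

(** * Monotone-class induction in L^2 *)

Section L2_density.
Context {R : realType} {disp : measure_display} {X : measurableType disp}.
Variables (mu : {measure set X -> \bar R}) (D : set X) (mD : measurable D).
Implicit Types f g h : X -> R.
Local Notation dot := (dot mu D).

Lemma Rintegral_dominated (f_ : nat -> X -> R) f g :
  (forall n, measurable_fun D (f_ n)) ->
  (forall x, D x -> f_ ^~ x @ \oo --> f x) ->
  mu.-integrable D (EFin \o g) ->
  (forall n x, D x -> `|f_ n x| <= g x) ->
  \int[mu]_(x in D) f_ n x @[n --> \oo] --> \int[mu]_(x in D) f x.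
Proof.
move=> mf_ cf ig fg; apply: fine_cvg.
have mf : measurable_fun D f by apply: measurable_fun_cvg cf.
have mf_' n : measurable_fun D (EFin \o f_ n) by exact/measurable_EFinP.
have cf' : {ae mu, forall x, D x -> (EFin \o f_ n) x @[n --> \oo] --> (EFin \o f) x}.
  by apply: aeW => x Dx; apply: cvg_EFin; [exact: nearW|exact: cf].
have fg' : {ae mu, forall x n, D x -> (`|(EFin \o f_ n) x| <= (EFin \o g) x)%E}.
  by apply: aeW => x n Dx; rewrite lee_fin fg.
have mf' : measurable_fun D (EFin \o f) by exact/measurable_EFinP.
have [If _] := dominated_convergence mD mf_' mf' cf' ig fg'.
by rewrite fineK//; exact: integrable_fin_num.
Qed.

Lemma L2_dominated_cvg (h_ : nat -> X -> R) f g : L2 mu D g ->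
  (forall n, measurable_fun D (h_ n)) -> measurable_fun D f ->
  (forall x, D x -> h_ ^~ x @ \oo --> f x) ->
  (forall n x, D x -> `|h_ n x| <= g x) ->
  dot (f \- h_ n) (f \- h_ n) @[n --> \oo] --> 0.
Proof.
move=> Lg mh mf cf hg.
have fg x : D x -> `|f x| <= g x.
  move=> Dx; have := cf x Dx => /cvg_norm; move=> /(@cvg_lim _ (@Rhausdorff R)) <-.
  apply: limr_le; last by apply: nearW => n; exact: hg.
  by apply: cvgP; apply: cvg_norm; exact: cf.
have -> : 0 = \int[mu]_(x in D) (0 : R) by rewrite Rintegral_cst// mul0r.
apply: (@Rintegral_dominated _ _ (fun x => 4 * (g x * g x))).
- by move=> n; apply: measurable_funM; exact: measurable_funB.
- move=> x Dx; have c : (f x - h_ n x) @[n --> \oo] --> (0 : R).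
    by rewrite -(subrr (f x)); apply: cvgB; [exact: cvg_cst|exact: cf].
  by rewrite -[0](mulr0 0); exact: cvgM.
- have := integrableZl mD 4 (L2_mul mD Lg Lg); exact: eq_integrable.
- move=> n x Dx /=; rewrite normrM.
  have := ler_normB (f x) (h_ n x); have := fg _ Dx; have := hg n _ Dx.
  have := normr_ge0 (f x - h_ n x); nra.
Qed.

Lemma L2_le f g : measurable_fun D f -> L2 mu D g ->
  (forall x, D x -> `|f x| <= g x) -> L2 mu D f.
Proof.
move=> mf [mg Ig] fg; split=> //.
apply: (le_integrable mD _ _ Ig).
  by apply/measurable_EFinP; exact: measurable_funX.
move=> x Dx; rewrite lee_fin !normrX.
by rewrite lerXn2r ?nnegrE//; apply: le_trans (fg _ Dx) (ler_norm _).
Qed.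

Lemma L2_norm f : L2 mu D f -> L2 mu D (fun x => `|f x|).
Proof.
move=> [mf If]; split; first exact: measurableT_comp.
by under eq_fun do rewrite -normrX ger0_norm ?sqr_ge0//.
Qed.

Hypothesis muD : (mu D < +oo)%E.

Lemma L2_cst (c : R) : L2 mu D (fun=> c).
Proof.
split=> //; apply/integrableP; split=> //.
under eq_integral do rewrite abse_EFin.
by rewrite integral_cst// lte_mul_pinfty.
Qed.

Lemma L2_indic (A : set X) : measurable A -> L2 mu D (\1_A).
Proof.
move=> mA; apply: (L2_le _ (L2_cst 1)) => //.
move=> x _; rewrite indicE; by case: (_ \in _); rewrite ?normr1 ?normr0.
Qed.

Variables (G : set (set X)) (P : (X -> R) -> Prop).
Hypothesis GE : @measurable _ X = <<s G >>.
Hypothesis GI : setI_closed G.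
Hypothesis P1 : P (fun=> 1).
Hypothesis PG : forall A, G A -> P (\1_A).
Hypothesis Pcomb : forall a f g, L2 mu D f -> L2 mu D g -> P f -> P g ->
  P (fun x => a * f x + g x).
Hypothesis Plim : forall f, L2 mu D f ->
  (forall e, 0 < e -> exists h, [/\ L2 mu D h, P h & dot (f \- h) (f \- h) <= e]) -> P f.

Let Pdom (h_ : nat -> X -> R) f g : L2 mu D g ->
  (forall n, measurable_fun D (h_ n)) -> (forall n, P (h_ n)) ->
  measurable_fun D f ->
  (forall x, D x -> h_ ^~ x @ \oo --> f x) ->
  (forall n x, D x -> `|h_ n x| <= g x) -> L2 mu D f -> P f.
Proof.
move=> Lg mh Ph mf cf hg Lf; apply: Plim => // e e0.
have /cvgrPdist_le/(_ _ e0)[N _ /(_ N (leqnn _))/=] := L2_dominated_cvg Lg mh mf cf hg.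
rewrite sub0r normrN ger0_norm ?dot_ge0// => H.
exists (h_ N); split=> //; apply: (L2_le (mh N) Lg) => x; exact: hg.
Qed.

Let Pext f g : f =1 g -> P f -> P g.
Proof. by move=> /funext ->. Qed.

Let P0 : P (fun=> 0).
Proof.
have := Pcomb (-1) (L2_cst 1) (L2_cst 1) P1 P1.
by under eq_fun do rewrite mulr1 addNr.
Qed.

Let Pindic (A : set X) : measurable A -> P (\1_A).
Proof.
rewrite GE => sA; move: A sA; apply: (@dynkin_induction _ _ G (fun A => P (\1_A))) => //.
- by rewrite (_ : \1_setT = fun=> 1)//; apply/funext => x; rewrite indicE in_setT.
- move=> S mS PS; have := Pcomb (-1) (L2_indic mS) (L2_cst 1) PS P1.
  apply: Pext => x; rewrite !indicE in_setC.
  by case: (_ \in _) => /=; ring.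
- move=> F mF tF PF.
  have indS n (x : X) : \1_(\big[setU/set0]_(i < n) F i) x = \sum_(i < n) \1_(F i) x :> R.
    elim: n => [|n IH]; first by rewrite !big_ord0 indic0.
    rewrite !big_ord_recr/= -IH !indicE in_setU.
    set U := \big[setU/set0]_(i < n) F i.
    have [xU|xU] := boolP (x \in U); have [xF|xF] := boolP (x \in F n);
      rewrite /= ?addr0 ?add0r//.
    move: xU xF; rewrite !inE /U -bigcup_mkord => -[k /= kn Fkx] Fnx.
    have kE : k = n by apply: tF => //; exists x.
    by move: kn; rewrite kE ltnn.
  (* The partial unions are dominated by 1, which is square-integrable because [mu D] is finite. *)
  apply: (@Pdom (fun n => \1_(\big[setU/set0]_(i < n) F i)) _ (fun=> 1)).
  + exact: L2_cst.
  + by move=> n; apply: measurable_indic; exact: bigsetU_measurable.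
  + elim=> [|n IH].
      by rewrite big_ord0 indic0.
    have mU : measurable (\big[setU/set0]_(i < n) F i) by exact: bigsetU_measurable.
    have := Pcomb 1 (L2_indic (mF n)) (L2_indic mU) (PF n) IH.
    apply: Pext => x; rewrite !indS big_ord_recr/= mul1r addrC//.
  + by apply: measurable_indic; exact: bigcupT_measurable.
  + move=> x _; rewrite indicE; case: (pselect ((\bigcup_k F k) x)) => Ux.
      rewrite mem_set//; have [k _ Fkx] := Ux.
      apply: cvg_near_cst; exists k.+1 => // n /= kn; rewrite indicE mem_set//.
      by rewrite -bigcup_mkord; exists k.
    rewrite memNset//; apply: cvg_near_cst; apply: nearW => n; rewrite indicE memNset//.
    by rewrite -bigcup_mkord => -[k _ Fkx]; apply: Ux; exists k.
  + by move=> n x _; rewrite indicE; case: (_ \in _); rewrite ?normr1 ?normr0.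
  + by apply: L2_indic; exact: bigcupT_measurable.
Qed.

Let Psum (n : nat) (c : nat -> R) (A : nat -> set X) :
  (forall i, measurable (A i)) -> P (fun x => \sum_(i < n) c i * \1_(A i) x) /\
  L2 mu D (fun x => \sum_(i < n) c i * \1_(A i) x).
Proof.
move=> mA; elim: n => [|n [IHP IHL]].
  by under eq_fun do rewrite big_ord0; split; [exact: P0|exact: L2_cst].
under eq_fun do rewrite big_ord_recr/= addrC.
split; first by apply: Pcomb => //; [exact: L2_indic|exact: Pindic].
by apply: L2_comb => //; exact: L2_indic.
Qed.

Import HBNNSimple.

Let Pge0 f : L2 mu D f -> (forall x, D x -> 0 <= f x) -> P f.
Proof.
move=> Lf f0; have [mf _] := Lf.
have mf' : measurable_fun D (EFin \o f) by exact/measurable_EFinP.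
pose h := nnsfun_approx mD mf'.
have ch x : D x -> h ^~ x @ \oo --> f x.
  move=> Dx; have f0' t : D t -> (0 <= (EFin \o f) t)%E by move=> Dt; rewrite lee_fin f0.
  by have /fine_cvgP[_] := cvg_nnsfun_approx mD mf' f0' Dx.
have hf n x : D x -> `|h n x| <= f x.
  move=> Dx; rewrite ger0_norm//.
  have := ch x Dx => /(@cvg_lim _ (@Rhausdorff R)) <-.
  apply: nondecreasing_cvgn_le; last by apply: cvgP; exact: ch.
  move=> a b ab; have := nd_nnsfun_approx mD mf' ab => /lefP; exact.
apply: (@Pdom h _ f) => //.
- by move=> n; apply: measurable_funTS; exact: measurable_funPT.
- move=> n; pose s := finmap.enum_fset (fset_set (h n @` setT)).
  have mA i : measurable (h n @^-1` [set s`_i]) by exact: measurable_sfunP.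
  have [PS _] := @Psum (size s) (fun i => s`_i) (fun i => h n @^-1` [set s`_i]) mA.
  move: PS; congr P; apply/funext => x.
  by rewrite (fimfunEord (h n)).
Qed.

(** Dynkin's theorem carries [P] from the pi-system [G] to all measurable indicators, linearity
    carries it to simple functions, and dominated limits to nonnegative functions; [f] is then the
    difference of its two parts. The induction is used for the fundamental lemma, for separability,
    for approximation by steps in time and for the du Bois-Reymond lemma. *)
Lemma L2_ind f : L2 mu D f -> P f.
Proof.
move=> Lf; have [mf _] := Lf.
have Lp : L2 mu D (f^\+).
  apply: (L2_le _ (L2_norm Lf)); first exact: measurable_funrpos.
  by move=> x _; rewrite /funrpos ger0_norm ?le_max ?lexx ?orbT// ge_max ler_norm normr_ge0.
have Ln : L2 mu D (f^\-).
  apply: (L2_le _ (L2_norm Lf)); first exact: measurable_funrneg.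
  by move=> x _; rewrite /funrneg ger0_norm ?le_max ?lexx ?orbT// ge_max -normrN ler_norm normr_ge0.
have := @Pcomb (-1) _ _ Ln Lp.
rewrite (_ : (fun x => _) = f).
  by apply; [apply: Pge0 => // x _; rewrite /funrneg le_max lexx orbT|
    apply: Pge0 => // x _; rewrite /funrpos le_max lexx orbT].
apply/funext => x; rewrite mulN1r /funrpos /funrneg /Order.max oppr_lt0.
by case: ltgtP => h; lra.
Qed.

End L2_density.

(** * Completeness of L^2 *)

Lemma geometric_dominated_cvg {R : realType} (u : nat -> R) (c : R) :
  (forall n, `|u n.+1 - u n| <= c * 2^-1 ^+ n) ->
  exists l, u @ \oo --> l /\ forall n, `|l - u n| <= 2 * c * 2^-1 ^+ n.
Proof.
move=> du.
have c0 : 0 <= c by have := le_trans (normr_ge0 _) (du 0%N); rewrite expr0 mulr1.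
have hlt (k : nat) : 0 < (2^-1 : R) ^+ k by rewrite exprn_gt0.
(* The bound is the exact sum of the geometric majorant from [n] up to [n + j], so that the
   induction only adds one term. *)
have dj n j : `|u (n + j)%N - u n| <= 2 * c * (2^-1 ^+ n - 2^-1 ^+ (n + j)).
  elim: j => [|j IH]; first by rewrite addn0 !subrr normr0 mulr0.
  rewrite addnS; apply: le_trans (ler_distD (u (n + j)%N) _ _) _.
  have := du (n + j)%N; rewrite exprS; move: (hlt (n + j)%N) IH.
  by set a := `|_|; set b := `|_|; nra.
have dn n m : (n <= m)%N -> `|u m - u n| <= 2 * c * 2^-1 ^+ n.
  move=> nm; rewrite -(subnKC nm); apply: le_trans (dj _ _) _.
  rewrite ler_wpM2l ?mulr_ge0// gerBl ltW//.
have h0 : 2 * c * 2^-1 ^+ n @[n --> \oo] --> (0 : R).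
  by rewrite -(mulr0 (2 * c)); apply: cvgMr; apply: cvg_expr; rewrite ger0_norm ?invr_ge0// invf_lt1// ltr1n.
have cu : cvgn u.
  apply: cauchy_cvg; apply: cauchy_exP => e e0.
  have /cvgrPdist_lt/(_ _ e0)[N _ HN] := h0.
  exists (u N), N => // m /= Nm; rewrite /ball/= distrC.
  apply: le_lt_trans (dn _ _ Nm) _.
  by have := HN N (leqnn _); rewrite sub0r normrN; apply: le_lt_trans; exact: ler_norm.
exists (limn u); split=> // n.
have cn : `|u m - u n| @[m --> \oo] --> `|limn u - u n|.
  by apply: cvg_norm; apply: cvgB => //; exact: cvg_cst.
by apply: cvgr_to_le cn _; exists n => // m /= nm; exact: dn.
Qed.

Section L2_complete.
Context {R : realType} {disp : measure_display} {X : measurableType disp}.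
Variables (mu : {measure set X -> \bar R}) (D : set X) (mD : measurable D).
Implicit Types f g h : X -> R.
Local Notation dot := (dot mu D).

(** The weighted series [S], the sum of the [4 ^+ n * d n ^+ 2], has integral at most 2 because the
    squared steps are below [8^-1 ^+ n]. Where [S] is finite it bounds [d n] by
    [Num.sqrt S * 2^-1 ^+ n], and this single estimate gives both pointwise convergence and an
    integrable majorant for the square of [f - u n]. *)
Lemma L2_complete (u : nat -> X -> R) : (forall n, L2 mu D (u n)) ->
  (forall n, dot (u n.+1 \- u n) (u n.+1 \- u n) <= 8^-1 ^+ n) ->
  exists f, L2 mu D f /\
    dot (f \- u n) (f \- u n) @[n --> \oo] --> 0.
Proof.
move=> Lu du.
pose d n x := u n.+1 x - u n x.
have Ld n : L2 mu D (d n) by exact: L2_B.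
pose S x : \bar R := (\sum_(n <oo) (4 ^+ n * (d n x * d n x))%:E)%E.
have d0 n x : (0 <= (4 ^+ n * (d n x * d n x))%:E)%E.
  by rewrite lee_fin mulr_ge0 ?exprn_ge0// -expr2 sqr_ge0.
have md n : measurable_fun D (fun x => (4 ^+ n * (d n x * d n x))%:E).
  have [m _] := Ld n.
  by apply/measurable_EFinP; apply: measurable_funM => //; exact: measurable_funM.
have mS : measurable_fun D S.
  by apply: ge0_emeasurable_sum.
have S0 x : (0 <= S x)%E by apply: nneseries_ge0.
have IS : (\int[mu]_(x in D) S x < +oo)%E.
  rewrite integral_nneseries//.
  apply: (@le_lt_trans _ _ 2%:E); last exact: ltry.
  apply: lime_le; first by apply: is_cvg_nneseries => n _ _; exact: integral_ge0.
  apply: nearW => n.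
  have H k : (\int[mu]_(x in D) (4 ^+ k * (d k x * d k x))%:E <= (2^-1 ^+ k)%:E)%E.
    have Ik := L2_mul mD (Ld k) (Ld k).
    under eq_integral do rewrite EFinM.
    rewrite integralZl// -(fineK (integrable_fin_num mD Ik)) -EFinM lee_fin.
    have -> : (2^-1 : R) ^+ k = 4 ^+ k * 8^-1 ^+ k.
      by rewrite -exprMn; congr (_ ^+ _); lra.
    by rewrite ler_wpM2l ?exprn_ge0//; exact: du.
  rewrite big_mkord; apply: (@le_trans _ _ (\sum_(k < n) 2^-1 ^+ k)%:E).
    by rewrite -sumEFin; apply: lee_sum => k _; exact: H.
  rewrite lee_fin.
  suff -> : \sum_(k < n) (2^-1 : R) ^+ k = 2 - 2 * 2^-1 ^+ n by rewrite gerBl mulr_ge0// exprn_ge0.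
  elim: (n) => [|m IH]; first by rewrite big_ord0 expr0 mulr1 subrr.
  by rewrite big_ord_recr/= IH exprS; lra.
have IS' : mu.-integrable D S.
  apply/integrableP; split=> //.
  by under eq_integral do rewrite gee0_abs//.
have [N [mN N0 HN]] := integrable_ae mD IS'.
have Sf x : D x -> ~ N x -> S x \is a fin_num.
  by move=> Dx Nx; apply: contrapT => h; apply/Nx/HN => /= /(_ Dx).
have dS x n : D x -> ~ N x -> `|u n.+1 x - u n x| <= Num.sqrt (fine (S x)) * 2^-1 ^+ n.
  move=> Dx Nx; rewrite -(@ler_pXn2r _ 2) ?nnegrE ?mulr_ge0 ?exprn_ge0 ?sqrtr_ge0//.
  rewrite exprMn sqr_sqrtr ?fine_ge0// real_normK ?num_real// exprAC.
  have -> : (2^-1 : R) ^+ 2 = 4^-1 by lra.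
  rewrite -ler_pdivrMr ?exprn_gt0// -exprVn invrK mulrC.
  rewrite -lee_fin fineK ?Sf//.
  have := @nneseries_lim_ge R (fun n => (4 ^+ n * (d n x * d n x))%:E) xpredT 0 n.+1 (fun n _ _ => d0 n x).
  rewrite -/(S x); apply: le_trans.
  by rewrite big_mkord big_ord_recr/= leeDr// sume_ge0.
pose f x := if pselect (D x /\ ~ N x) is left _ then limn (u ^~ x) else 0.
(* Cutting the sequence off on the null set makes it converge everywhere on [D], so that its limit
   [f] is measurable. *)
pose v n := u n \* \1_(~` N).
have Pf x : D x -> ~ N x -> (u ^~ x) @ \oo --> f x /\
    forall n, `|f x - u n x| <= 2 * Num.sqrt (fine (S x)) * 2^-1 ^+ n.
  move=> Dx Nx; rewrite /f; case: pselect => [_|]; last by case.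
  have [l [cl Hl]] := geometric_dominated_cvg (fun n => dS x n Dx Nx).
  by rewrite (cvg_lim _ cl).
have mv n : measurable_fun D (v n).
  by have [m _] := Lu n; apply: measurable_funM => //; apply: measurable_indic; exact: measurableC.
have cv x : D x -> v ^~ x @ \oo --> f x.
  move=> Dx; rewrite /v/=; case: (pselect (N x)) => Nx.
    rewrite /f; case: pselect => [[]//|_].
    apply: cvg_near_cst; apply: nearW => n; rewrite indicE memNset ?mulr0//; exact.
  have [H _] := Pf x Dx Nx.
  by under eq_fun do rewrite indicE mem_set// mulr1.
have mf : measurable_fun D f by apply: measurable_fun_cvg cv.
have aefu n : {ae mu, forall x, D x -> ((f x - u n x) ^+ 2)%:E <= (4 * 4^-1 ^+ n)%:E * S x}%E.
  exists N; split=> // x /=; apply: contra_notP => Nx Dx.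
  have [_ /(_ n) fu] := Pf x Dx Nx.
  rewrite -(fineK (Sf _ Dx Nx)) -EFinM lee_fin -(real_normK (num_real (f x - u n x))).
  apply: (@le_trans _ _ ((2 * Num.sqrt (fine (S x)) * 2^-1 ^+ n) ^+ 2)).
    by rewrite lerXn2r ?nnegrE ?mulr_ge0 ?exprn_ge0 ?sqrtr_ge0.
  rewrite !exprMn sqr_sqrtr ?fine_ge0// exprAC.
  have -> : (2^-1 : R) ^+ 2 = 4^-1 by lra.
  have -> : (2 : R) ^+ 2 = 4 by lra.
  by rewrite mulrAC.
have mfu n : measurable_fun D (fun x => ((f x - u n x) ^+ 2)%:E).
  have [m _] := Lu n.
  by apply/measurable_EFinP; apply: measurable_funX; exact: measurable_funB.
have intfu n : (\int[mu]_(x in D) ((f x - u n x) ^+ 2)%:E <=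
    (4 * 4^-1 ^+ n)%:E * \int[mu]_(x in D) S x)%E.
  rewrite -ge0_integralZl_EFin// ?mulr_ge0 ?exprn_ge0//; apply: ae_ge0_le_integral => //.
  - by move=> x _; rewrite lee_fin sqr_ge0.
  - by move=> x _; rewrite mule_ge0// lee_fin mulr_ge0 ?exprn_ge0.
  - exact: measurable_funeM.
have Lfu n : L2 mu D (f \- u n).
  have [m _] := Lu n.
  split; first exact: measurable_funB.
  apply/integrableP; split; first exact: mfu.
  under eq_integral do rewrite gee0_abs ?lee_fin ?sqr_ge0//.
  apply: le_lt_trans (intfu n) _.
  by rewrite lte_mul_pinfty// lee_fin mulr_ge0 ?exprn_ge0.
exists f; split.
  have := L2_D mD (Lfu 0%N) (Lu 0%N); congr (L2 _ _ _).
  by apply/funext => x /=; rewrite subrK.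
pose s := fine (\int[mu]_(x in D) S x).
have sE : (\int[mu]_(x in D) S x = s%:E)%E.
  by rewrite fineK// ge0_fin_numE// integral_ge0.
have h0 : 4 * 4^-1 ^+ n * s @[n --> \oo] --> (0 : R).
  rewrite -(mul0r s) -[in X in _ --> X](mulr0 4); apply: cvgMl; apply: cvgMr.
  by apply: cvg_expr; rewrite ger0_norm ?invr_ge0// invf_lt1// ltr1n.
apply: (@squeeze_cvgr _ _ _ _ (cst 0) (fun n => 4 * 4^-1 ^+ n * s)); [|exact: cvg_cst|exact: h0].
apply: nearW => n; rewrite dot_ge0/=.
have := intfu n; rewrite sE -EFinM.
rewrite -lee_fin; apply: le_trans; rewrite /dot/Rintegral fineK.
  by rewrite le_eqVlt; apply/orP; left; apply/eqP; apply: eq_integral => x _; rewrite expr2.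
exact: (integrable_fin_num mD (L2_mul mD (Lfu n) (Lfu n))).
Qed.

End L2_complete.

Lemma count_bigcup_measurable d (X : measurableType d) (I : countType) (D : set I)
    (F : I -> set X) : (forall i, D i -> measurable (F i)) ->
  measurable (\bigcup_(i in D) F i).
Proof.
move=> mF; rewrite bigcup_mkcond; apply: countable_bigcupT_measurable => // i.
by case: ifPn => // /set_mem; exact: mF.
Qed.

(** * Borel sets of R^n and integration by parts *)

Section rV_borel.
Context {R : realType} {n : nat}.
Local Notation E := 'rV[R]_n.

Definition orthant (q : {ffun 'I_n -> rat}) : set E :=
  [set x | forall i, ratr (q i) < x 0 i].

Definition orthants : set (set E) := range orthant.

Definition obox (a b : 'I_n -> R) : set E :=
  [set x | forall i, a i < x 0 i < b i].

Definition cbox (a b : 'I_n -> R) : set E :=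
  [set x | forall i, a i <= x 0 i <= b i].

Lemma measurable_forall (T : finType) d1 (X : measurableType d1) (A : T -> set X) :
  (forall i, measurable (A i)) -> measurable [set x | forall i, A i x].
Proof.
move=> mA; rewrite (_ : [set _ | _] = \bigcap_i A i).
  by apply: fin_bigcap_measurable => //; exact: finite_finset.
by apply/seteqP; split=> x /= H i; [move=> _|]; exact: H.
Qed.

Lemma measurable_coord_preimage (i : 'I_n) (Y : set R) : measurable Y ->
  measurable [set x : E | Y (x 0 i)].
Proof. by move=> mY; rewrite -[X in measurable X]setTI; exact: (measurable_coord i). Qed.

Lemma measurable_obox a b : measurable (obox a b).
Proof.
apply: (@measurable_forall _ _ _ (fun i => [set x : E | a i < x 0 i < b i])) => i.
rewrite (_ : [set _ | _] = [set x : E | `]a i, b i[%classic (x 0 i)]).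
  exact: measurable_coord_preimage.
by apply/seteqP; split=> x /=; rewrite in_itv.
Qed.

Lemma measurable_cbox a b : measurable (cbox a b).
Proof.
apply: (@measurable_forall _ _ _ (fun i => [set x : E | a i <= x 0 i <= b i])) => i.
rewrite (_ : [set _ | _] = [set x : E | `[a i, b i]%classic (x 0 i)]).
  exact: measurable_coord_preimage.
by apply/seteqP; split=> x /=; rewrite in_itv.
Qed.

Lemma closed_cbox (a b : 'I_n -> R) : closed (cbox a b : set E).
Proof.
rewrite (_ : cbox a b = \bigcap_(j in setT) [set x : E | `[a j, b j]%classic (x 0 j)]).
  apply: closed_bigI => j _.
  apply: (@closed_comp _ _ (fun x : E => x 0 j) `[a j, b j]%classic).
    by move=> y _; exact: coord_continuous.
  exact: interval_closed.
by apply/seteqP; split=> y /= H j; have := H j; rewrite /= in_itv/=; [move=> ? _|apply].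
Qed.

Lemma measurable_orthant q : measurable (orthant q).
Proof.
apply: (@measurable_forall _ _ _ (fun i => [set x : E | ratr (q i) < x 0 i])) => i.
rewrite (_ : [set _ | _] = [set x : E | `]ratr (q i), +oo[%classic (x 0 i)]).
  exact: measurable_coord_preimage.
by apply/seteqP; split=> x /=; rewrite in_itv/= andbT.
Qed.

Lemma setI_orthants : setI_closed orthants.
Proof.
move=> _ _ [p _ <-] [q _ <-]; exists [ffun i => Num.max (p i) (q i)] => //.
apply/seteqP; split=> x /=.
  move=> H; split=> i; have := H i; rewrite ffunE; apply: le_lt_trans;
  by rewrite ler_rat le_max lexx ?orbT.
by move=> [Hp Hq] i; rewrite ffunE; case: (leP (p i) (q i)).
Qed.

(** The measurable structure is generated by preimages under single coordinates, a family that is in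
    general not closed under intersection. The rational orthants are closed under intersection, as
    [L2_ind] asks of a generator, and they are countable, as separability requires. *)
Lemma rV_measurableE : @measurable _ E = <<s orthants >>.
Proof.
apply/seteqP; split; last first.
  apply: smallest_sub.
    exact: sigma_algebra_measurable.
  by move=> _ [q _ <-]; exact: measurable_orthant.
apply: smallest_sub; first exact: smallest_sigma_algebra.
move=> B; rewrite -bigcup_seq/= => -[i _ [Y mY <-]]; rewrite setTI.
have mi : measurable_fun setT
    (fun x : g_sigma_algebraType orthants => (x : E) 0 i : measurableTypeR R).
  apply: (measurability _ (RGenOInfty.measurableE R)).
  move=> _ [_ [a ->] <-]; rewrite setTI.
  (* A half-space is the union of the orthants whose [i]-th bound exceeds [a]: the other bounds can
     be taken arbitrarily low. *)
  rewrite (_ : _ @^-1` _ = \bigcup_(q in [set q : {ffun 'I_n -> rat} | a < ratr (q i)]) orthant q).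
    apply: (@count_bigcup_measurable _ _ {ffun 'I_n -> rat}).
    by move=> q _; apply: sub_sigma_algebra; exists q.
  apply/seteqP; split=> x /=.
    rewrite in_itv/= andbT => ax.
    have H j : exists q : rat, (ratr q < x 0 j) && ((j == i) ==> (a < ratr q)).
      have [->|ji] := eqVneq j i.
        have [q] := rat_in_itvoo ax; rewrite in_itv/= => /andP[h1 h2].
        by exists q; rewrite h1 h2.
      have /rat_in_itvoo[q] : x 0 j - 1 < x 0 j by rewrite ltrBlDr ltrDl.
      by rewrite in_itv/= => /andP[h1 h2]; exists q; rewrite h2.
    have [q Hq] := choice H.
    exists [ffun j => q j] => /=.
      by have := Hq i; rewrite ffunE eqxx/= => /andP[].
    by move=> j; rewrite ffunE; have /andP[] := Hq j.
  move=> [q aq qx]; rewrite in_itv/= andbT; exact: lt_trans aq (qx i).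
by have := mi measurableT Y mY; rewrite setTI.
Qed.

(** Asking that the closed box lie in [U] leaves room for test functions supported in that box, as
    in [tensor_plateau_test]; rational corners keep the union countable. *)
Lemma open_bigcup_obox (U : set E) : open U ->
  U = \bigcup_(q in [set q : {ffun 'I_n -> rat} * {ffun 'I_n -> rat} |
    cbox (fun i => ratr (q.1 i)) (fun i => ratr (q.2 i)) `<=` U])
    obox (fun i => ratr (q.1 i)) (fun i => ratr (q.2 i)).
Proof.
move=> oU; apply/seteqP; split=> [x Ux|x [q qU qx]]; last first.
  by apply: qU => i; have /andP[/ltW -> /ltW ->] := qx i.
have /nbhs_ballP[r /= r0 rU] : nbhs x U by exact: open_nbhs_nbhs.
have Ha j : exists q : rat, x 0 j - r < ratr q < x 0 j.
  have /rat_in_itvoo[q] : x 0 j - r < x 0 j by rewrite ltrBlDr ltrDl.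
  by rewrite in_itv/=; exists q.
have Hb j : exists q : rat, x 0 j < ratr q < x 0 j + r.
  have /rat_in_itvoo[q] : x 0 j < x 0 j + r by rewrite ltrDl.
  by rewrite in_itv/=; exists q.
have [a aP] := choice Ha; have [b bP] := choice Hb.
exists ([ffun i => a i], [ffun i => b i]) => /=.
  move=> y /= Hy; apply: rU; split=> // k j; rewrite ord1.
  have := Hy j; rewrite !ffunE => /andP[h1 h2].
  have /andP[h3 h4] := aP j; have /andP[h5 h6] := bP j.
  rewrite /ball/= ltr_norml; apply/andP; split; lra.
move=> i; rewrite !ffunE; have /andP[h3 h4] := aP i; have /andP[h5 h6] := bP i.
by rewrite h4 h5.
Qed.

Lemma open_measurable_rV (U : set E) : open U -> measurable U.
Proof.
move=> /open_bigcup_obox ->; apply: (@count_bigcup_measurable _ _ ({ffun 'I_n -> rat} * {ffun 'I_n -> rat})%type).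
by move=> q _; exact: measurable_obox.
Qed.

Lemma continuous_measurable_rV (f : E -> R) : continuous f -> measurable_fun setT f.
Proof.
move=> cf; apply: (measurability _ (RGenOInfty.measurableE R)).
move=> _ [_ [a ->] <-]; rewrite setTI; apply: open_measurable_rV.
by move/continuousP : cf; apply; exact: interval_open.
Qed.

Lemma coord_le_norm (x : E) i : `|x 0 i| <= `|x|.
Proof.
rewrite [leRHS]/Num.norm/= mx_normrE.
exact: (le_bigmax _ (fun ij : 'I_1 * 'I_n => `|x ij.1 ij.2|) (0, i)).
Qed.

Definition cube (M : R) : set E := cbox (fun=> - M) (fun=> M).

Lemma bounded_sub_cube (A : set E) : bounded_set A -> exists2 M, 0 <= M & A `<=` cube M.
Proof.
move=> [M [Mr HM]]; exists (`|M| + 1) => [|x Ax i]; first by rewrite addr_ge0.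
have := HM (`|M| + 1) _ x Ax.
have M1 : M < `|M| + 1 by rewrite (le_lt_trans (ler_norm _))// ltrDl.
move=> /(_ M1) /= xM; rewrite -ler_norml.
exact: le_trans (coord_le_norm x i) xM.
Qed.

End rV_borel.

Lemma cons_cube {R : realType} n (M : R) :
  @cons_rV R n @^-1` cube M = `[- M, M]%classic `*` cube M.
Proof.
apply/seteqP; split=> [[t v] H|[t v] [/= + vM] i]; last first.
  rewrite in_itv/= /cons_rV => tM; case: (@split_ordP 1 n i) => j ->.
    by rewrite (@row_mxEl _ 1 1 n) mxE.
  by rewrite (@row_mxEr _ 1 1 n); exact: vM.
split=> /=.
  have := H (lshift n (0 : 'I_1)).
  by rewrite /cons_rV (@row_mxEl _ 1 1 n) mxE/= in_itv.
move=> i; have := H (rshift 1 i).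
by rewrite /cons_rV (@row_mxEr _ 1 1 n).
Qed.

Lemma lebesgue_rV_cube {R : realType} n (M : R) :
  (lebesgue_rV n (cube M : set 'rV[R]_n) < +oo)%E.
Proof.
elim: n => [|n IH]; first by rewrite /= diracE ltry.
rewrite /= /lebesgue_rV_step /pushforward cons_cube product_measure1E//; last first.
  exact: measurable_cbox.
rewrite lte_mul_pinfty//.
rewrite ge0_fin_numE//; have := @lebesgue_measure_itv R `[- M, M] => /= ->.
by case: ifP => // _; rewrite -EFinD ltry.
Qed.

(** * Integration of derivatives of compactly supported functions *)

Lemma FTC2_everywhere {R : realType} (F f : R -> R) (a b : R) : a < b ->
  (forall t : R, is_derive t (1 : R) F (f t)) -> continuous f ->
  (\int[lebesgue_measure]_(t in `[a, b]) (f t)%:E = (F b - F a)%:E)%E.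
Proof.
move=> ab dF cf.
have cF t : {for t, continuous F}.
  by have [d _] := dF t; exact/differentiable_continuous/derivable1_diffP.
rewrite (@continuous_FTC2 _ f F)//.
- exact: continuous_subspaceT.
- split.
  + by move=> t _; have [] := dF t.
  + exact: cvg_at_right_filter (cF a).
  + exact: cvg_at_left_filter (cF b).
- by move=> t _; rewrite derive1E; have [_ ->] := dF t.
Qed.

(** Along the line through [y] the map [g] is affine, so the two difference quotients coincide;
    differentiability of [h] is asked in one direction only. *)
Lemma is_derive_reparam {R : realType} (V W : normedModType R) (g : W -> V) (h : V -> R)
    (y e' : W) (e : V) (df : R) :
  (forall s : R, g (s *: e' + y) = s *: e + g y) ->
  is_derive (g y) e h df -> is_derive y e' (h \o g) df.
Proof.
move=> gE [dh Dh].
have E : (fun s : R => s^-1 *: (((h \o g) \o shift y) (s *: e') - (h \o g) y)) =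
    (fun s : R => s^-1 *: ((h \o shift (g y)) (s *: e) - h (g y))).
  by apply/funext => s /=; rewrite gE.
by split; rewrite ?/derivable ?/derive E.
Qed.

Section ibp.
Context {R : realType}.

Lemma cons_rVl n (t : R) (v : 'rV[R]_n) (j : 'I_1) : cons_rV (t, v) 0 (lshift n j) = t.
Proof. by rewrite /cons_rV (@row_mxEl _ 1 1 n) mxE. Qed.

Lemma cons_rVr n (t : R) (v : 'rV[R]_n) j : cons_rV (t, v) 0 (rshift 1 j) = v 0 j.
Proof. by rewrite /cons_rV (@row_mxEr _ 1 1 n). Qed.

Lemma cons_rV_shift0 n (s t : R) (v : 'rV[R]_n) :
  cons_rV (s + t, v) = s *: delta_mx 0 0 + cons_rV (t, v).
Proof.
apply/rowP => i; rewrite [RHS]mxE [X in _ = X + _]mxE [X in _ = _ * X + _]mxE.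
case: (@split_ordP 1 n i) => j ->.
  by rewrite !cons_rVl ord1/= mulr1.
by rewrite !cons_rVr/= mulr0 add0r.
Qed.

Lemma cons_rV_shiftr n (s t : R) (v : 'rV[R]_n) (j : 'I_n) :
  cons_rV (t, s *: delta_mx 0 j + v) = s *: delta_mx 0 (rshift 1 j) + cons_rV (t, v).
Proof.
apply/rowP => i; rewrite [RHS]mxE [X in _ = X + _]mxE [X in _ = _ * X + _]mxE.
case: (@split_ordP 1 n i) => k ->.
  by rewrite !cons_rVl/= -val_eqE/= ord1 mulr0 add0r.
rewrite !cons_rVr !mxE.
by rewrite (_ : rshift 1 k == rshift 1 j = (k == j))// -!val_eqE /= eqSS.
Qed.

(** Induction on the dimension, following the recursive construction of [lebesgue_rV]. If [i] is the
    first coordinate, the inner integral over it vanishes by the fundamental theorem of calculus;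
    otherwise the first coordinate is frozen and the induction hypothesis applies to the slice. A
    pair [h], [k], in place of a function and its partial derivative, is what passes to slices. *)
Lemma integral_partial_eq0 n (i : 'I_n) (h k : 'rV[R]_n -> R) (M C : R) :
  0 <= M ->
  (forall x, is_derive x (delta_mx 0 i : 'rV[R]_n) h (k x)) ->
  (forall x, continuous (fun s : R => k (s *: delta_mx 0 i + x))) ->
  measurable_fun setT k -> (forall x, `|k x| <= C) ->
  (forall x, ~ cube M x -> h x = 0 /\ k x = 0) ->
  (\int[lebesgue_rV n]_x (k x)%:E = 0)%E.
Proof.
elim: n => [|n IH] in i h k *; first by case: i.
move=> M0 dh ck mk kC h0.
have mkc : measurable_fun setT (k \o @cons_rV R n) by apply: measurableT_comp => //; exact: measurable_cons_rV.
have mcube m : measurable (cube M : set 'rV[R]_m) by exact: measurable_cbox.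
pose B := `[- M, M]%classic `*` (cube M : set 'rV[R]_n).
have mB : measurable B by exact: measurableX.
have kcB : k \o @cons_rV R n = (k \o @cons_rV R n) \_ B.
  apply/funext => p; rewrite patchE; case: ifPn => // pB.
  by rewrite /= (h0 _ _).2//; move: pB; rewrite notin_setE /B -cons_cube.
have If : (lebesgue_measure \x lebesgue_rV n)%E.-integrable setT (EFin \o (k \o @cons_rV R n)).
  rewrite kcB -restrict_EFin; apply/integrable_restrict => //.
  rewrite setTI; apply: measurable_bounded_integrable => //.
  - rewrite /B/= product_measure1E//; last exact: mcube.
    rewrite lte_mul_pinfty//; last exact: lebesgue_rV_cube.
    rewrite ge0_fin_numE//; have := @lebesgue_measure_itv R `[- M, M] => /= ->.
    by case: ifP => // _; rewrite -EFinD ltry.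
  - exact: measurable_funTS.
  - by exists C; split; [exact: num_real|move=> z Cz p _; apply: le_trans (kC _) (ltW Cz)].
transitivity (\int[lebesgue_measure \x lebesgue_rV n]_p ((k \o @cons_rV R n) p)%:E)%E.
  rewrite (@integral_pushforward _ _ _ _ _ (@cons_rV R n) (@measurable_cons_rV R n)
    (lebesgue_measure \x lebesgue_rV n)%E setT (fun x => (k x)%:E))//.
  exact/measurable_EFinP.
have [j ij|j ij] := @split_ordP 1 n i; last first.
  rewrite -(integral12_prod_meas1 If) /fubini_F.
  rewrite integral0_eq// => t _.
  apply: (IH j (h \o (fun v => cons_rV (t, v))) (k \o (fun v => cons_rV (t, v)))) => //.
  - move=> v; apply: (@is_derive_reparam _ _ _ (fun v => cons_rV (t, v)) h v _ (delta_mx 0 i)) => // s.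
    by rewrite ij cons_rV_shiftr.
  - move=> v; have := ck (cons_rV (t, v)); rewrite ij.
    by under eq_fun do rewrite -cons_rV_shiftr.
  - by apply: measurableT_comp => //; apply: (measurableT_comp (@measurable_cons_rV R n)); exact: pair1_measurable.
  - by move=> v /= ; exact: kC.
  - move=> v vM; apply: h0 => H; apply: vM.
    by have := cons_cube n M; move/seteqP => [/(_ (t, v) H)[]].
rewrite -(integral21_prod_meas1 If) /fubini_G.
rewrite integral0_eq// => v _.
have i0 : i = 0 by apply/val_inj; rewrite ij /= ord1.
pose f t := k (cons_rV (t, v)); pose F t := h (cons_rV (t, v)).
have out t : ~ `[- M, M]%classic t -> F t = 0 /\ f t = 0.
  move=> tM; apply: h0 => H; apply: tM.
  by have := cons_cube n M; move/seteqP => [/(_ (t, v) H)[]].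
(* [F] is known to vanish only strictly outside [[- M, M]]; moving the endpoints out by 1 makes both
   boundary terms zero. *)
have -> : (\int[lebesgue_measure]_t (f t)%:E = \int[lebesgue_measure]_(t in `[(- (M + 1))%R, (M + 1)%R]) (f t)%:E)%E.
  rewrite [RHS]integral_mkcond; apply: eq_integral => t _; rewrite patchE.
  case: ifPn => //; rewrite notin_setE => tM; rewrite (out t _).2//.
  move: tM; apply: contra_not; rewrite /= !in_itv/= => /andP[h1 h2]; apply/andP; split; lra.
have dF (t : R) : is_derive t (1 : R) F (f t).
  apply: (@is_derive_reparam _ _ _ (fun t => cons_rV (t, v)) h t _ (delta_mx 0 i)) => // s.
  by rewrite i0 -cons_rV_shift0 scaler1.
have cf : continuous f.
  have := ck (cons_rV (0, v)); rewrite i0; under eq_fun do rewrite -cons_rV_shift0 addr0.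
  by [].
rewrite (FTC2_everywhere _ dF cf); last lra.
by rewrite (out (M + 1) _).1 ?(out (- (M + 1)) _).1 ?subrr//= in_itv/= => /andP[]; lra.
Qed.

End ibp.

(** * Calculus of test functions *)

Section test_functions.
Context {R : realType} {d : nat}.
Local Notation E := 'rV[R]_d.
Implicit Types (phi psi : E -> R) (i : 'I_d).

Lemma smooth_is_derive phi : smooth phi ->
  forall x i, is_derive x (delta_mx 0 i : E) phi (partial i phi x).
Proof.
move=> sp x i; split=> //; apply: diff_derivable; exact: (sp [::]).
Qed.

Lemma smooth_partial phi i : smooth phi -> smooth (partial i phi).
Proof. by move=> sp s x; rewrite -foldr_rcons; exact: sp. Qed.

Lemma smooth_continuous phi : smooth phi -> continuous phi.
Proof. by move=> sp x; apply: differentiable_continuous; exact: (sp [::]). Qed.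

Lemma partial_comb (a : R) phi psi i : smooth phi -> smooth psi ->
  partial i (fun x => a * phi x + psi x) =
  (fun x => a * partial i phi x + partial i psi x).
Proof.
move=> sp sq; apply/funext => x; rewrite /partial.
have [dp _] := smooth_is_derive sp x i; have [dq _] := smooth_is_derive sq x i.
rewrite (_ : (fun x => _) = (a \*: phi) + psi); last by apply/funext.
by rewrite (deriveD (derivableZ (k := a) dp) dq) (deriveZ _ dp).
Qed.

Lemma smooth_comb (a : R) phi psi : smooth phi -> smooth psi ->
  smooth (fun x => a * phi x + psi x).
Proof.
move=> sp sq s x.
have -> : foldr partial (fun x => a * phi x + psi x) s =
    (fun x => a * foldr partial phi s x + foldr partial psi s x).
  elim: s => [|i s /= ->]//; apply: partial_comb.
    by move=> s' y; rewrite -foldr_cat; exact: sp.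
  by move=> s' y; rewrite -foldr_cat; exact: sq.
rewrite (_ : (fun x => _) = (a \*: foldr partial phi s) + foldr partial psi s); last by apply/funext.
by apply: differentiableD; [apply: differentiableZ; exact: sp|exact: sq].
Qed.

Variable Omega : set E.
Local Notation test_function := (test_function Omega).

Lemma test_comb (a : R) phi psi : test_function phi -> test_function psi ->
  test_function (fun x => a * phi x + psi x).
Proof.
move=> [sp cp pO] [sq cq qO].
have S : closure [set x | a * phi x + psi x != 0] `<=`
    closure [set x | phi x != 0] `|` closure [set x | psi x != 0].
  rewrite -closureU; apply: closureS => x /= h; apply: contrapT => /not_orP[/negP + /negP].
  by rewrite !negbK => /eqP p /eqP q; move: h; rewrite p q mulr0 addr0 eqxx.
split; first exact: smooth_comb.
- apply: (subclosed_compact _ _ S); first exact: closed_closure.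
  exact: compactU.
- by apply: subset_trans S _; rewrite subUset.
Qed.

Lemma partial_out phi i x : ~ closure [set x | phi x != 0] x -> partial i phi x = 0.
Proof.
move=> nx; rewrite /partial (near_eq_derive (g := cst 0)) ?derive_cst//.
have oC : open (~` closure [set x | phi x != 0]) by exact/closed_openC/closed_closure.
have : nbhs x (~` closure [set x | phi x != 0]) by exact: open_nbhs_nbhs.
apply: filterS => y /= ny; apply: contrapT => /eqP py; apply: ny; exact: subset_closure.
Qed.

Lemma test_partial phi i : test_function phi -> test_function (partial i phi).
Proof.
move=> [sp cp pO].
have S : closure [set x | partial i phi x != 0] `<=` closure [set x | phi x != 0].
  rewrite [X in _ `<=` X](closure_id _).1; last exact: closed_closure.
  by apply: closureS => x /= /eqP; apply: contra_notP => /partial_out ->.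
split; first exact: smooth_partial.
- by apply: (subclosed_compact _ _ S) => //; exact: closed_closure.
- exact: subset_trans S pO.
Qed.

Lemma test_out phi x : test_function phi -> ~ Omega x -> phi x = 0.
Proof.
move=> [_ _ pO] nx; apply: contrapT => /eqP px; apply/nx/pO; exact: subset_closure.
Qed.

Lemma test_cube phi : test_function phi ->
  exists2 M, 0 <= M & forall x, ~ cube M x -> phi x = 0.
Proof.
move=> [_ cp _]; have [M M0 HM] := bounded_sub_cube (compact_bounded cp).
exists M => // x; apply: contra_notP => /eqP px; apply: HM; exact: subset_closure.
Qed.

Lemma test_bounded phi : test_function phi -> exists C, forall x, `|phi x| <= C.
Proof.
move=> [sp cp pO].
have : compact (phi @` closure [set x | phi x != 0]).
  apply: continuous_compact => //; apply: continuous_subspaceT => x; exact: smooth_continuous.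
move=> /compact_bounded[M [_ HM]].
exists (`|M| + 1) => x.
have M1 : M < `|M| + 1 by rewrite (le_lt_trans (ler_norm _))// ltrDl.
have [->|px] := eqVneq (phi x) 0; first by rewrite normr0 addr_ge0.
by apply: (HM _ M1); exists x => //; exact: subset_closure.
Qed.

Lemma test_measurable phi : test_function phi -> measurable_fun setT phi.
Proof. by move=> [sp _ _]; apply: continuous_measurable_rV => x; exact: smooth_continuous. Qed.

Hypothesis oO : open Omega.
Hypothesis bO : bounded_set Omega.
Local Notation mu := (@lebesgue_rV R d).

Lemma domain_measurable : measurable Omega.
Proof. exact: open_measurable_rV. Qed.

Lemma domain_finite : (mu Omega < +oo)%E.
Proof.
have [M _ OM] := bounded_sub_cube bO.
apply: le_lt_trans (lebesgue_rV_cube d M); apply: le_measure => //; rewrite inE.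
  exact: domain_measurable.
exact: measurable_cbox.
Qed.

Lemma test_L2 phi : test_function phi -> L2 mu Omega phi.
Proof.
move=> tp; have [C HC] := test_bounded tp.
apply: (L2_le domain_measurable _ (L2_cst domain_measurable domain_finite C)) => //.
exact: measurable_funTS (test_measurable tp).
Qed.

(** By the product rule, the difference of the two sides is the integral of a partial derivative of
    [phi * psi]. That integrand vanishes off [Omega], so it may be integrated over the whole space,
    where [integral_partial_eq0] applies. *)
Lemma test_weak_grad phi : test_function phi ->
  is_weak_grad Omega phi (fun i => partial i phi).
Proof.
move=> tp; split=> [i|i psi tq]; first by apply: test_L2; exact: test_partial.
have mO := domain_measurable.
have tpp := test_partial i tp; have tqp := test_partial i tq.
apply/eqP; rewrite -addr_eq0; apply/eqP.
rewrite /dotL2 -RintegralD//; last 2 first.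
- by apply: L2_mul => //; exact: test_L2.
- by apply: L2_mul => //; exact: test_L2.
rewrite Rintegral_mkcond.
pose k x := phi x * partial i psi x + partial i phi x * psi x.
rewrite (_ : _ \_ _ = k); last first.
  apply/funext => x; rewrite patchE; case: ifPn => //; rewrite notin_setE => nx.
  by rewrite /k (test_out tp nx) (test_out tq nx) mul0r mulr0 addr0.
have [sp _ _] := tp; have [sq _ _] := tq.
have [spp _ _] := tpp; have [sqp _ _] := tqp.
have ck : continuous k.
  have cM (f g : E -> R) : continuous f -> continuous g -> continuous (fun x => f x * g x).
    by move=> cf cg x; exact: cvgM (cf x) (cg x).
  move=> x; apply: cvgD (cM _ _ _ _ x) (cM _ _ _ _ x); exact: smooth_continuous.
have [M M0 HM] := test_cube tp; have [C1 H1] := test_bounded tp.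
have [C2 H2] := test_bounded tq; have [C3 H3] := test_bounded tpp.
have [C4 H4] := test_bounded tqp.
have Mp : forall x, ~ cube M x -> partial i phi x = 0.
  move=> x xM; have := @partial_out phi i x; apply => Zx; apply: xM.
  have cM : closed (cube M : set E) by exact: closed_cbox.
  move/closure_id : cM => ->; apply: closureS Zx => y /= /eqP.
  by apply: contra_notP => /HM.
have dk (x : E) : is_derive x (delta_mx 0 i : E) (phi * psi) (k x).
  have dp := smooth_is_derive sp x i; have dq := smooth_is_derive sq x i.
  by apply: is_derive_eq; rewrite /k /GRing.scale/= [in X in _ + X]mulrC.
have ckl (x : E) : continuous (fun s : R => k (s *: delta_mx 0 i + x)).
  move=> s; apply: (@continuous_comp _ _ _ (fun s : R => s *: (delta_mx 0 i : E) + x) k).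
    by apply: cvgD; [exact: cvgZr_tmp|exact: cvg_cst].
  exact: ck.
have mk : measurable_fun setT k by exact: continuous_measurable_rV.
have kC x : `|k x| <= C1 * C4 + C3 * C2.
  apply: le_trans (ler_normD _ _) _; rewrite !normrM.
  by rewrite lerD// ler_pM.
have k0 x : ~ cube M x -> (phi * psi) x = 0 /\ k x = 0.
  by move=> xM; rewrite /k/= -[(phi * psi) x]/(phi x * psi x) HM// Mp// !mul0r addr0.
by rewrite /Rintegral (integral_partial_eq0 M0 dk ckl mk kC k0).
Qed.

End test_functions.

(** * Test functions and weak gradients *)

Section smooth1d.
Context {R : realType}.

(** The classical functions that are flat at 0. The factor [x^-1 ^+ n] is included because the
    derivative of the [n]-th function is a combination of those of indices [n.+1] and [n.+2], so
    that the family accounts for all derivatives. *)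
Definition flat (n : nat) (x : R) : R :=
  if 0 < x then x^-1 ^+ n * expR (- x^-1) else 0.

(** The exponential of [x^-1] dominates its Taylor term of degree [n.+2]. The factor [x ^+ 2],
    rather than [x], is what makes the difference quotient at 0 tend to 0. *)
Lemma flat_bound n x : `|flat n x| <= n.+2`!%:R * x ^+ 2.
Proof.
rewrite /flat; case: ltP => x0; last by rewrite normr0 mulr_ge0 ?sqr_ge0.
have y0 : 0 < x^-1 by rewrite invr_gt0.
rewrite ger0_norm; last by rewrite mulr_ge0 ?expR_ge0// exprn_ge0// ltW.
have := expR_ge1Dxn n.+1 (ltW y0).
have f0 : 0 < n.+2`!%:R :> R by rewrite ltr0n fact_gt0.
rewrite expRN => h.
rewrite ler_pdivrMr ?expR_gt0//.
apply: (@le_trans _ _ (n.+2`!%:R * x ^+ 2 * (x^-1 ^+ n.+2 / n.+2`!%:R))); last first.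
  apply: ler_wpM2l; first by rewrite mulr_ge0 ?sqr_ge0// ltW.
  by apply: le_trans h; rewrite lerDr.
rewrite le_eqVlt; apply/orP; left; apply/eqP.
rewrite !exprS; set e := x^-1 ^+ n; set c := n.+2`!%:R.
rewrite expr0; field; rewrite (gt_eqF x0)/=; apply/negPf; rewrite gt_eqF//.
Qed.

Lemma is_derive_flat n (x : R) :
  is_derive x (1 : R) (flat n) (flat n.+2 x - n%:R * flat n.+1 x).
Proof.
have [x0|x0|->] := ltgtP x 0.
- have nf : \near x, (cst 0 : R -> R) x = flat n x.
    have : \forall y \near x, y < 0 by exact: lt_nbhsl.
    by apply: filterS => y y0; rewrite /flat ltNge (ltW y0).
  rewrite /flat !ltNge (ltW x0)/= mulr0 subr0.
  exact: near_eq_is_derive nf (is_derive_cst _ _ _).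
- have nf : \near x, ((fun y => y^-1 ^+ n) * (fun y => expR (- y^-1)) : R -> R) x = flat n x.
    have : \forall y \near x, 0 < y by exact: lt_nbhsr.
    by apply: filterS => y y0; rewrite /flat y0.
  apply: near_eq_is_derive nf _.
  have dV : is_derive x (1 : R) (fun y : R => y^-1) (- x ^- 2).
    have := @is_deriveV _ id x 1 1; rewrite gt_eqF// => /(_ isT (is_derive_id _ _)).
    by rewrite /GRing.scale/= mulr1.
  have dX : is_derive x (1 : R) ((fun y : R => y^-1) ^+ n) (n%:R * x^-1 ^+ n.-1 * - x ^- 2).
    exact: is_deriveX.
  have dN : is_derive x (1 : R) (- (fun y : R => y^-1)) (- - x ^- 2) by exact: is_deriveN.
  have dE : is_derive x (1 : R) (expR \o (- (fun y : R => y^-1))) (expR (- x^-1) * - - x ^- 2).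
    exact: is_derive1_comp.
  have := is_deriveM dX dE.
  rewrite (_ : (fun y : R => y^-1) ^+ n = (fun y : R => y^-1 ^+ n)); last first.
    apply/funext => y; elim: (n) => [|m IH]; first by rewrite !expr0.
    by rewrite exprS [RHS]exprS -IH.
  move=> /is_derive_eq; apply; rewrite /flat x0 /GRing.scale/= opprK.
  case: n {dX} => [|n].
    by rewrite !expr0 !exprS expr0 !mul0r mulr0 addr0 subr0 !mulr1 mul1r invfM mulrC.
  rewrite /= !exprS !expr0 !mulr1 invfM; ring.
- rewrite /flat ltxx mulr0 subr0 -/(flat n).
  have H : (h^-1 *: ((flat n \o shift 0) (h *: 1) - flat n 0)) @[h --> 0^'] --> (0 : R).
    apply/cvgrPdist_le => e e0.
    have f0 : 0 < n.+2`!%:R :> R by rewrite ltr0n fact_gt0.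
    near=> h.
    have h0 : h != 0 by near: h; exact: nbhs_dnbhs_neq.
    rewrite sub0r normrN /= {2}/flat ltxx subr0 addr0 /GRing.scale/= mulr1 normrM normfV.
    rewrite mulrC ler_pdivrMr ?normr_gt0//; apply: le_trans (flat_bound _ _) _.
    rewrite -(real_normK (num_real h)) expr2 mulrA ler_wpM2r//.
    rewrite mulrC -ler_pdivlMr//; near: h; apply: dnbhs0_le.
    by rewrite divr_gt0.
  by split; [apply/cvg_ex; exists 0|apply/cvg_lim].
Unshelve. all: by end_near. Qed.

(** A class of functions visibly closed under differentiation, so that membership yields derivatives
    of every order without computing them. *)
Inductive elem : (R -> R) -> Prop :=
| elem_flat n a c : elem (fun x => flat n (a * x + c))
| elem_cst c : elem (fun=> c)
| elem_D f g : elem f -> elem g -> elem (f + g)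
| elem_M f g : elem f -> elem g -> elem (f * g).

Lemma elem_derive f : elem f ->
  exists f', elem f' /\ forall x : R, is_derive x (1 : R) f (f' x).
Proof.
elim=> [n a c|c|{}f g _ [f' [ef' df]] _ [g' [eg' dg]]|{}f g ef [f' [ef' df]] eg [g' [eg' dg]]].
- exists ((fun x => flat n.+2 (a * x + c)) * cst a +
      cst (- n%:R * a) * (fun x => flat n.+1 (a * x + c))); split.
    by apply: elem_D; apply: elem_M; [exact: elem_flat|exact: elem_cst|exact: elem_cst|exact: elem_flat].
  move=> x.
  have da : is_derive x (1 : R) (a \*: id + cst c) (a *: 1 + 0).
    by apply: is_deriveD.
  have := @is_derive1_comp _ (flat n) (a \*: id + cst c) x _ _ (is_derive_flat n _) da.
  move=> /is_derive_eq; apply; rewrite addr0 [a *: 1]mulr1.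
  rewrite -[RHS]/(flat n.+2 (a * x + c) * a + (- n%:R * a) * flat n.+1 (a * x + c)).
  rewrite -[(_ + _) x]/(a * x + c); ring.
- exists (fun=> 0); split; first exact: elem_cst.
  by move=> x; exact: is_derive_cst.
- exists (f' + g'); split; first exact: elem_D.
  by move=> x; exact: is_deriveD.
- exists (f * g' + g * f'); split; first by apply: elem_D; apply: elem_M.
  by move=> x; exact: is_deriveM.
Qed.

Lemma elem_derive1 f : elem f -> elem (derive1 f).
Proof.
move=> /elem_derive[f' [ef' df]]; rewrite (_ : derive1 f = f')//.
by apply/funext => x; rewrite derive1E; have [_ ->] := df x.
Qed.

Lemma elem_is_derive f : elem f -> forall x : R, is_derive x (1 : R) f (derive1 f x).
Proof.
move=> /elem_derive[f' [ef' df]] x.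
by have [d1 d2] := df x; split=> //; rewrite derive1E.
Qed.

Lemma elem_smooth f : elem f -> forall n (t : R), derivable (derive1n n f) t 1.
Proof.
move=> ef n; have : elem (derive1n n f).
  by elim: n => [|n IH] //; rewrite derive1nS; exact: elem_derive1.
by move=> e t; have [] := elem_is_derive e t.
Qed.

Lemma elem_continuous f : elem f -> continuous f.
Proof.
move=> ef x; have [df _] := elem_is_derive ef x.
exact/differentiable_continuous/derivable1_diffP.
Qed.

(** A smooth bump supported in [[a, b]]. Since [expR (- (n * y)^-1)] tends to 1 for positive [y],
    these functions stay between 0 and 1 and tend to the indicator of the open interval. *)
Definition plateau (a b : R) (n : nat) (x : R) : R :=
  flat 0 (n%:R * (x - a)) * flat 0 (n%:R * (b - x)).

Lemma elem_plateau a b n : elem (plateau a b n).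
Proof.
rewrite (_ : plateau a b n = (fun x => flat 0 (n%:R * x + - (n%:R * a))) *
  (fun x => flat 0 (- n%:R * x + n%:R * b))).
  by apply: elem_M; exact: elem_flat.
apply/funext => x; rewrite -[RHS]/(flat 0 _ * flat 0 _) /plateau.
by congr (flat 0 _ * flat 0 _); ring.
Qed.

Lemma flat0_ge0 x : 0 <= flat 0 x.
Proof. by rewrite /flat; case: ifP => // _; rewrite mul1r expR_ge0. Qed.

Lemma flat0_le1 x : flat 0 x <= 1.
Proof.
rewrite /flat; case: ifP => // x0.
by rewrite mul1r -expR0 ler_expR oppr_le0 invr_ge0 ltW.
Qed.

Lemma plateau_ge0 a b n x : 0 <= plateau a b n x.
Proof. by rewrite mulr_ge0// flat0_ge0. Qed.

Lemma plateau_le1 a b n x : plateau a b n x <= 1.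
Proof. by rewrite mulr_ile1// ?flat0_ge0 ?flat0_le1. Qed.

Lemma plateau_out a b n x : ~~ (a < x < b) -> plateau a b n x = 0.
Proof.
rewrite negb_and -!leNgt /plateau /flat => /orP[xa|bx].
  by rewrite ltNge mulr_ge0_le0 ?subr_le0//= mul0r.
by rewrite [X in _ * X]ifF ?mulr0// ltNge mulr_ge0_le0 ?subr_le0.
Qed.

Lemma flat0_cvg y : 0 < y -> flat 0 (n%:R * y) @[n --> \oo] --> (1 : R).
Proof.
move=> y0; apply/cvgrPdist_le => e e0.
near=> n.
have n0 : 0 < n%:R :> R by rewrite ltr0n; near: n; exact: nbhs_infty_gt.
have ny0 : 0 < n%:R * y by rewrite mulr_gt0.
rewrite ger0_norm ?subr_ge0 ?flat0_le1// /flat ny0 mul1r.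
have := expR_ge1Dx (- (n%:R * y)^-1).
suff : (n%:R * y)^-1 <= e by lra.
rewrite invf_ple ?posrE// -ler_pdivrMr//; near: n.
exact: nbhs_infty_ger.
Unshelve. all: by end_near. Qed.

Lemma plateau_cvg a b x : plateau a b n x @[n --> \oo] --> (\1_`]a, b[%classic x : R).
Proof.
rewrite indicE; case: (boolP (a < x < b)) => xab.
  rewrite mem_set ?in_itv// -[1%:R](mulr1 1).
  by apply: cvgM; apply: flat0_cvg; rewrite subr_gt0; case/andP: xab.
rewrite memNset/=; last by rewrite in_itv/=; exact/negP.
by apply: cvg_near_cst; apply: nearW => n; rewrite plateau_out.
Qed.

End smooth1d.

Section box_test_functions.
Context {R : realType} {d : nat}.
Local Notation E := 'rV[R]_d.
Local Notation mu := (@lebesgue_rV R d).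

Definition tensor (f_ : 'I_d -> R -> R) (x : E) : R := \prod_i f_ i (x 0 i).

Lemma tensor_differentiable f_ : (forall i, elem (f_ i)) ->
  forall x, differentiable (tensor f_) x.
Proof.
move=> ef x; rewrite /tensor.
elim: (index_enum _) => [|i s IH].
  under eq_fun do rewrite big_nil; exact: differentiable_cst.
under eq_fun do rewrite big_cons.
apply: (@differentiableM _ _ (fun x : E => f_ i (x 0 i))) => //.
apply: (@differentiable_comp _ _ _ _ (fun x : E => x 0 i) (f_ i)).
  exact: differentiable_coord.
have [df _] := elem_is_derive (ef i) (x 0 i).
exact/derivable1_diffP.
Qed.

(** Only the [k]-th factor varies along the line, so the partial derivative is again a tensor;
    smoothness of every order then reduces to [elem]. *)
Lemma tensor_partial f_ k : (forall i, elem (f_ i)) ->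
  partial k (tensor f_) = tensor (fun i => if i == k then derive1 (f_ i) else f_ i).
Proof.
move=> ef; apply/funext => x; rewrite /partial.
pose c := \prod_(i | i != k) f_ i (x 0 i).
have H (h : R) : tensor f_ (h *: delta_mx 0 k + x) = c * f_ k (h + x 0 k).
  rewrite /tensor (bigD1 k)//= mulrC; congr (_ * _).
    apply: eq_bigr => i ik; rewrite !mxE eqxx (negbTE ik) mulr0 add0r//.
  by rewrite !mxE !eqxx mulr1.
have := is_deriveZ c (elem_is_derive (ef k) (x 0 k)) => -[_].
rewrite /derive.
rewrite (_ : (fun h : R => h^-1 *: ((tensor f_ \o shift x) (h *: delta_mx 0 k) - tensor f_ x)) =
  (fun h : R => h^-1 *: ((c \*: f_ k \o shift (x 0 k)) (h *: 1) - (c \*: f_ k) (x 0 k)))).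
  move=> ->; rewrite /tensor [RHS](bigD1 k)//= eqxx [RHS]mulrC; congr (_ * _).
  by apply: eq_bigr => i /negbTE ->.
apply/funext => h /=; rewrite H -[in X in _ - X](add0r x) -{1}(scale0r (delta_mx 0 k : E)) H.
by rewrite add0r [h *: 1]mulr1.
Qed.

Lemma tensor_smooth f_ : (forall i, elem (f_ i)) -> smooth (tensor f_).
Proof.
move=> ef s x.
have [g_ [eg ->]] : exists g_, (forall i, elem (g_ i)) /\ foldr partial (tensor f_) s = tensor g_.
  elim: s => [|k s [g_ [eg IH]]]; first by exists f_.
  exists (fun i => if i == k then derive1 (g_ i) else g_ i); split.
    by move=> i; case: ifP => // _; exact: elem_derive1.
  by rewrite /= IH tensor_partial.
exact: tensor_differentiable.
Qed.

Lemma bounded_cbox (a b : 'I_d -> R) : bounded_set (cbox a b : set E).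
Proof.
pose M := \big[Num.max/0]_i Num.max `|a i| `|b i|.
exists M; split; first exact: num_real.
move=> N MN x xab; apply: le_trans (ltW MN).
rewrite [leLHS]/Num.norm/= mx_normrE.
apply: bigmax_le => [|[i j] _ /=].
  by rewrite /M; apply: (big_ind (fun z => 0 <= z)) => // u v u0 v0; rewrite le_max u0.
rewrite ord1; apply: le_trans (le_bigmax _ _ j).
have /andP[h1 h2] := xab j.
rewrite ler_norml le_max; apply/andP; split.
  by rewrite lerNl le_max; apply/orP; left; rewrite (@le_trans _ _ (- a j)) ?lerN2// -normrN ler_norm.
by apply/orP; right; apply: le_trans h2 (ler_norm _).
Qed.

Lemma tensor_plateau_test (Omega : set E) (a b : 'I_d -> R) (n : nat) : cbox a b `<=` Omega ->
  test_function Omega (tensor (fun i : 'I_d => plateau (a i) (b i) n)).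
Proof.
move=> abO.
have S : closure [set x | tensor (fun i : 'I_d => plateau (a i) (b i) n) x != 0] `<=` cbox a b.
  rewrite [X in _ `<=` X](closure_id _).1; last exact: closed_cbox.
  apply: closureS => x /= nz i.
  have [/andP[h1 h2]|h] := boolP (a i < x 0 i < b i); first by rewrite !ltW.
  by move: nz; rewrite /tensor (bigD1 i)//= plateau_out// mul0r eqxx.
split.
- by apply: tensor_smooth => i; exact: elem_plateau.
- apply: (subclosed_compact _ _ S); first exact: closed_closure.
  by apply: bounded_closed_compact; [exact: bounded_cbox|exact: closed_cbox].
- exact: subset_trans S abO.
Qed.

Lemma tensor_plateau_cvg (a b : 'I_d -> R) x :
  tensor (fun i : 'I_d => plateau (a i) (b i) n) x @[n --> \oo] --> (\1_(obox a b) x : R).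
Proof.
have -> : (\1_(obox a b) x : R) = \prod_i \1_(`]a i, b i[%classic) (x 0 i).
  rewrite indicE; case: (pselect (obox a b x)) => xab.
    by rewrite mem_set// big1// => i _; rewrite indicE mem_set//= in_itv; exact: xab.
  rewrite memNset//; have [i /negP xi] : exists i, ~ a i < x 0 i < b i by exact/existsNP.
  rewrite (bigD1 i)//= indicE memNset ?mul0r//=.
  by rewrite in_itv/=; exact/negP.
rewrite /tensor; elim: (index_enum _) => [|i s IH].
  by under eq_fun do rewrite big_nil; rewrite big_nil; exact: cvg_cst.
under eq_fun do rewrite big_cons; rewrite big_cons.
by apply: cvgM => //; exact: plateau_cvg.
Qed.

Lemma tensor_plateau_norm (a b : 'I_d -> R) (n : nat) (x : E) :
  `|tensor (fun i : 'I_d => plateau (a i) (b i) n) x| <= 1.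
Proof.
rewrite /tensor normr_prod; apply: prodr_ile1 => i; rewrite normr_ge0/=.
by rewrite ger0_norm ?plateau_ge0 ?plateau_le1.
Qed.

End box_test_functions.

(** * Fundamental lemma and uniqueness of weak gradients *)

Lemma ae_forall_count {d} {X : measurableType d} {R : realType}
    (mu : {measure set X -> \bar R}) (I : countType) (P : I -> X -> Prop) :
  (forall i, {ae mu, forall x, P i x}) -> {ae mu, forall x, forall i, P i x}.
Proof.
move=> H; have : {ae mu, forall x n, if (unpickle n : option I) is Some i then P i x else True}.
  apply: ae_foralln => n; case: (unpickle n) => [i|]; first exact: H.
  exact: aeW.
by apply: filterS => x Hx i; have := Hx (pickle i); rewrite pickleK.
Qed.

Section fundamental_lemma.
Context {R : realType} {d : nat} (Omega : set 'rV[R]_d).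
Hypotheses (oO : open Omega) (bO : bounded_set Omega).
Local Notation E := 'rV[R]_d.
Local Notation mu := (@lebesgue_rV R d).
Let mO := domain_measurable oO.
Let fO := domain_finite oO bO.

Lemma L2_mul_indic (B : set E) f : measurable B -> L2 mu Omega f ->
  L2 mu Omega (fun x => f x * \1_B x).
Proof.
move=> mB Lf; have [mf _] := Lf.
apply: (L2_le mO _ (L2_norm Lf)).
  by apply: measurable_funM => //; exact: measurable_indic.
move=> x _; rewrite indicE; case: (_ \in _); rewrite ?mulr1// mulr0 normr0//.
Qed.

Lemma L2_integrable f : L2 mu Omega f -> mu.-integrable Omega (EFin \o f).
Proof.
move=> Lf; have := L2_mul mO Lf (L2_cst mO fO 1).
by under eq_fun do rewrite mulr1.
Qed.

(** Plateaus tending to the indicator of a rational box show that [G] integrates to zero over it.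
    For a fixed box, the functions [f] such that [G * f] integrates to zero over it include the
    orthant indicators, since an orthant cuts the box in a smaller box; hence they include all of
    L^2, and in particular [G]. So [G] vanishes almost everywhere on each of the countably many
    boxes that make up [Omega]. *)
Lemma fundamental_lemma G : L2 mu Omega G ->
  (forall phi, test_function Omega phi -> dotL2 Omega G phi = 0) ->
  {ae mu, forall x, Omega x -> G x = 0}.
Proof.
move=> LG HG; have [mG _] := LG.
have box0 (a b : 'I_d -> R) : cbox a b `<=` Omega ->
    dot mu Omega G (fun x => \1_(obox a b) x) = 0.
  move=> abO.
  have c : dot mu Omega G (tensor (fun i : 'I_d => plateau (a i) (b i) n)) @[n --> \oo] -->
      dot mu Omega G (fun x => \1_(obox a b) x).
    apply: (Rintegral_dominated mO (g := fun x => `|G x|)).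
    - move=> n; apply: measurable_funM => //; apply: measurable_funTS.
      by apply: test_measurable; exact: tensor_plateau_test abO.
    - by move=> x _; apply: cvgM; [exact: cvg_cst|exact: tensor_plateau_cvg].
    - exact: L2_integrable (L2_norm LG).
    - by move=> n x _; rewrite normrM ler_piMr// tensor_plateau_norm.
  rewrite -(cvg_lim _ c)//; apply: cvg_lim => //.
  apply: cvg_near_cst; apply: nearW => n; apply: HG; exact: tensor_plateau_test.
have boxae (q : {ffun 'I_d -> rat} * {ffun 'I_d -> rat}) :
    cbox (fun i => ratr (q.1 i)) (fun i => ratr (q.2 i)) `<=` Omega ->
    {ae mu, forall x, Omega x ->
      obox (fun i => ratr (q.1 i)) (fun i => ratr (q.2 i)) x -> G x = 0}.
  set a := fun i => _; set b := fun i => _ => abO.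
  have mB : measurable (obox a b : set E) by exact: measurable_obox.
  pose P (f : E -> R) := dot mu Omega G (fun x => f x * \1_(obox a b) x) = 0.
  have PG : P G.
    apply: (@L2_ind _ _ _ mu Omega mO fO (@orthants R d) P rV_measurableE) => //.
    - exact: setI_orthants.
    - by rewrite /P; under eq_fun do rewrite mul1r; exact: box0.
    - move=> _ [c _ <-]; rewrite /P.
      rewrite (_ : (fun x => _) = \1_(obox (fun i => Num.max (a i) (ratr (c i))) b)).
        apply: box0 => x Hx; apply: abO => i; have := Hx i.
        by rewrite ge_max => /andP[/andP[-> _] ->].
      apply/funext => x; rewrite !indicE -natrM mulnb; congr ((nat_of_bool _)%:R).
      apply/idP/idP => [/andP[/set_mem h1 /set_mem h2]|/set_mem H].
        apply/mem_set => i; rewrite gt_max.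
        by have /andP[-> ->] := h2 i; rewrite h1.
      by apply/andP; split; apply/mem_set => i; have := H i;
        rewrite gt_max => /andP[/andP[h1 h2] h3]//; rewrite h1.
    - move=> k f g Lf Lg; rewrite /P => Pf Pg.
      under eq_fun do rewrite mulrDl -mulrA.
      by rewrite dot_combr// ?Pf ?Pg ?mulr0 ?addr0//; exact: L2_mul_indic.
    - move=> f Lf H; rewrite /P; apply/eqP; rewrite -sqrf_eq0; apply/eqP/le_anti.
      rewrite sqr_ge0 andbT; apply/ler_addgt0Pr => e e0; rewrite add0r.
      have C0 : 0 < dot mu Omega G G + 1 by rewrite ltr_wpDl ?dot_ge0.
      have [h [Lh Ph fh]] := H _ (divr_gt0 e0 C0).
      have Lfh := L2_B mO Lf Lh.
      have -> : dot mu Omega G (fun x => f x * \1_(obox a b) x) =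
          dot mu Omega G (fun x => (f \- h) x * \1_(obox a b) x).
        rewrite -[LHS]subr0 -Ph -dotBr//; [|exact: L2_mul_indic|exact: L2_mul_indic].
        by apply: eq_Rintegral => x _ /=; rewrite mulrBl.
      apply: le_trans (dot_CS mO LG (L2_mul_indic mB Lfh)) _.
      apply: (@le_trans _ _ ((dot mu Omega G G + 1) * (e / (dot mu Omega G G + 1)))); last first.
        by rewrite mulrC divfK ?gt_eqF.
      apply: ler_pM; rewrite ?dot_ge0 ?lerDl//; apply: le_trans fh.
      apply: le_Rintegral => //.
      + exact: (L2_mul mO (L2_mul_indic mB Lfh) (L2_mul_indic mB Lfh)).
      + exact: (L2_mul mO Lfh Lfh).
      + move=> x _ /=; rewrite indicE; case: (_ \in _); first by rewrite !mulr1.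
        by rewrite !mulr0 -expr2 sqr_ge0.
  have := dot_eq0 mO (L2_mul_indic mB LG).
  have -> : dot mu Omega (fun x => G x * \1_(obox a b) x) (fun x => G x * \1_(obox a b) x) = 0.
    rewrite -PG; apply: eq_Rintegral => x _.
    by rewrite indicE; case: (_ \in _); rewrite ?mulr1// !mulr0.
  move=> /(_ erefl); apply: filterS => x H Ox xab.
  by have := H Ox; rewrite indicE mem_set// mulr1.
have : {ae mu, forall x, forall q : ({ffun 'I_d -> rat} * {ffun 'I_d -> rat})%type,
    cbox (fun i => ratr (q.1 i)) (fun i => ratr (q.2 i)) `<=` Omega -> Omega x ->
    obox (fun i => ratr (q.1 i)) (fun i => ratr (q.2 i)) x -> G x = 0}.
  apply: ae_forall_count => q.
  case: (pselect (cbox (fun i => ratr (q.1 i)) (fun i => ratr (q.2 i)) `<=` Omega)) => h.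
    by have := boxae q h; apply: filterS => x Hx _.
  by apply: aeW => x /h.
apply: filterS => x Hx Ox; move: (Ox); rewrite (open_bigcup_obox oO) => -[q qO xq].
exact: (Hx q).
Qed.

(** This is what makes the chosen [grad] usable: up to null sets it may be exchanged for any weak
    gradient at hand. *)
Lemma weak_grad_unique u G H : is_weak_grad Omega u G -> is_weak_grad Omega u H ->
  forall i, {ae mu, forall x, Omega x -> G i x = H i x}.
Proof.
move=> [LG uG] [LH uH] i.
have : {ae mu, forall x, Omega x -> (G i \- H i) x = 0}.
  apply: fundamental_lemma; first exact: L2_B.
  move=> phi tp; have Lp := test_L2 oO bO tp.
  rewrite -[dotL2 _ _ _]/(dot mu Omega (G i \- H i) phi) dotBl//.
  have e : dotL2 Omega (G i) phi = dotL2 Omega (H i) phi.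
    by apply: oppr_inj; rewrite -(uG i phi tp) -(uH i phi tp).
  by apply/eqP; rewrite subr_eq0; apply/eqP.
by apply: filterS => x h Ox; apply/eqP; rewrite -subr_eq0; apply/eqP; exact: h.
Qed.

End fundamental_lemma.

Lemma dot_sq_comb_le {R : realType} {disp} {X : measurableType disp}
    (mu : {measure set X -> \bar R}) (D : set X) (mD : measurable D) (a : R) f g :
  L2 mu D f -> L2 mu D g ->
  dot mu D (fun x => a * f x + g x) (fun x => a * f x + g x) <=
  2 * a ^+ 2 * dot mu D f f + 2 * dot mu D g g.
Proof.
move=> Lf Lg; have := dot_ge0 mu D (fun x => (- a) * f x + g x).
rewrite (dot_sq_comb mD (- a) Lf Lg) (dot_sq_comb mD a Lf Lg).
by move: (dot mu D f f) (dot mu D f g) (dot mu D g g) => p q r; lra.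
Qed.

Section dotv_theory.
Context {R : realType} {d : nat} (Omega : set 'rV[R]_d) (mO : measurable Omega).
Local Notation E := 'rV[R]_d.
Local Notation mu := (@lebesgue_rV R d).
Local Notation dotv := (dotL2v Omega).
Implicit Types F G H : 'I_d -> E -> R.

Definition L2v F := forall i, L2 mu Omega (F i).

Lemma dotvC F G : dotv F G = dotv G F.
Proof. by apply: eq_bigr => i _; exact: dotC. Qed.

Lemma dotv_ge0 F : 0 <= dotv F F.
Proof. by apply: sumr_ge0 => i _; exact: dot_ge0. Qed.

Lemma dotv_combl a F G H : L2v F -> L2v G -> L2v H ->
  dotv (fun i x => a * F i x + G i x) H = a * dotv F H + dotv G H.
Proof.
move=> LF LG LH; rewrite /dotL2v mulr_sumr -big_split/=; apply: eq_bigr => i _.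
exact: dot_combl.
Qed.

Lemma dotv_young F G : L2v F -> L2v G -> 2 * `|dotv F G| <= dotv F F + dotv G G.
Proof.
move=> LF LG; rewrite /dotL2v -big_split/=.
apply: (@le_trans _ _ (2 * \sum_(i < d) `|dotL2 Omega (F i) (G i)|)).
  by rewrite ler_wpM2l//; exact: ler_norm_sum.
rewrite mulr_sumr; apply: ler_sum => i _; exact: dot_young.
Qed.

Lemma dotv_le2 F G : L2v F -> L2v G ->
  dotv (fun i => F i \- G i) (fun i => F i \- G i) <= 2 * dotv F F + 2 * dotv G G.
Proof.
move=> LF LG; rewrite /dotL2v !mulr_sumr -big_split/=; apply: ler_sum => i _.
exact: dot_le2.
Qed.

Lemma dotv_ae F F' G G' : L2v F -> L2v F' -> L2v G -> L2v G' ->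
  (forall i, {ae mu, forall x, Omega x -> F i x = F' i x}) ->
  (forall i, {ae mu, forall x, Omega x -> G i x = G' i x}) ->
  dotv F G = dotv F' G'.
Proof. by move=> *; apply: eq_bigr => i _; exact: dot_ae. Qed.

Lemma normL2v_sqr F : normL2v Omega F ^+ 2 = dotv F F.
Proof. by rewrite sqr_sqrtr ?dotv_ge0. Qed.

End dotv_theory.

(* A lock: conversion must not unfold [grad], which is a [get]. *)
Fact ip_key : unit. Proof. by []. Qed.

(** * The spaces H^1_0 and H^-1 *)

Section H10_theory.
Context {R : realType} {d : nat} (Omega : set 'rV[R]_d).
Hypotheses (oO : open Omega) (bO : bounded_set Omega).
Local Notation E := 'rV[R]_d.
Local Notation mu := (@lebesgue_rV R d).
Local Notation dotv := (dotL2v Omega).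
Local Notation dotO := (dotL2 Omega).
Local Notation H10 := (H10 Omega).
Let mO := domain_measurable oO.
Implicit Types u w : E -> R.

Lemma weak_grad_comb a u w G H : L2 mu Omega u -> L2 mu Omega w ->
  is_weak_grad Omega u G -> is_weak_grad Omega w H ->
  is_weak_grad Omega (fun x => a * u x + w x) (fun i x => a * G i x + H i x).
Proof.
move=> Lu Lw [LG uG] [LH wH]; split=> [i|i phi tp]; first exact: L2_comb.
have Lp := test_L2 oO bO tp; have Lpp := test_L2 oO bO (test_partial i tp).
rewrite -[LHS]/(dot mu Omega _ _) -[dotL2 _ (fun x => _ + _) _]/(dot mu Omega _ _).
rewrite !dot_combl// [dot _ _ u _]uG// [dot _ _ w _]wH//.
by rewrite opprD mulrN.
Qed.

Lemma weak_grad_ext u w G : L2 mu Omega u -> L2 mu Omega w ->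
  {ae mu, forall x, Omega x -> u x = w x} ->
  is_weak_grad Omega u G -> is_weak_grad Omega w G.
Proof.
move=> Lu Lw uw [LG uG]; split=> // i phi tp; rewrite -uG//.
have Lpp := test_L2 oO bO (test_partial i tp).
apply: dot_ae => //; last by apply: aeW.
by apply: filterS uw => x h /h.
Qed.

Lemma grad_weak u : H1 Omega u -> is_weak_grad Omega u (grad Omega u).
Proof. by move=> [_ H]; exact: (getPex H). Qed.

Lemma grad_L2v u : H1 Omega u -> L2v Omega (grad Omega u).
Proof. by move=> /grad_weak[]. Qed.

Lemma grad_ae u G : is_weak_grad Omega u G ->
  forall i, {ae mu, forall x, Omega x -> grad Omega u i x = G i x}.
Proof.
exact: (fun uG => weak_grad_unique oO bO (getPex (ex_intro _ G uG)) uG).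
Qed.

Lemma dotv_grad u w G H : is_weak_grad Omega u G -> is_weak_grad Omega w H ->
  dotv (grad Omega u) (grad Omega w) = dotv G H.
Proof.
move=> uG wH.
have gu : is_weak_grad Omega u (grad Omega u) by exact: (getPex (ex_intro _ G uG)).
have gw : is_weak_grad Omega w (grad Omega w) by exact: (getPex (ex_intro _ H wH)).
exact: (dotv_ae mO gu.1 uG.1 gw.1 wH.1 (grad_ae uG) (grad_ae wH)).
Qed.

Lemma H1_comb a u w : H1 Omega u -> H1 Omega w -> H1 Omega (fun x => a * u x + w x).
Proof.
move=> hu hw; split; first by apply: L2_comb; [exact: mO|exact: hu.1|exact: hw.1].
exists (fun i x => a * grad Omega u i x + grad Omega w i x).
by apply: weak_grad_comb; [exact: hu.1|exact: hw.1|exact: grad_weak|exact: grad_weak].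
Qed.

Lemma test_H1 phi : test_function Omega phi -> H1 Omega phi.
Proof.
move=> tp; split; first exact: test_L2.
by exists (fun i => partial i phi); exact: test_weak_grad.
Qed.

Definition ip u w := locked_with ip_key (dotv (grad Omega u) (grad Omega w)).

Lemma ipE u w : ip u w = dotv (grad Omega u) (grad Omega w).
Proof. by rewrite /ip unlock. Qed.

Lemma ipC u w : ip u w = ip w u.
Proof. by rewrite !ipE; exact: dotvC. Qed.

Lemma ip_ge0 u : 0 <= ip u u.
Proof. by rewrite ipE; exact: dotv_ge0. Qed.

Lemma ip_combl a u w v : H1 Omega u -> H1 Omega w -> H1 Omega v ->
  ip (fun x => a * u x + w x) v = a * ip u v + ip w v.
Proof.
move=> hu hw hv; rewrite !ipE.
rewrite -(dotv_combl mO a (grad_L2v hu) (grad_L2v hw) (grad_L2v hv)).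
apply: dotv_grad; last exact: grad_weak.
by apply: weak_grad_comb; [exact: hu.1|exact: hw.1|exact: grad_weak|exact: grad_weak].
Qed.

Lemma ip_sq_comb a u w : H1 Omega u -> H1 Omega w ->
  ip (fun x => a * u x + w x) (fun x => a * u x + w x) =
  a ^+ 2 * ip u u + 2 * a * ip u w + ip w w.
Proof.
move=> hu hw; have huw := H1_comb a hu hw.
pose v := (fun x => a * u x + w x).
have e1 : ip v v = a * ip u v + ip w v := ip_combl a hu hw huw.
have e2 : ip u v = a * ip u u + ip w u := etrans (ipC u v) (ip_combl a hu hw hu).
have e3 : ip w v = a * ip u w + ip w w := etrans (ipC w v) (ip_combl a hu hw hw).
rewrite -/v e1 e2 e3 (ipC w u).
by move: (ip u u) (ip u w) (ip w w) => p q r; ring.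
Qed.

Lemma ip_young u w : H1 Omega u -> H1 Omega w -> 2 * `|ip u w| <= ip u u + ip w w.
Proof. by move=> hu hw; rewrite !ipE; exact: (dotv_young mO (grad_L2v hu) (grad_L2v hw)). Qed.

Lemma subE u w : u \- w = (fun x => (-1) * w x + u x).
Proof. by apply/funext => x /=; rewrite mulN1r addrC. Qed.

Lemma ip_sqB u w : H1 Omega u -> H1 Omega w ->
  ip (u \- w) (u \- w) = ip u u - 2 * ip u w + ip w w.
Proof. move=> hu hw; rewrite subE (ip_sq_comb (-1) hw hu) (ipC w u).
by move: (ip u u) (ip u w) (ip w w) => p q r; ring. Qed.

Lemma ip_sqB_le u w : H1 Omega u -> H1 Omega w ->
  ip (u \- w) (u \- w) <= 2 * ip u u + 2 * ip w w.
Proof.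
move=> hu hw; rewrite (ip_sqB hu hw); have := ip_young hu hw.
have := lerNnormlW (lexx `|ip u w|).
by move: (ip u u) (ip u w) (ip w w) => p q r; lra.
Qed.

Lemma ip_sq_comb_le a u w : H1 Omega u -> H1 Omega w ->
  ip (fun x => a * u x + w x) (fun x => a * u x + w x) <= 2 * a ^+ 2 * ip u u + 2 * ip w w.
Proof.
move=> hu hw; have := ip_ge0 (fun x => (- a) * u x + w x).
rewrite (ip_sq_comb (- a) hu hw) (ip_sq_comb a hu hw).
by move: (ip u u) (ip u w) (ip w w) => p q r; lra.
Qed.

Lemma normL2v_grad u : normL2v Omega (grad Omega u) ^+ 2 = ip u u.
Proof. by rewrite ipE; exact: normL2v_sqr. Qed.

Lemma H10_H1 u : H10 u -> H1 Omega u. Proof. by case. Qed.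

Lemma H10_L2 u : H10 u -> L2 mu Omega u. Proof. by case=> -[]. Qed.

(** Squared distances replace the sum of norms in the definition: they are quadratic, so later
    estimates reduce to expansions of inner products. The tolerance [(n.+1%:R^-1) ^+ 2] turns back
    into a null sequence of norms. *)
Lemma H10P u : H1 Omega u -> (forall e, 0 < e -> exists phi, test_function Omega phi /\
    dotO (u \- phi) (u \- phi) + ip (u \- phi) (u \- phi) <= e) -> H10 u.
Proof.
move=> hu H; split=> //.
have H' (n : nat) : exists phi, test_function Omega phi /\
    dotO (u \- phi) (u \- phi) + ip (u \- phi) (u \- phi) <= (n.+1%:R^-1) ^+ 2.
  by apply: H; rewrite exprn_gt0.
have [phi Hphi] := choice H'; exists phi; split=> [n|]; first by have [] := Hphi n.
have b n : normL2 Omega (u \- phi n) + normL2v Omega (grad Omega (u \- phi n)) <= 2 * n.+1%:R^-1.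
  have [_ h] := Hphi n.
  have h1 := dot_ge0 mu Omega (u \- phi n); have h2 := ip_ge0 (u \- phi n).
  have i0 : 0 <= n.+1%:R^-1 :> R by [].
  rewrite mulr2n mulrDl mul1r lerD//.
    rewrite /normL2 -[leRHS](ger0_norm i0) -sqrtr_sqr ler_sqrt ?sqr_ge0//.
    by apply: le_trans h; rewrite lerDl.
  rewrite /normL2v -ipE -[leRHS](ger0_norm i0) -sqrtr_sqr ler_sqrt ?sqr_ge0//.
  by apply: le_trans h; rewrite lerDr.
have c0 : 2 * n.+1%:R^-1 @[n --> \oo] --> (0 : R).
  rewrite -(mulr0 2); apply: cvgMr; exact: cvg_harmonic.
apply: (@squeeze_cvgr _ _ _ _ (cst 0) (fun n => 2 * n.+1%:R^-1)); [|exact: cvg_cst|exact: c0].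
by apply: nearW => n; rewrite b andbT addr_ge0 ?sqrtr_ge0.
Qed.

Lemma H10_approx u : H10 u -> forall e, 0 < e -> exists phi, test_function Omega phi /\
    dotO (u \- phi) (u \- phi) + ip (u \- phi) (u \- phi) <= e.
Proof.
move=> [hu [phi [tp c]]] e e0.
have e2 : 0 < Num.sqrt (e / 2) by rewrite sqrtr_gt0 divr_gt0.
move/cvgrPdist_le : c => /(_ _ e2)[n _ /(_ n (leqnn _))] /=.
rewrite sub0r normrN ger0_norm ?addr_ge0 ?sqrtr_ge0// => h.
exists (phi n); split=> //.
have le1 (a b s : R) : 0 <= a -> 0 <= b -> Num.sqrt a + Num.sqrt b <= Num.sqrt s -> 0 <= s -> a <= s.
  move=> a0 b0 h' s0; rewrite -ler_sqrt//; apply: le_trans h'; rewrite lerDl sqrtr_ge0//.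
have h1 : dotO (u \- phi n) (u \- phi n) <= e / 2.
  by apply: le1 h _; rewrite ?dot_ge0 ?dotv_ge0 ?divr_ge0// ltW.
have h2 : ip (u \- phi n) (u \- phi n) <= e / 2.
  rewrite ipE; by apply: le1; last (by rewrite divr_ge0// ltW); last (by rewrite addrC; exact: h);
    rewrite ?dot_ge0 ?dotv_ge0.
lra.
Qed.

Lemma H10_comb a u w : H10 u -> H10 w -> H10 (fun x => a * u x + w x).
Proof.
move=> hu hw; apply: H10P; first by apply: H1_comb; exact: H10_H1.
move=> e e0.
(* Adding 1 to [a ^+ 2] keeps the tolerance below meaningful when [a = 0]. *)
have a0 : 0 < 4 * (a ^+ 2 + 1) by rewrite mulr_gt0// ltr_wpDl ?sqr_ge0.
have [p [tp up]] := H10_approx hu (divr_gt0 e0 a0).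
have [q [tq wq]] := H10_approx hw (divr_gt0 e0 (ltr0n _ 4 : 0 < 4 :> R)).
exists (fun x => a * p x + q x); split; first exact: test_comb.
have -> : (fun x => a * u x + w x) \- (fun x => a * p x + q x) =
    (fun x => a * (u \- p) x + (w \- q) x) by apply/funext => x /=; ring.
have Hup : H1 Omega (u \- p) by rewrite subE; apply: H1_comb; [exact: test_H1|exact: H10_H1].
have Hwq : H1 Omega (w \- q) by rewrite subE; apply: H1_comb; [exact: test_H1|exact: H10_H1].
have := ip_sq_comb_le a Hup Hwq.
have : dotO (fun x => a * (u \- p) x + (w \- q) x) (fun x => a * (u \- p) x + (w \- q) x) <=
    2 * a ^+ 2 * dotO (u \- p) (u \- p) + 2 * dotO (w \- q) (w \- q).
  exact: (dot_sq_comb_le mO a Hup.1 Hwq.1).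
move: up wq; set A := dotO _ _; set B := ip _ _; set C := dotO (w \- q) _; set D := ip (w \- q) _.
move=> up wq h1 h2.
apply: (le_trans (lerD h1 h2)).
have : a ^+ 2 * (A + B) <= e / 4.
  apply: (@le_trans _ _ ((a ^+ 2 + 1) * (e / (4 * (a ^+ 2 + 1))))).
    apply: ler_pM; rewrite ?sqr_ge0 ?lerDl// addr_ge0 ?dot_ge0 ?ip_ge0//.
  have k0 : a ^+ 2 + 1 != 0 by rewrite gt_eqF// ltr_wpDl ?sqr_ge0.
  by move: k0; move: (a ^+ 2 + 1) => k k0; rewrite (_ : k * _ = e / 4)//; field.
move: A B C D up wq h1 h2 => A B C D; lra.
Qed.

Lemma H10_B u w : H10 u -> H10 w -> H10 (u \- w).
Proof. by move=> hu hw; rewrite subE; exact: H10_comb. Qed.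

Lemma H10_D u w : H10 u -> H10 w -> H10 (u \+ w).
Proof.
move=> hu hw; rewrite (_ : _ \+ _ = (fun x => 1 * u x + w x)); first exact: H10_comb.
by apply/funext => x /=; rewrite mul1r.
Qed.

Lemma H10_N u : H10 u -> H10 (fun x => - u x).
Proof.
move=> hu; rewrite (_ : (fun x => _) = (fun x => (-2) * u x + u x)); first exact: H10_comb.
by apply/funext => x /=; ring.
Qed.

Lemma test_0 : test_function Omega (fun=> 0).
Proof.
have S : [set x : E | (0 : R) != 0] = set0 by apply/seteqP; split=> // x /=; rewrite eqxx.
split; last 2 first.
- by rewrite S closure0; exact: compact0.
- by rewrite S closure0.
move=> s x; have -> : foldr partial (fun=> 0) s = (cst 0 : E -> R).
  elim: s => [|i s /= ->] //; apply/funext => y; rewrite /partial.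
  exact: derive_cst.
exact: differentiable_cst.
Qed.

Lemma H10_test phi : test_function Omega phi -> H10 phi.
Proof.
move=> tp; apply: H10P; first exact: test_H1.
move=> e e0; exists phi; split=> //.
rewrite (ip_sqB (test_H1 tp) (test_H1 tp)).
rewrite -[dotL2 _ _ _]/(dot mu Omega _ _) (dot_sqB mO (test_L2 oO bO tp) (test_L2 oO bO tp)).
have -> : forall x y : R, x - 2 * x + x + (y - 2 * y + y) = 0 by move=> *; ring.
exact: ltW.
Qed.

Lemma H10_0 : H10 (fun=> 0).
Proof. exact: H10_test test_0. Qed.

End H10_theory.

Ltac gen_reals :=
  repeat match goal with
  | |- context [dot ?m ?D ?f ?g] => generalize (dot m D f g)
  | |- context [dotL2 ?D ?f ?g] => generalize (dotL2 D f g)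
  | |- context [dotL2v ?D ?f ?g] => generalize (dotL2v D f g)
  | |- context [ip ?D ?f ?g] => generalize (ip D f g)
  end.

Lemma mul_divK {R : realType} (e c k : R) : 0 < c -> 0 < k -> k * (e / (c * k)) = e / c.
Proof. by move=> c0 k0; field; rewrite !gt_eqF. Qed.

Lemma sum_split_le {R : realType} n (A A' r p1 p2 e : R) (B B' : 'I_n -> R) :
  p1 <= 2 * A + 2 * A' -> p2 <= \sum_(i < n) (2 * B i + 2 * B' i) ->
  A + \sum_(i < n) B i <= r -> A' + \sum_(i < n) B' i <= r -> 4 * r <= e ->
  p1 + p2 <= e.
Proof. by rewrite big_split/= -!mulr_sumr => *; lra. Qed.

(** * Separability of L^2 and H^1_0 *)

Section separability.
Context {R : realType} {d : nat} (Omega : set 'rV[R]_d).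
Hypotheses (oO : open Omega) (bO : bounded_set Omega).
Local Notation E := 'rV[R]_d.
Local Notation mu := (@lebesgue_rV R d).
Local Notation dotO := (dot mu Omega).
Let mO := domain_measurable oO.
Let fO := domain_finite oO bO.

Definition ratstep (l : seq (rat * {ffun 'I_d -> rat})) (x : E) : R :=
  \sum_(p <- l) ratr p.1 * \1_(orthant p.2) x.

Lemma ratstep_L2 l : L2 mu Omega (ratstep l).
Proof.
rewrite /ratstep; elim: l => [|p l IH].
  by under eq_fun do rewrite big_nil; exact: L2_0.
under eq_fun do rewrite big_cons.
apply: L2_comb => //; apply: L2_indic => //; exact: measurable_orthant.
Qed.

(** On the bounded set [Omega], the constant 1 and the orthant indicators are themselves rational
    steps, and limits are immediate. The work lies in linear combinations, where the real
    coefficient must be replaced by a rational one. *)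
Lemma L2_separable f : L2 mu Omega f -> forall e, 0 < e ->
  exists l, dotO (f \- ratstep l) (f \- ratstep l) <= e.
Proof.
move=> Lf.
pose P (f : E -> R) := forall e, 0 < e ->
  exists l, dotO (f \- ratstep l) (f \- ratstep l) <= e.
apply: (@L2_ind _ _ _ mu Omega mO fO (@orthants R d) P rV_measurableE) => //.
- exact: setI_orthants.
(* An orthant with all its bounds below the cube contains [Omega], so its indicator represents the
   constant 1. *)
- have [M M0 OM] := bounded_sub_cube bO.
  have /rat_in_itvoo[q] : - M - 1 < - M by rewrite ltrBlDr ltrDl.
  rewrite in_itv/= => /andP[_ qM].
  move=> e e0; exists [:: (1%Q, [ffun=> q])].
  rewrite (dot_ae0 mO (L2_cst mO fO 1) (ratstep_L2 _)) ?(ltW e0)//.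
  apply: aeW => x Ox; rewrite /ratstep big_cons big_nil addr0 rmorph1 mul1r indicE mem_set//.
  by move=> i; rewrite ffunE; have /andP[h _] := OM x Ox i; exact: lt_le_trans qM h.
- move=> _ [q _ <-] e e0; exists [:: (1%Q, q)].
  rewrite (dot_ae0 mO _ (ratstep_L2 _)) ?(ltW e0)//.
    by apply: L2_indic => //; exact: measurable_orthant.
  by apply: aeW => x Ox; rewrite /ratstep big_cons big_nil addr0 rmorph1 mul1r.
- move=> a {}f g {}Lf Lg Pf Pg e e0.
  have F0 : 0 < 8 * (dotO f f + 1) by rewrite mulr_gt0// ltr_wpDl ?dot_ge0.
  pose dl := Num.sqrt (e / (8 * (dotO f f + 1))).
  have dl0 : 0 < dl by rewrite sqrtr_gt0 divr_gt0.
  have /rat_in_itvoo[q] : a < a + dl by rewrite ltrDl.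
  rewrite in_itv/= => /andP[aq qa].
  have q0 : 0 < 16 * ((ratr q : R) ^+ 2 + 1) by rewrite mulr_gt0// ltr_wpDl ?sqr_ge0.
  have [l Hl] := Pf _ (divr_gt0 e0 q0).
  have [m Hm] := Pg _ (divr_gt0 e0 (ltr0n _ 8 : 0 < 8 :> R)).
  exists ([seq (q * p.1, p.2) | p <- l] ++ m).
  have sE : ratstep ([seq (q * p.1, p.2) | p <- l] ++ m) =
      (fun x => ratr q * ratstep l x + ratstep m x).
    apply/funext => x; rewrite /ratstep big_cat/= big_map mulr_sumr; congr (_ + _).
    by apply: eq_bigr => p _ /=; rewrite rmorphM mulrA.
  rewrite sE.
  (* Three successive replacements: the coefficient [a] by [q], then [f] by [ratstep l], then [g] by
     [ratstep m]. *)
  pose u := (fun x => a * f x + g x).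
  pose v := (fun x => ratr q * f x + g x).
  pose w := (fun x => ratr q * ratstep l x + g x).
  have Lu : L2 mu Omega u by exact: L2_comb.
  have Lv : L2 mu Omega v by exact: L2_comb.
  have Ll := ratstep_L2 l; have Lm := ratstep_L2 m.
  have Lw : L2 mu Omega w by exact: L2_comb.
  have Lz : L2 mu Omega (fun x => ratr q * ratstep l x + ratstep m x) by exact: L2_comb.
  have sc (c : R) (h : E -> R) : L2 mu Omega h ->
      dotO (fun x => c * h x) (fun x => c * h x) = c ^+ 2 * dotO h h.
    move=> Lh; have := dot_sq_comb mO c Lh (L2_0 mu mO).
    rewrite (_ : (fun x => c * h x + 0) = (fun x => c * h x)); last by apply/funext => x; rewrite addr0.
    have z : forall k, dotO k (fun=> 0) = 0.
      by move=> k; rewrite /dot; under eq_Rintegral do rewrite mulr0; rewrite Rintegral_cst// mul0r.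
    by rewrite !z mulr0 !addr0.
  apply: (le_trans (dot_tri mO Lu Lv Lz)).
  have vz := dot_tri mO Lv Lw Lz.
  have uv : dotO (u \- v) (u \- v) <= e / 8.
    rewrite (_ : u \- v = (fun x => (a - ratr q) * f x)); last by apply/funext => x; rewrite /u/v/=; ring.
    rewrite sc//; apply: (@le_trans _ _ (dl ^+ 2 * (dotO f f + 1))).
      apply: ler_pM; rewrite ?sqr_ge0 ?dot_ge0 ?lerDl//.
      have := ltW aq; have := ltW qa; nra.
    rewrite /dl sqr_sqrtr; last by rewrite ltW// divr_gt0.
    by rewrite mulrC mul_divK// ltr_wpDl ?dot_ge0.
  have vw : dotO (v \- w) (v \- w) <= e / 16.
    rewrite (_ : v \- w = (fun x => ratr q * (f \- ratstep l) x)); last by apply/funext => x; rewrite /v/w/=; ring.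
    rewrite sc; last exact: L2_B.
    apply: (@le_trans _ _ (((ratr q) ^+ 2 + 1) * (e / (16 * (ratr q ^+ 2 + 1))))).
      by apply: ler_pM; rewrite ?sqr_ge0 ?dot_ge0 ?lerDl.
    by rewrite (mul_divK e (ltr0n _ 16 : 0 < 16 :> R)) ?ltr_wpDl ?sqr_ge0.
  have wz : dotO (w \- (fun x => ratr q * ratstep l x + ratstep m x))
      (w \- (fun x => ratr q * ratstep l x + ratstep m x)) <= e / 8.
    apply: le_trans Hm; rewrite (_ : w \- _ = g \- ratstep m)//.
    by apply/funext => x; rewrite /w/=; ring.
  apply: (@le_trans _ _ (2 * (e / 8) + 2 * (2 * (e / 16) + 2 * (e / 8)))); last lra.
  apply: lerD; apply: ler_wpM2l => //.
  by apply: (le_trans vz); apply: lerD; apply: ler_wpM2l.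
- move=> {}f {}Lf H e e0.
  have e4 : 0 < e / 4 by rewrite divr_gt0.
  have [h [Lh Ph fh]] := H _ e4; have [l hl] := Ph _ e4.
  exists l; apply: (le_trans (dot_tri mO Lf Lh (ratstep_L2 l))).
  apply: (@le_trans _ _ (2 * (e / 4) + 2 * (e / 4))); last lra.
  by apply: lerD; apply: ler_wpM2l.
Qed.

Definition H10_dist u w := dotO (u \- w) (u \- w) + ip Omega (u \- w) (u \- w).

(* A countable dense family: for each index, some element of H10 whose value
   and gradient are close to the given rational step functions, if any. *)
Lemma H10_separable : exists (I : countType) (D : I -> E -> R),
  (forall j, H10 Omega (D j)) /\
  forall u, H10 Omega u -> forall e, 0 < e -> exists j, H10_dist u (D j) <= e.
Proof.
pose S := seq (rat * {ffun 'I_d -> rat}).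
pose near_ (j : S * {ffun 'I_d -> S} * nat) (v : E -> R) :=
  H10 Omega v /\ dotO (v \- ratstep j.1.1) (v \- ratstep j.1.1) +
    \sum_(i < d) dotO (grad Omega v i \- ratstep (j.1.2 i)) (grad Omega v i \- ratstep (j.1.2 i))
    <= j.2.+1%:R^-1.
exists (S * {ffun 'I_d -> S} * nat)%type.
exists (fun j => if pselect (exists v, near_ j v) is left _ then get [set v | near_ j v] else fun=> 0).
split=> [j|u hu e e0].
  case: pselect => [H|_]; last exact: H10_0.
  by have [] := getPex H.
(* Two functions within [r] of the same steps, in squared distance, are within [2 * r + 2 * r] of
   each other. *)
have [n n0] : exists n : nat, 4 * n.+1%:R^-1 <= e.
  have e4 : 0 < e / 4 by rewrite divr_gt0.
  have c := @cvg_harmonic R.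
  move/cvgrPdist_le : c => /(_ _ e4)[n _ /(_ n (leqnn _))]; rewrite sub0r normrN ger0_norm /harmonic/= ?invr_ge0// => h.
  by exists n; rewrite mulrC -ler_pdivlMr.
have n1 : 0 < (n.+1%:R^-1 : R) / 2 by rewrite divr_gt0.
have [l Hl] := L2_separable (H10_L2 hu) n1.
have d1 : 0 < (n.+1%:R^-1 : R) / 2 / (d%:R + 1) by rewrite divr_gt0// ltr_wpDl.
have hg := grad_L2v (H10_H1 hu).
have [m Hm] := choice (fun i => L2_separable (hg i) d1).
exists (l, [ffun i => m i], n).
have near_u : near_ (l, [ffun i => m i], n) u.
  split=> //=; rewrite [leRHS](splitr _) lerD//.
  apply: (@le_trans _ _ (\sum_(i < d) ((n.+1%:R^-1 : R) / 2 / (d%:R + 1)))).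
    by apply: ler_sum => i _; rewrite ffunE.
  rewrite sumr_const card_ord -[leLHS]mulr_natr -mulrA ler_piMr ?divr_ge0//.
  by rewrite mulrC ler_pdivrMr ?mul1r ?lerDl// ltr_wpDl.
case: pselect => [H|[]]; last by exists u.
have [hv Hv] := getPex H; move: hv Hv; set v := get _ => hv Hv.
have [_ Hu] := near_u; rewrite /= in Hu Hv.
have hgv := grad_L2v (H10_H1 hv).
have huv := H10_B oO bO hu hv.
have ipE : ip Omega (u \- v) (u \- v) =
    \sum_(i < d) dotO (grad Omega u i \- grad Omega v i) (grad Omega u i \- grad Omega v i).
  rewrite (_ : \sum_(i < d) _ = dotL2v Omega (fun i x => (-1) * grad Omega v i x + grad Omega u i x)
     (fun i x => (-1) * grad Omega v i x + grad Omega u i x)); last first.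
    by apply: eq_bigr => i _; rewrite -subE.
  have W := weak_grad_comb oO bO (-1) (H10_L2 hv) (H10_L2 hu) (grad_weak (H10_H1 hv)) (grad_weak (H10_H1 hu)).
  by rewrite subE ipE; exact: (dotv_grad oO bO W W).
rewrite /H10_dist ipE.
have tr1 : dotO (u \- v) (u \- v) <= 2 * dotO (u \- ratstep l) (u \- ratstep l) +
    2 * dotO (v \- ratstep l) (v \- ratstep l).
  have -> : u \- v = (u \- ratstep l) \- (v \- ratstep l) by apply/funext => x /=; ring.
  exact: (dot_le2 mO (L2_B mO (H10_L2 hu) (ratstep_L2 l)) (L2_B mO (H10_L2 hv) (ratstep_L2 l))).
have tr2 : \sum_(i < d) dotO (grad Omega u i \- grad Omega v i) (grad Omega u i \- grad Omega v i) <=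
   \sum_(i < d) (2 * dotO (grad Omega u i \- ratstep ([ffun i => m i] i)) (grad Omega u i \- ratstep ([ffun i => m i] i)) +
    2 * dotO (grad Omega v i \- ratstep ([ffun i => m i] i)) (grad Omega v i \- ratstep ([ffun i => m i] i))).
  apply: ler_sum => i _; set r := ratstep _.
  have -> : grad Omega u i \- grad Omega v i = (grad Omega u i \- r) \- (grad Omega v i \- r).
    by apply/funext => x /=; ring.
  exact: (dot_le2 mO (L2_B mO (hg i) (ratstep_L2 _)) (L2_B mO (hgv i) (ratstep_L2 _))).
exact: (sum_split_le tr1 tr2 Hu Hv n0).
Qed.

End separability.

(** * Functionals on H^1_0 and their dual norm *)

Lemma slope_perturb {R : realType} (a b n m k dl e c : R) :
  0 <= c -> 0 <= k -> 0 < e -> dl <= e -> `|a - b| <= k * dl -> m <= n + dl ->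
  (k + c + 1) * e = (a - c * n) / 2 -> c * m < b.
Proof.
move=> c0 k0 e0 de ab mn eE; have ab' := le_trans (ler_norm _) ab.
have h1 : k * dl <= k * e by rewrite ler_wpM2l.
have h2 : c * m <= c * (n + e) by rewrite ler_wpM2l// (le_trans mn)// lerD2l.
clear ab; nra.
Qed.

Lemma value_perturb {R : realType} (a b k dl e e' c : R) :
  0 <= k -> 0 < e' -> dl <= e' -> `|a - b| <= k * dl -> c <= b + k * dl ->
  (k + 1) * e' = e / 2 -> c <= a + e.
Proof.
move=> k0 e0 de ab cb eE; have ab' := lerNnormlW ab.
have h1 : k * dl <= k * e' by rewrite ler_wpM2l.
clear ab; nra.
Qed.

Lemma pm_le_ge0 {R : realType} (a b : R) : a <= b -> - a <= b -> 0 <= b.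
Proof. by move=> *; lra. Qed.

Lemma young_mul {R : realType} (l n m a : R) : 0 < l -> a <= m * n ->
  2 * a <= l * m ^+ 2 + l^-1 * n ^+ 2.
Proof.
move=> l0 h; have := sqr_ge0 (l * m - n) => h1.
have -> : l * m ^+ 2 + l^-1 * n ^+ 2 = l^-1 * ((l * m - n) ^+ 2) + 2 * (m * n).
  by field; rewrite gt_eqF.
have : 0 <= l^-1 * (l * m - n) ^+ 2 by rewrite mulr_ge0// invr_ge0 ltW.
lra.
Qed.

Lemma minkowski_sqr {R : realType} (a b c ab a2 b2 c2 : R) :
  c2 = a2 - 2 * ab + b2 -> b ^+ 2 = b2 -> a ^+ 2 = a2 -> c ^+ 2 = c2 ->
  - (a * b) <= ab -> c ^+ 2 <= (a + b) ^+ 2.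
Proof.
move=> e1 e2 e3 e4 h.
have -> : (a + b) ^+ 2 = a2 + b2 + 2 * (a * b) by rewrite -e2 -e3; ring.
by rewrite e4 e1; lra.
Qed.

Section Hm1_theory.
Context {R : realType} {d : nat} (Omega : set 'rV[R]_d).
Hypotheses (oO : open Omega) (bO : bounded_set Omega).
Local Notation E := 'rV[R]_d.
Local Notation mu := (@lebesgue_rV R d).
Local Notation H10 := (H10 Omega).
Local Notation Hm1 := (Hm1 Omega).
Local Notation ip := (ip Omega).
Let mO := domain_measurable oO.
Implicit Types (u w : E -> R) (g h : (E -> R) -> R).

Definition nu u := locked_with ip_key (normL2v Omega (grad Omega u)).

Lemma nuE u : nu u = normL2v Omega (grad Omega u).
Proof. by rewrite /nu unlock. Qed.

Lemma nu_ge0 u : 0 <= nu u. Proof. by rewrite nuE; exact: sqrtr_ge0. Qed.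

Lemma nu_sqr u : nu u ^+ 2 = ip u u. Proof. by rewrite nuE; exact: normL2v_grad. Qed.

Lemma ip_CS u w : H10 u -> H10 w -> ip u w ^+ 2 <= ip u u * ip w w.
Proof.
move=> /H10_H1 hu /H10_H1 hw; apply: disc_le0; first exact: ip_ge0.
by move=> x; rewrite -(ip_sq_comb oO bO x hu hw); exact: ip_ge0.
Qed.

Lemma nu_tri u w : H10 u -> H10 w -> nu (u \- w) <= nu u + nu w.
Proof.
move=> hu hw; rewrite -(@ler_pXn2r _ 2) ?nnegrE ?addr_ge0 ?nu_ge0//.
have h : `|ip u w| <= nu u * nu w.
  have := ip_CS hu hw; rewrite -(nu_sqr u) -(nu_sqr w) -exprMn.
  have := mulr_ge0 (nu_ge0 u) (nu_ge0 w); move: (ip u w) (nu u * nu w) => a b b0.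
  by rewrite -(real_normK (num_real a)) ler_pXn2r ?nnegrE.
exact: (minkowski_sqr (ip_sqB oO bO (H10_H1 hu) (H10_H1 hw)) (nu_sqr w) (nu_sqr u)
  (nu_sqr _) (lerNnormlW h)).
Qed.

Lemma Hm1_B g u w : Hm1 g -> H10 u -> H10 w -> g (u \- w) = g u - g w.
Proof. by move=> [lg _] hu hw; rewrite subE (lg (-1) w u hw hu) mulN1r addrC. Qed.

Lemma Hm1_N g u : Hm1 g -> H10 u -> g (fun x => - u x) = - g u.
Proof.
move=> [lg _] hu; have := lg (-2) u u hu hu.
rewrite (_ : (fun x => _) = (fun x => - u x)); last by apply/funext => x; ring.
by move=> ->; ring.
Qed.

Definition dualnorm g := locked_with ip_key (normHm1 Omega g).

Lemma dualnormE g : dualnorm g = normHm1 Omega g.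
Proof. by rewrite /dualnorm unlock. Qed.

Definition nontrivial u := ~ {ae mu, forall x, Omega x -> u x = 0}.

Local Notation N := dualnorm.

Lemma dualnorm_sup g :
  N g = sup [set g u / nu u | u in [set u | H10 u /\ nontrivial u]].
Proof.
rewrite dualnormE /normHm1; congr sup; apply/seteqP.
by split=> _ [u hu <-]; exists u => //; rewrite nuE.
Qed.

Lemma nontrivialN u : nontrivial u -> nontrivial (fun x => - u x).
Proof.
move=> nu0 H; apply: nu0; apply: filterS H => x H Ox.
by apply: oppr_inj; rewrite oppr0; exact: H.
Qed.

Lemma nuN u : H10 u -> nu (fun x => - u x) = nu u.
Proof.
move=> hu; suff e : ip (fun x => - u x) (fun x => - u x) = ip u u.
  have := nu_sqr (fun x => - u x); have := nu_sqr u.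
  have := nu_ge0 (fun x => - u x); have := nu_ge0 u; rewrite e.
  move: (nu (fun x => - u x)) (nu u) (ip u u) => a b c b0 a0 <- ab.
  apply/eqP; rewrite -(@eqrXn2 _ 2); first exact/eqP.
  by [].
  exact: a0.
  exact: b0.
have := ip_sq_comb oO bO (-2) (H10_H1 hu) (H10_H1 hu).
rewrite (_ : (fun x => _) = (fun x => - u x)); last by apply/funext => x; ring.
by move=> ->; move: (ip u u) => a; ring.
Qed.

(** The supremum in [normHm1] runs over the functions that are not almost everywhere zero, whereas
    dividing asks for [nu u] to be nonzero. This makes every [u] with [nu u != 0] a competitor; a
    competitor with [nu u = 0] gives the quotient 0 by convention. *)
Lemma nu_trivial u : H10 u -> ~ nontrivial u -> nu u = 0.
Proof.
move=> hu /contrapT u0.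
have wg : is_weak_grad Omega u (fun _ _ => 0).
  apply: (weak_grad_ext oO bO (L2_0 mu mO) (H10_L2 hu)).
    by apply: filterS u0 => x h /h ->.
  split=> [i|i phi tp]; first exact: L2_0.
  have z (f : E -> R) : dotL2 Omega (fun=> 0) f = 0.
    by rewrite /dotL2; under eq_Rintegral do rewrite mul0r; rewrite Rintegral_cst// mul0r.
  by rewrite !z oppr0.
rewrite nuE /normL2v (dotv_grad oO bO wg wg) /dotL2v big1 ?sqrtr0// => i _.
by rewrite /dotL2; under eq_Rintegral do rewrite mul0r; rewrite Rintegral_cst// mul0r.
Qed.
Lemma Hm1_nontrivial g u : Hm1 g -> H10 u -> nu u != 0 -> nontrivial u.
Proof.
move=> _ hu n0; apply: contrapT => /(nu_trivial hu) /eqP; exact/negP.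
Qed.

Lemma Hm1_nu0 g u : Hm1 g -> H10 u -> nu u = 0 -> g u = 0.
Proof.
move=> [_ [C H]] hu u0; have := H u hu; rewrite -nuE u0 mulr0.
by rewrite normr_le0 => /eqP.
Qed.
Lemma Hm1_has_ubound g : Hm1 g ->
  has_ubound [set g u / nu u | u in [set u | H10 u /\ nontrivial u]].
Proof.
move=> [_ [C H]]; exists `|C| => _ [u [hu _] <-].
have [->|n0] := eqVneq (nu u) 0; first by rewrite invr0 mulr0.
have np : 0 < nu u by rewrite lt_neqAle eq_sym n0 nu_ge0.
rewrite ler_pdivrMr//; apply: le_trans (ler_norm _) _; apply: (le_trans (H u hu)).
by rewrite -nuE ler_wpM2r ?nu_ge0// ler_norm.
Qed.

Lemma Hm1_le g u : Hm1 g -> H10 u -> g u <= N g * nu u.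
Proof.
move=> hg hu; have [n0|n0] := eqVneq (nu u) 0; first by rewrite (Hm1_nu0 hg hu n0) n0 mulr0.
have np : 0 < nu u by rewrite lt_neqAle eq_sym n0 nu_ge0.
rewrite -ler_pdivrMr// dualnorm_sup; apply: sup_ubound; first exact: (Hm1_has_ubound hg).
by exists u => //; split=> //; exact: (Hm1_nontrivial hg).
Qed.

(** The competitors [u] and [- u] give opposite quotients, and the supremum is at least both; if
    there are no competitors, [sup] of the empty set is 0. *)
Lemma normHm1_ge0 g : Hm1 g -> 0 <= N g.
Proof.
move=> hg; pose S := [set g u / nu u | u in [set u | H10 u /\ nontrivial u]].
have NE : N g = sup S by exact: dualnorm_sup.
have [S0|/set0P[_ [u [hu nt] _]]] := eqVneq S set0; first by rewrite NE S0 sup0.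
have h1 : g u / nu u <= N g.
  by rewrite NE; apply: sup_ubound; [exact: (Hm1_has_ubound hg)|exists u].
have h2 : g (fun x => - u x) / nu (fun x => - u x) <= N g.
  rewrite NE; apply: sup_ubound; first exact: (Hm1_has_ubound hg).
  exists (fun x => - u x); last by [].
  exact: (conj (H10_N oO bO hu) (nontrivialN nt)).
move: h1 h2; rewrite (Hm1_N hg hu) (nuN hu) mulNr.
exact: pm_le_ge0.
Qed.

Lemma Hm1_abs g u : Hm1 g -> H10 u -> `|g u| <= N g * nu u.
Proof.
move=> hg hu; rewrite ler_norml (Hm1_le hg hu) andbT.
have := Hm1_le hg (H10_N oO bO hu); rewrite (Hm1_N hg hu) (nuN hu).
by rewrite lerNl.
Qed.

Lemma Hm1_young g u (l : R) : 0 < l -> Hm1 g -> H10 u ->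
  2 * `|g u| <= l * N g ^+ 2 + l^-1 * ip u u.
Proof.
by move=> l0 hg hu; rewrite -(nu_sqr u); exact: young_mul l0 (Hm1_abs hg hu).
Qed.

Lemma Hm1_sub g h : Hm1 g -> Hm1 h -> Hm1 (fun u => g u - h u).
Proof.
move=> [lg [C HC]] [lh [K HK]]; split.
  by move=> a u w hu hw; rewrite lg// lh//; ring.
exists (C + K) => u hu; rewrite mulrDl.
by apply: le_trans (ler_normB _ _) _; rewrite lerD ?HC ?HK.
Qed.

Section measurability.
Variables (d1 : measure_display) (X : measurableType d1) (J : set X) (mJ : measurable J).
Variable g : X -> (E -> R) -> R.
Hypothesis Jg : forall t, J t -> Hm1 (g t).
Hypothesis mg : forall u, H10 u -> measurable_fun J (fun t => g t u).

(** For [c >= 0], the norm exceeds [c] exactly when some [u] satisfies the strict inequality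
    [c * nu u < g t u]. Both sides are continuous in [u], so some member of the countable dense
    family then satisfies it too, and the norm is seen through countably many measurable functions
    of [t]. *)
Lemma measurable_normHm1 : measurable_fun J (fun t => N (g t)).
Proof.
have [I [D [HD dD]]] := H10_separable oO bO.
apply: (measurability _ (RGenOInfty.measurableE R)).
move=> _ [_ [c ->] <-].
have [c0|c0] := ltP c 0.
  rewrite (_ : _ `&` _ = J)//; apply/seteqP; split=> t; first by case.
  move=> Jt; split; first exact: Jt.
  by rewrite /= in_itv/= andbT; exact: lt_le_trans c0 (normHm1_ge0 (Jg Jt)).
rewrite (_ : _ `&` _ = \bigcup_j (J `&` [set t | `]c * nu (D j), +oo[%classic (g t (D j))])).
  apply: count_bigcup_measurable => j _; exact: (mg (HD j)).
apply/seteqP; split=> [t [Jt]|t [j _ [Jt]]] /=; rewrite !in_itv/= !andbT => h; last first.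
  split; first exact: Jt.
  have hg := Jg Jt.
  have n0 : nu (D j) != 0.
    by apply/eqP => n0; move: h; rewrite n0 mulr0 (Hm1_nu0 hg (HD j) n0) ltxx.
  have np : 0 < nu (D j) by rewrite lt_neqAle eq_sym n0 nu_ge0.
  by have := lt_le_trans h (Hm1_le hg (HD j)); rewrite ltr_pM2r.
have hg := Jg Jt.
have [u [hu hc]] : exists u, H10 u /\ c * nu u < g t u.
  have S0 : [set g t u / nu u | u in [set u | H10 u /\ nontrivial u]] !=set0.
    apply/set0P/eqP => S0; move: h; rewrite dualnorm_sup.
    by rewrite S0 sup0 ltNge c0.
  move: h; rewrite dualnorm_sup => h; have [_ [u [hu nt] <-] cu] := sup_gt S0 h.
  exists u; split=> //.
  have [n0|n0] := eqVneq (nu u) 0; first by move: cu; rewrite n0 invr0 mulr0 ltNge c0.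
  by rewrite -ltr_pdivlMr// lt_neqAle eq_sym n0 nu_ge0.
(* With this radius, the perturbation of the two sides uses up at most half of the gap
   [g t u - c * nu u]. *)
pose e := (g t u - c * nu u) / (2 * (N (g t) + c + 1)).
have k0 : 0 < N (g t) + c + 1 by rewrite ltr_wpDl// addr_ge0// normHm1_ge0.
have e0 : 0 < e by rewrite divr_gt0 ?subr_gt0// mulr_gt0.
have [j Hj] := dD u hu _ (exprn_gt0 2 e0).
exists j; first by []; split; first exact: Jt.
rewrite /= in_itv/= andbT.
have he : nu (u \- D j) <= e.
  rewrite -(@ler_pXn2r _ 2) ?nnegrE ?nu_ge0 ?(ltW e0)// nu_sqr; apply: le_trans Hj.
  by rewrite /H10_dist lerDr dot_ge0.
have h1 := Hm1_abs hg (H10_B oO bO hu (HD j)); rewrite (Hm1_B hg hu (HD j)) in h1.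
have h2 : nu (D j) <= nu u + nu (u \- D j).
  have := nu_tri hu (H10_B oO bO hu (HD j)).
  by rewrite (_ : u \- (u \- D j) = D j)//; apply/funext => x /=; ring.
have eE : (N (g t) + c + 1) * e = (g t u - c * nu u) / 2.
  by rewrite /e mul_divK.
exact: (slope_perturb c0 (normHm1_ge0 hg) e0 he h1 h2 eE).
Qed.

(** [g t (phi t)] is the infimum over [j] of [F j t], the value at [D j] plus the largest error that
    the dual norm allows. The moving argument [phi t] thus enters only through its distances to
    fixed elements, which are assumed measurable. *)
Lemma measurable_Hm1_pairing (phi : X -> E -> R) :
  (forall t, J t -> H10 (phi t)) ->
  (forall u, H10 u -> measurable_fun J (fun t => nu (phi t \- u))) ->
  measurable_fun J (fun t => g t (phi t)).
Proof.
move=> hphi mphi; have [I [D [HD dD]]] := H10_separable oO bO.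
apply: (measurability _ (RGenCInfty.measurableE R)).
move=> _ [_ [c ->] <-].
pose F j t := g t (D j) + N (g t) * nu (phi t \- D j).
have mF j : measurable_fun J (F j).
  apply: measurable_funD; first exact: mg.
  by apply: measurable_funM; [exact: measurable_normHm1|exact: mphi].
rewrite (_ : _ `&` _ = J `\` \bigcup_j (J `&` F j @^-1` `]-oo, c[%classic)).
  by apply: measurableD => //; apply: count_bigcup_measurable => j _; exact: mF.
apply/seteqP; split=> t [Jt] /=; rewrite in_itv/= ?andbT => h.
  split; first exact: Jt.
  move=> [j _ [_]] /=; rewrite in_itv/= ltNge => /negP; apply.
  have := Hm1_le (Jg Jt) (H10_B oO bO (hphi _ Jt) (HD j)).
  by rewrite (Hm1_B (Jg Jt) (hphi _ Jt) (HD j)) lerBlDl; exact: le_trans.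
split; first exact: Jt.
have hF j : c <= F j t.
  by rewrite leNgt; apply/negP => Fc; apply: h; exists j; first by []; split; [exact: Jt|rewrite /= in_itv].
have hg := Jg Jt; have N0 := normHm1_ge0 hg.
apply/ler_addgt0Pr => e e0.
have k0 : 0 < N (g t) + 1 by rewrite ltr_wpDl.
pose e' := e / (2 * (N (g t) + 1)).
have e'0 : 0 < e' by rewrite divr_gt0// mulr_gt0.
have [j Hj] := dD _ (hphi _ Jt) _ (exprn_gt0 2 e'0).
have he : nu (phi t \- D j) <= e'.
  rewrite -(@ler_pXn2r _ 2) ?nnegrE ?nu_ge0 ?(ltW e'0)// nu_sqr; apply: le_trans Hj.
  by rewrite /H10_dist lerDr dot_ge0.
have h1 := Hm1_abs hg (H10_B oO bO (hphi _ Jt) (HD j)).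
rewrite (Hm1_B hg (hphi _ Jt) (HD j)) in h1.
have eE : (N (g t) + 1) * e' = e / 2 by rewrite /e' mul_divK.
exact: (value_perturb N0 e'0 he h1 (hF j) eE).
Qed.

End measurability.

End Hm1_theory.

(** * Energy identity for an abstract evolution *)

Section interval_integral.
Context {R : realType}.
Local Notation lam := (@lebesgue_measure R).
Implicit Types (f g : R -> R) (a b c : R).

Lemma lam_aeS (P Q : R -> Prop) : (forall x, P x -> Q x) ->
  {ae lam, forall x, P x} -> {ae lam, forall x, Q x}.
Proof.
move=> PQ; apply: filterS => //; exact: (ae_filter_ringOfSetsType lam).
Qed.

Lemma lam_aeS2 (P Q S : R -> Prop) : (forall x, P x -> Q x -> S x) ->
  {ae lam, forall x, P x} -> {ae lam, forall x, Q x} -> {ae lam, forall x, S x}.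
Proof.
move=> PQ; apply: filterS2 => //; exact: (ae_filter_ringOfSetsType lam).
Qed.

(* Integrability on the whole line, so that restricting to an interval needs
   no side condition. *)
Definition igr f := lam.-integrable setT (EFin \o f).

Definition itg f a b : R := \int[lam]_(x in `]a, b]) f x.

Lemma igrS f (A : set R) : measurable A -> igr f -> lam.-integrable A (EFin \o f).
Proof. by move=> mA If; apply: integrableS If. Qed.

Lemma igr_comb c f g : igr f -> igr g -> igr (fun x => c * f x + g x).
Proof.
move=> If Ig; have := integrableD measurableT (integrableZl measurableT c If) Ig.
by apply: eq_integrable.
Qed.

Lemma igrZ c f : igr f -> igr (fun x => c * f x).
Proof. by move=> If; have := integrableZl measurableT c If; exact: eq_integrable. Qed.

Lemma igrD f g : igr f -> igr g -> igr (fun x => f x + g x).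
Proof. by move=> If Ig; have := integrableD measurableT If Ig; exact: eq_integrable. Qed.

Lemma itg_comb c f g a b : igr f -> igr g ->
  itg (fun x => c * f x + g x) a b = c * itg f a b + itg g a b.
Proof.
move=> If Ig; rewrite /itg RintegralD//; last 2 first.
- by apply: igrS => //; exact: igrZ.
- exact: igrS.
by rewrite RintegralZl//; exact: igrS.
Qed.

Lemma itg_split f a b c : igr f -> a <= b -> b <= c -> itg f a c = itg f a b + itg f b c.
Proof.
move=> If ab bc; rewrite /itg.
have E : `]a, c]%classic = `]a, b]%classic `|` `]b, c]%classic :> set R.
  by rewrite -itv_bndbnd_setU// bnd_simp.
rewrite E Rintegral_setU// -?E; first exact: igrS.
apply/disj_setPS => x [] /=; rewrite !in_itv/= => /andP[_ xb] /andP[bx _].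
by move: (lt_le_trans bx xb); rewrite ltxx.
Qed.

Lemma itg_le_ae f g a b (G : set R) : igr f -> igr g ->
  {ae lam, forall x, `]a, b]%classic x -> G x} ->
  (forall x, `]a, b]%classic x -> G x -> f x <= g x) -> itg f a b <= itg g a b.
Proof.
move=> If Ig aeG fg.
have Igf := igr_comb (-1) If Ig.
have mI : measurable `]a, b]%classic by [].
have mgf := measurable_int lam (igrS mI Igf).
rewrite -subr_ge0 addrC -mulN1r -itg_comb//.
rewrite /itg/Rintegral; apply: fine_ge0.
(* The integrand is exchanged for its positive part, almost everywhere equal to it and nonnegative
   at every point. *)
rewrite (@ae_eq_integral _ _ _ lam _ (fun x => (Num.max (-1 * f x + g x) 0)%:E))//.
- by apply: integral_ge0 => x _; rewrite lee_fin le_max lexx orbT.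
- apply/measurable_EFinP; apply: measurable_maxr => //.
  exact/measurable_EFinP.
- apply: (lam_aeS _ aeG) => x Gx xab; congr EFin.
  by rewrite max_l// mulN1r addrC subr_ge0; apply: fg => //; exact: Gx.
Qed.

Lemma itg_le f g a b : igr f -> igr g ->
  (forall x, `]a, b]%classic x -> f x <= g x) -> itg f a b <= itg g a b.
Proof.
move=> If Ig fg; apply: (@itg_le_ae _ _ _ _ setT) => //; last by move=> x + _; exact: fg.
exact: aeW.
Qed.

Lemma itg_ge0 f a b : (forall x, 0 <= f x) -> 0 <= itg f a b.
Proof. by move=> f0; apply: Rintegral_ge0 => x _; exact: f0. Qed.

Lemma itg_cst c a b : a <= b -> itg (fun=> c) a b = c * (b - a).
Proof.
move=> ab; rewrite /itg Rintegral_cst//; congr (_ * _).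
have := @lebesgue_measure_itv R `]a, b] => /= ->; rewrite lte_fin.
move: ab; rewrite le_eqVlt => /predU1P[->|->]; last by rewrite -EFinD.
by rewrite ltxx subrr.
Qed.

Lemma itg_eq f g a b : (forall x, `]a, b]%classic x -> f x = g x) -> itg f a b = itg g a b.
Proof. by move=> fg; apply: eq_Rintegral => x /set_mem; exact: fg. Qed.

Lemma itg_small f e : igr f -> 0 < e -> exists2 d, 0 < d &
  forall a b, a <= b -> b - a < d -> itg (fun x => `|f x|) a b < e.
Proof.
move=> If e0; have [d [d0 H]] := integral_normr_continuous If e0.
exists d => // a b ab bad; apply: H => //.
have := @lebesgue_measure_itv R `]a, b] => /= ->.
by case: ifP => _; rewrite ?lte_fin// -EFinD lte_fin.
Qed.

Lemma itg_abs f a b : igr f -> `|itg f a b| <= itg (fun x => `|f x|) a b.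
Proof. by move=> If; apply: le_normr_Rintegral => //; exact: igrS. Qed.

Lemma ae_exists (G : set R) a b : a < b ->
  {ae lam, forall x, `]a, b]%classic x -> G x} -> exists x, a < x <= b /\ G x.
Proof.
move=> ab [N [mN N0 HN]]; apply: contrapT => H.
have sub : `]a, b]%classic `<=` N.
  move=> x xab; apply: HN => /= /(_ xab) Gx; apply: H; exists x.
  by move: xab; rewrite /= in_itv/=.
have : (lam `]a, b]%classic <= lam N)%E by apply: le_measure => //; rewrite inE.
have := @lebesgue_measure_itv R `]a, b] => /= ->; rewrite lte_fin ab N0 -EFinD lee_fin.
by rewrite subr_le0 leNgt ab.
Qed.

(** Otherwise [f] would exceed its mean [m] almost everywhere while [f - m] has integral zero. The
    freedom to demand [G x] is what later provides times at which the slice lies in H^1_0. *)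
Lemma itg_mean f a b (G : set R) : a < b -> igr f ->
  {ae lam, forall x, `]a, b]%classic x -> G x} ->
  exists x, [/\ a < x <= b, G x & (b - a) * f x <= itg f a b].
Proof.
move=> ab If aeG; pose m := itg f a b / (b - a).
have ba0 : 0 < b - a by rewrite subr_gt0.
apply: contrapT => H.
have fm x : `]a, b]%classic x -> G x -> m < f x.
  move=> xab Gx; rewrite ltNge; apply/negP => fm; apply: H; exists x.
  by split; [move: xab; rewrite /= in_itv|exact: Gx|rewrite mulrC -ler_pdivlMr].
have lamI : lam `]a, b]%classic = (b - a)%:E.
  by have := @lebesgue_measure_itv R `]a, b] => /= ->; rewrite lte_fin ab -EFinD.
pose h x := f x - m.
have Ic : lam.-integrable `]a, b]%classic (EFin \o cst m).
  apply: measurable_bounded_integrable; [by []|by rewrite -[X in (X < _)%E]/(lam _) lamI ltry|by []|].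
  by exists `|m|; split; [exact: num_real|move=> z mz x _; exact: ltW].
have mI : measurable (`]a, b]%classic : set (measurableTypeR R)) by [].
have Iab : lam.-integrable `]a, b]%classic (EFin \o f) by exact: igrS.
have Ih : lam.-integrable `]a, b]%classic (EFin \o h).
  have := integrableB mI Iab Ic; exact: eq_integrable.
have h0 : (\int[lam]_(x in `]a, b]) (h x)%:E = 0)%E.
  rewrite -(fineK (integrable_fin_num mI Ih)); congr EFin.
  apply: (etrans (RintegralB mI Iab Ic)).
  rewrite Rintegral_cst//; have := lamI => /= ->.
  by rewrite /= /m divfK ?gt_eqF// subrr.
have mh := measurable_int _ Ih.
have : (\int[lam]_(x in `]a, b]) `|(h x)%:E| = 0)%E.
  rewrite -[RHS]h0; apply: ae_eq_integral => //.
    exact: measurableT_comp.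
  apply: (lam_aeS _ aeG) => x Gx xab; rewrite gee0_abs// lee_fin subr_ge0.
  by apply: ltW; apply: fm => //; exact: Gx.
move=> /(ae_eq_integral_abs lam (measurable_itv _) mh) hae.
have : {ae lam, forall x, `]a, b]%classic x -> G x /\ h x = 0}.
  by apply: (lam_aeS2 _ aeG hae) => x Gx hx xab; split; [exact: Gx|have [] := hx xab].
move=> /(ae_exists ab)[x [xab [Gx hx]]].
have : m < f x by apply: fm => //; rewrite /= in_itv.
by rewrite -subr_gt0 -/(h x) hx ltxx.
Qed.

End interval_integral.

(** * Telescoping along selected partition points *)

Section telescope.
Context {R : realType}.
Local Notation lam := (@lebesgue_measure R).
Variables (T : R) (G : set R).
Hypothesis aeG : {ae lam, forall t, 0 < t < T -> G t}.
Variables (e p k : R -> R).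
Hypotheses (Ip : igr p) (Ik : igr k) (p0 : forall t, 0 <= p t) (k0 : forall t, 0 <= k t).
Hypothesis step : forall r r', G r -> G r' -> r < r' ->
  `|e r' - e r| <= itg k r r' + (r' - r) * (p r + p r').

Let aeG_itv a b : 0 < a -> b < T -> {ae lam, forall x, `]a, b]%classic x -> G x}.
Proof.
move=> a0 bT; apply: (lam_aeS _ aeG) => x Gx; rewrite /= in_itv/= => /andP[ax xb].
by apply: Gx; rewrite (lt_trans a0 ax) (le_lt_trans xb bT).
Qed.

(** The term [- 2 * d * p r] is a credit kept for the next step. Consecutive points are at most
    [2 * d] apart, so a step costs at most [2 * d * (p r + p r')]. The credit pays for [p r]; of the
    four copies of the integral of [p] over the new cell, each at least [d * p r'], two pay for
    [p r'] and two renew the credit. *)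
Let chain s d : G s -> 0 < s -> 0 < d -> forall m : nat, s + d * m.+1%:R < T ->
  exists r, [/\ G r, s + d * m%:R < r <= s + d * m.+1%:R &
    `|e r - e s| <= itg k s r + 4 * itg p s (s + d * m.+1%:R) - 2 * d * p r + d * p s].
Proof.
move=> Gs s0 d0; elim=> [|m IH] mT.
  have sd : s < s + d * 1%:R by rewrite mulr1 ltrDl.
  have [r [rs Gr pr]] := itg_mean sd Ip (aeG_itv s0 mT).
  exists r; split=> //; first by rewrite mulr0 addr0.
  move/andP: rs => [sr rd].
  have := step Gs Gr sr.
  have : (r - s) * (p s + p r) <= d * (p s + p r).
    by apply: ler_wpM2r; [rewrite addr_ge0|move: rd; rewrite mulr1; lra].
  move: pr; rewrite mulr1 addrAC subrr add0r => h1 h2 h3.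
  have h4 : 0 <= d * p r by rewrite mulr_ge0// ltW.
  apply: (le_trans h3); lra.
have mT' : s + d * m.+1%:R < T.
  apply: lt_trans mT; rewrite ltrD2l ltr_pM2l// ltr_nat//.
have [r [Gr /andP[rm rm1] er]] := IH mT'.
have ab : s + d * m.+1%:R < s + d * m.+2%:R by rewrite ltrD2l ltr_pM2l// ltr_nat.
have a0 : 0 < s + d * m.+1%:R by rewrite addr_gt0// mulr_gt0.
have [r' [/andP[r'm r'm1] Gr' pr']] := itg_mean ab Ip (aeG_itv a0 mT).
have rr' : r < r' by exact: le_lt_trans rm1 r'm.
exists r'; split=> //; first by rewrite r'm r'm1.
have sr : s <= r by apply: le_trans (ltW rm); rewrite lerDl mulr_ge0// ltW.
have := step Gr Gr' rr'.
have dE : d * m.+2%:R = d * m.+1%:R + d by rewrite -[m.+2]addn1 natrD mulrDr mulr1.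
have dE1 : d * m.+1%:R = d * m%:R + d by rewrite -[m.+1 in LHS]addn1 natrD mulrDr mulr1.
have r'r : r' - r <= 2 * d by move: rm r'm1; rewrite dE dE1; lra.
have h1 : (r' - r) * (p r + p r') <= 2 * d * (p r + p r').
  by apply: ler_wpM2r => //; rewrite addr_ge0.
have kE := itg_split Ik sr (ltW rr').
have sm1 : s <= s + d * m.+1%:R by rewrite lerDl mulr_ge0// ltW.
have pE := itg_split Ip sm1 (ltW ab).
have pr2 : d * p r' <= itg p (s + d * m.+1%:R) (s + d * m.+2%:R).
  by move: pr'; rewrite (_ : s + _ - _ = d)//; rewrite dE; ring.
have tri : `|e r' - e s| <= `|e r' - e r| + `|e r - e s| by exact: ler_distD.
move=> h2; rewrite kE pE; move: tri er h1 h2 pr2; lra.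
Qed.

(* The first and last points [s] and [t] are not at our choice, but their
   contributions [d * p s] and [d * p t] vanish with the mesh [d]. *)
Lemma telescope_bound s t : G s -> G t -> 0 < s -> t < T -> s <= t ->
  `|e t - e s| <= itg k s t + 4 * itg p s t.
Proof.
move=> Gs Gt s0 tT; rewrite le_eqVlt => /predU1P[<-|st].
  by rewrite subrr normr0 addr_ge0 ?mulr_ge0//; apply: itg_ge0.
apply/ler_addgt0Pr => z z0.
have [n n0] : exists n : nat, (t - s) * (p s + p t) / z < n.+1%:R.
  exists (Num.truncn ((t - s) * (p s + p t) / z)).
  exact: truncnS_gt.
pose d := (t - s) / n.+1%:R.
have ts0 : 0 < t - s by rewrite subr_gt0.
have d0 : 0 < d by rewrite divr_gt0.
have dn : d * n.+1%:R = t - s by rewrite /d divfK.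
have sdn : s + d * n.+1%:R = t by rewrite dn addrC subrK.
have dz : d * (p s + p t) <= z.
  by rewrite /d mulrAC ler_pdivrMr// [leRHS]mulrC -ler_pdivrMr// ltW.
have := @chain s d Gs s0 d0 n; rewrite sdn => /(_ tT)[r [Gr /andP[rn rt] er]].
have dE1 : d * n.+1%:R = d * n%:R + d by rewrite -[n.+1 in LHS]addn1 natrD mulrDr mulr1.
have sr : s <= r by apply: le_trans (ltW rn); rewrite lerDl mulr_ge0// ltW.
have kE := itg_split Ik sr rt.
have k1 : 0 <= itg k r t by exact: itg_ge0.
have tri : `|e t - e s| <= `|e t - e r| + `|e r - e s| by exact: ler_distD.
have dr : 0 <= d * p r by rewrite mulr_ge0// ltW.
have dt : 0 <= d * p t by rewrite mulr_ge0// ltW.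
move: rt; rewrite le_eqVlt => /predU1P[rtE|rt].
  rewrite rtE in er; move: er dz dt; lra.
have := step Gr Gt rt.
have h1 : (t - r) * (p r + p t) <= d * (p r + p t).
  apply: ler_wpM2r; first by rewrite addr_ge0.
  by move: rn sdn; rewrite dE1; lra.
move=> h2; rewrite kE; move: tri er h1 h2 dz dr; lra.
Qed.

End telescope.

Lemma igr_indic {R : realType} (a b : R) : igr (fun x : R => \1_(`]a, b]%classic) x).
Proof. exact: (@integrable_indic_itv R a b false false). Qed.

Lemma itgZ {R : realType} (h : R -> R) (k a d : R) :
  igr h -> itg (fun t => k * h t) a d = k * itg h a d.
Proof. by move=> Ih; rewrite /itg RintegralZl//; exact: igrS. Qed.

Lemma young_of_CS {R : realType} (x a b l : R) : 0 <= a -> 0 <= b -> 0 < l ->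
  x ^+ 2 <= a * b -> 2 * `|x| <= l * a + l^-1 * b.
Proof.
move=> a0 b0 l0; rewrite -(real_normK (num_real x)).
move: (normr_ge0 x); move: `|x| => z z0 h.
rewrite -(@ler_pXn2r _ 2) ?nnegrE ?addr_ge0 ?mulr_ge0 ?(ltW l0) ?invr_ge0 ?(ltW l0)//.
have -> : (l * a + l^-1 * b) ^+ 2 = (l * a - l^-1 * b) ^+ 2 + 4 * (a * b).
  by field; rewrite gt_eqF.
have -> : (2 * z) ^+ 2 = 4 * z ^+ 2 by ring.
by have := sqr_ge0 (l * a - l^-1 * b); lra.
Qed.

(** * Abstract evolution: [b] is the L^2 product, [q] the squared gradient norm, [g t] the time
    derivative of [w] *)

Section evolution.
Context {R : realType} {V : zmodType}.
Local Notation lam := (@lebesgue_measure R).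
Variables (T : R) (Lp Hp : V -> Prop) (b : V -> V -> R) (q : V -> R).
Hypotheses (LpB : forall u v, Lp u -> Lp v -> Lp (u - v))
  (HpLp : forall u, Hp u -> Lp u) (Hp0 : Hp 0)
  (HpB : forall u v, Hp u -> Hp v -> Hp (u - v))
  (HpD : forall u v, Hp u -> Hp v -> Hp (u + v)).
Hypotheses (bC : forall u v, b u v = b v u)
  (bB : forall u v z, Lp u -> Lp v -> Lp z -> b (u - v) z = b u z - b v z)
  (bge0 : forall u, 0 <= b u u)
  (bCS : forall u v, Lp u -> Lp v -> b u v ^+ 2 <= b u u * b v v).
Hypotheses (qB : forall u v, Hp u -> Hp v -> q (u - v) <= 2 * q u + 2 * q v)
  (qD : forall u v, Hp u -> Hp v -> q (u + v) <= 2 * q u + 2 * q v).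
Variables (g : R -> V -> R) (Ng c : R -> R) (w : R -> V) (G : set R)
  (pf gf : V -> R -> R).
Hypotheses (GT : forall t, G t -> 0 < t < T)
  (aeG : {ae lam, forall t, 0 < t < T -> G t})
  (wHp : forall t, G t -> Hp (w t))
  (pfI : forall u, Hp u -> igr (pf u)) (pf0 : forall u t, 0 <= pf u t)
  (pfE : forall u t, Hp u -> G t -> pf u t = q (w t - u))
  (gfI : forall u, Hp u -> igr (gf u))
  (gfE : forall u t, Hp u -> G t -> gf u t = g t u)
  (NgI : igr Ng) (Ng0 : forall t, 0 <= Ng t)
  (cI : igr c) (cE : forall t, G t -> c t = g t (w t))
  (gB : forall t u v, G t -> Hp u -> Hp v -> g t (u - v) = g t u - g t v)
  (gyoung : forall t u l, G t -> Hp u -> 0 < l ->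
    2 * `|g t u| <= l * Ng t + l^-1 * q u)
  (weak : forall s t u, G s -> G t -> s < t -> Hp u ->
    b (w t - w s) u = itg (gf u) s t).

Let wLp t : G t -> Lp (w t). Proof. by move/wHp/HpLp. Qed.

Let bBr u v z : Lp u -> Lp v -> Lp z -> b z (u - v) = b z u - b z v.
Proof. by move=> *; rewrite bC bB// !(bC z). Qed.

Let b_sqB u v : Lp u -> Lp v -> b (u - v) (u - v) = b u u - 2 * b u v + b v v.
Proof.
move=> Lu Lv; have Luv := LpB Lu Lv.
by rewrite bB// !bBr// (bC v u); ring.
Qed.

Let b_young u v l : Lp u -> Lp v -> 0 < l -> 2 * `|b u v| <= l * b u u + l^-1 * b v v.
Proof. by move=> Lu Lv l0; apply: young_of_CS => //; exact: bCS. Qed.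

Let b_tri u v z : Lp u -> Lp v -> Lp z ->
  b (u - z) (u - z) <= 2 * b (u - v) (u - v) + 2 * b (v - z) (v - z).
Proof.
move=> Lu Lv Lz; have Luv := LpB Lu Lv; have Lzv := LpB Lz Lv.
have -> : u - z = (u - v) - (z - v) by rewrite opprB addrA subrK.
have -> : b (v - z) (v - z) = b (z - v) (z - v).
  by rewrite !b_sqB// (bC v z); ring.
rewrite b_sqB//; have := b_young Luv Lzv ltr01; rewrite invr1 !mul1r.
have := lerNnormlW (lexx `|b (u - v) (z - v)|); lra.
Qed.

Let b_xx u : Lp u -> b (u - u) (u - u) = 0.
Proof. by move=> Lu; rewrite b_sqB//; ring. Qed.

Let aeG_itv a d : 0 <= a -> d < T -> {ae lam, forall x, `]a, d]%classic x -> G x}.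
Proof.
move=> a0 dT; apply: (lam_aeS _ aeG) => x Gx; rewrite /= in_itv/= => /andP[ax xb].
by apply: Gx; rewrite (le_lt_trans a0 ax) (le_lt_trans xb dT).
Qed.

Let E u t := b (w t - u) (w t - u).

(** A difference of squares is [b] of a difference and a sum; the sum is an admissible test element
    because both times lie in [G]. *)
Let E_diff u r r' : Hp u -> G r -> G r' -> r < r' ->
  E u r' - E u r = itg (gf ((w r - u) + (w r' - u))) r r'.
Proof.
move=> hu Gr Gr' rr'.
have hr := HpB (wHp Gr) hu; have hr' := HpB (wHp Gr') hu.
rewrite -weak//; last exact: HpD.
have Lr := HpLp hr; have Lr' := HpLp hr'; have L := HpLp (HpD hr hr').
have -> : w r' - w r = (w r' - u) - (w r - u) by rewrite opprB addrA subrK.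
have -> : (w r - u) + (w r' - u) = (w r' - u) - (0 - (w r - u)) by rewrite sub0r opprK addrC.
have L0 : Lp 0 := HpLp Hp0.
have Ls : Lp (0 - (w r - u)) by exact: LpB.
have b0 z : Lp z -> b z 0 = 0.
  by move=> Lz; rewrite -(subrr (0 : V)) bBr// subrr.
have Ld := LpB Lr' Lr.
rewrite /E; move: Lr Lr' Ls Ld; set y := w r - u; set y' := w r' - u => Lr Lr' Ls Ld.
rewrite (bB Lr' Lr (LpB Lr' Ls)) (bBr Lr' Ls Lr') (bBr Lr' Ls Lr).
rewrite (bBr L0 Lr Lr') (bBr L0 Lr Lr) (b0 _ Lr) (b0 _ Lr') (bC y y').
by move: (b _ _) (b _ _) (b _ _) => *; ring.
Qed.

Let E_step u l r r' : Hp u -> 0 < l -> G r -> G r' -> r < r' ->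
  `|E u r' - E u r| <= itg (fun t => l * Ng t) r r' +
    (r' - r) * (l^-1 * pf u r + l^-1 * pf u r').
Proof.
move=> hu l0 Gr Gr' rr'; rewrite E_diff//.
have hr := HpB (wHp Gr) hu; have hr' := HpB (wHp Gr') hu.
set z := _ + _; have hz : Hp z by exact: HpD.
have qz : q z <= 2 * q (w r - u) + 2 * q (w r' - u) by exact: qD.
apply: (le_trans (itg_abs _ _ (gfI hz))).
have rr : r <= r' by exact: ltW.
rewrite -mulrDr !pfE// mulrC -itg_cst//.
pose C := l^-1 * (q (w r - u) + q (w r' - u)).
have Igz : igr (fun t => `|gf z t|).
  by have := integrable_abse (gfI hz); exact: eq_integrable.
have [/andP[r0 _] /andP[_ r'T]] := (GT Gr, GT Gr').
(* The constant is carried by an indicator so that the majorant is integrable on the whole line. *)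
pose f t := l * Ng t + C * \1_(`]r, r']%classic) t.
have I1 : igr (fun t => C * \1_(`]r, r']%classic) t).
  apply: igrZ; rewrite /igr.
  exact: igr_indic.
have If : igr f by apply: igrD => //; exact: igrZ.
apply: (@le_trans _ _ (itg f r r')).
  apply: (@itg_le_ae _ _ _ _ _ G) => //; first exact: (aeG_itv (ltW r0) r'T).
  move=> t tr Gt; rewrite gfE// /f indicE mem_set// mulr1.
  have := gyoung Gt hz l0.
  have : l^-1 * q z <= 2 * C.
    rewrite /C mulrCA ler_wpM2l ?invr_ge0 ?(ltW l0)//; lra.
  have : 0 <= l * Ng t by rewrite mulr_ge0// ltW.
  lra.
rewrite /f (_ : (fun t => _) = (fun t => 1 * (l * Ng t) + C * \1_(`]r, r']%classic) t)); last first.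
  by apply/funext => t; rewrite mul1r.
rewrite itg_comb//; last exact: igrZ.
rewrite mul1r lerD2l le_eqVlt; apply/orP; left; apply/eqP.
by apply: itg_eq => t tr; rewrite indicE mem_set// mulr1.
Qed.

Let E_le u l s t : Hp u -> 0 < l -> G s -> G t -> s <= t ->
  `|E u t - E u s| <= l * itg Ng s t + 4 * (l^-1 * itg (pf u) s t).
Proof.
move=> hu l0 Gs Gt st.
have [/andP[s0 _] /andP[_ tT]] := (GT Gs, GT Gt).
rewrite -(itgZ l _ _ NgI) -(itgZ l^-1 _ _ (pfI hu)).
apply: (@telescope_bound _ T G aeG (E u) (fun t => l^-1 * pf u t) (fun t => l * Ng t)) => //.
- by apply: igrZ; exact: pfI.
- exact: igrZ.
- by move=> x; rewrite mulr_ge0// invr_ge0 ltW.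
- by move=> x; rewrite mulr_ge0// ltW.
- by move=> r r' Gr Gr' rr'; exact: E_step.
Qed.

Definition modulus t := 64 * (Ng t + pf 0 t).

Let kI : igr modulus.
Proof. by apply: igrZ; apply: igrD => //; exact: pfI. Qed.

Let k0 t : 0 <= modulus t. Proof. by rewrite mulr_ge0// addr_ge0. Qed.

(** At the mean-value time [r] for [pf 0], the integrals of [pf (w r)] are at most 4 times that of
    [pf 0]. Since [E (w r)] vanishes at [r], [E_le] bounds the squared distances from [w r] to [w s]
    and to [w t] by the integral of [Ng + 16 * pf 0]. The triangle inequality for squares then gives
    the coefficients 4 and 64, both covered by the 64 of [modulus]. *)
Lemma w_modulus s t : G s -> G t -> s < t ->
  b (w t - w s) (w t - w s) <= itg modulus s t.
Proof.
move=> Gs Gt st; have [/andP[s0 _] /andP[_ tT]] := (GT Gs, GT Gt).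
have I0 := pfI Hp0.
have [r [/andP[sr rt] Gr pr]] := itg_mean st I0 (aeG_itv (ltW s0) tT).
have hr := wHp Gr.
have Ir := pfI hr.
have P0 : 0 <= itg (pf 0) s t by exact: itg_ge0.
have pfr a d : s <= a -> a <= d -> d <= t -> itg (pf (w r)) a d <= 4 * itg (pf 0) s t.
  move=> sa ad dt.
  have a0 : 0 <= a by rewrite (le_trans (ltW s0)).
  have Icst : igr (fun x => 2 * pf 0 x + 2 * pf 0 r * \1_(`]s, t]%classic) x).
    apply: igrD; first exact: igrZ.
    by apply: igrZ; exact: igr_indic.
  apply: (@le_trans _ _ (itg (fun x => 2 * pf 0 x + 2 * pf 0 r * \1_(`]s, t]%classic) x) a d)).
    apply: (@itg_le_ae _ _ _ _ _ G) => //; first exact: aeG_itv a0 (le_lt_trans dt tT).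
    move=> x xad Gx; rewrite !pfE// !subr0 indicE mem_set ?mulr1; first by apply: qB => //; exact: wHp.
    by move: xad; rewrite /= !in_itv/= => /andP[ax xd]; rewrite (le_lt_trans sa ax) (le_trans xd dt).
  rewrite itg_comb//; last by apply: igrZ; exact: igr_indic.
  have -> : itg (fun x => 2 * pf 0 r * \1_(`]s, t]%classic) x) a d = 2 * pf 0 r * (d - a).
    rewrite -itg_cst//; apply: itg_eq => x xad; rewrite indicE mem_set ?mulr1//.
    by move: xad; rewrite /= !in_itv/= => /andP[ax xd]; rewrite (le_lt_trans sa ax) (le_trans xd dt).
  have h1 : itg (pf 0) a d <= itg (pf 0) s t.
    have e1 := itg_split I0 sa (le_trans ad dt); have e2 := itg_split I0 ad dt.
    have p1 : 0 <= itg (pf 0) s a by exact: itg_ge0.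
    have p2 : 0 <= itg (pf 0) d t by exact: itg_ge0.
    by rewrite e1 e2; lra.
  have h2 : pf 0 r * (d - a) <= pf 0 r * (t - s) by rewrite ler_wpM2l//; lra.
  by move: pr h1 h2; rewrite (mulrC (t - s)); lra.
have Ngle a d : s <= a -> a <= d -> d <= t -> itg Ng a d <= itg Ng s t.
  move=> sa ad dt.
  have e1 := itg_split NgI sa (le_trans ad dt); have e2 := itg_split NgI ad dt.
  have p1 : 0 <= itg Ng s a by exact: itg_ge0.
  have p2 : 0 <= itg Ng d t by exact: itg_ge0.
  by rewrite e1 e2; lra.
have A := E_le hr ltr01 Gr Gt rt; have B := E_le hr ltr01 Gs Gr (ltW sr).
rewrite /E invr1 !mul1r b_xx ?subr0 in A; last exact: wLp.
rewrite /E invr1 !mul1r b_xx ?sub0r ?normrN in B; last exact: wLp.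
have := b_tri (wLp Gt) (wLp Gr) (wLp Gs).
have -> : b (w r - w s) (w r - w s) = b (w s - w r) (w s - w r).
  rewrite (b_sqB (wLp Gr) (wLp Gs)) (b_sqB (wLp Gs) (wLp Gr)) (bC (w r) (w s)).
  by move: (b _ _) (b _ _) (b _ _) => *; ring.
rewrite ger0_norm// in A; rewrite ger0_norm// in B.
have := pfr r t (ltW sr) rt (lexx t); have := pfr s r (lexx s) (ltW sr) rt.
have := Ngle r t (ltW sr) rt (lexx t); have := Ngle s r (lexx s) (ltW sr) rt.
have -> : itg modulus s t = 64 * itg Ng s t + 64 * itg (pf 0) s t.
  rewrite -(itgZ 64 _ _ I0) -itg_comb//; last exact: igrZ.
  by apply: itg_eq => x _; rewrite /modulus mulrDr.
have P1 : 0 <= itg Ng s t by exact: itg_ge0.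
move: A B P0 P1; lra.
Qed.

(** [b (w t) (w t)] equals [E u t] plus [2 * b (w t) u] minus a constant. The first term contributes
    [l] and [4 * l^-1] by [E_le]. The increment of the second is the integral of [2 * gf u], and
    Young's inequality exchanges [gf u] for [c] at a further cost of [l] and [l^-1]. *)
Lemma energy_le u l s t : Hp u -> 0 < l -> G s -> G t -> s <= t ->
  `|b (w t) (w t) - b (w s) (w s) - 2 * itg c s t| <=
  2 * (l * itg Ng s t) + 5 * (l^-1 * itg (pf u) s t).
Proof.
move=> hu l0 Gs Gt st; have Lu := HpLp hu.
have [/andP[s0 _] /andP[_ tT]] := (GT Gs, GT Gt).
have A := E_le hu l0 Gs Gt st.
have Wst : b (w t - w s) u = itg (gf u) s t.
  move: st; rewrite le_eqVlt => /predU1P[->|st]; last exact: weak.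
  rewrite (bB (wLp Gt) (wLp Gt) Lu) subrr /itg set_itv_ge ?Rintegral_set0//.
  by rewrite bnd_simp ltxx.
rewrite (bB (wLp Gt) (wLp Gs) Lu) in Wst.
rewrite /E (b_sqB (wLp Gt) Lu) (b_sqB (wLp Gs) Lu) in A.
have Iu := pfI hu; have Igu := gfI hu.
have B : 2 * `|itg (fun x => -1 * gf u x + c x) s t| <=
    l * itg Ng s t + l^-1 * itg (pf u) s t.
  have Id : igr (fun x => -1 * gf u x + c x) by apply: igrD => //; exact: igrZ.
  have I1 : igr (fun x => l * Ng x + l^-1 * pf u x) by apply: igrD; exact: igrZ.
  have Ida : igr (fun x => `|-1 * gf u x + c x|).
    by have := integrable_abse Id; exact: eq_integrable.
  apply: (@le_trans _ _ (2 * itg (fun x => `|-1 * gf u x + c x|) s t)).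
    by rewrite ler_pM2l//; exact: itg_abs.
  rewrite -(itgZ l^-1 _ _ Iu) -(@itg_comb _ l)//; last exact: igrZ.
  rewrite -(itgZ 2 _ _ Ida).
  apply: (@itg_le_ae _ _ _ _ _ G) => //; first exact: igrZ.
    exact: aeG_itv (ltW s0) tT.
  move=> x _ Gx; rewrite (gfE hu Gx) (cE Gx) (pfE hu Gx) mulN1r addrC.
  rewrite -(gB Gx (wHp Gx) hu).
  exact: (gyoung Gx (HpB (wHp Gx) hu) l0).
rewrite (itg_comb (-1) s t Igu cI) in B.
move: A B Wst; move: (b (w t) (w t)) (b (w s) (w s)) (b (w t) u) (b (w s) u) (b u u).
move: (itg (gf u) s t) (itg c s t) (l * itg Ng s t) (l^-1 * itg (pf u) s t).
move=> i j k m x1 x2 x3 x4 x5 + + E1.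
rewrite !ler_norml -ler_pdivlMl// ler_norml => /andP[A1 A2] /andP[B1 B2].
by apply/andP; split; lra.
Qed.

End evolution.

(** * From almost all times to the cells of a partition *)

Section cells.
Context {R : realType}.
Variables (T : R) (G : set R).
Hypothesis T0 : 0 < T.
Local Notation lam := (@lebesgue_measure R).
Hypothesis (aeG : {ae lam, forall t, 0 < t < T -> G t}).

Lemma ae_near a e t : 0 <= a -> a < e -> e <= T -> 0 < t ->
  exists s, [/\ G s, a < s < e & s < a + t].
Proof.
move=> a0 ae eT t0.
pose m := Num.min (a + (e - a) / 2) (a + t / 2).
have am : a < m by rewrite lt_min; apply/andP; split; lra.
have me : m < e by rewrite gt_min; apply/orP; left; lra.
have mt : m < a + t by rewrite gt_min; apply/orP; right; lra.
have : {ae lam, forall x, `]a, m]%classic x -> G x}.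
  apply: (lam_aeS _ aeG) => x Gx; rewrite /= in_itv/= => /andP[ax xm].
  by apply: Gx; lra.
move=> /(ae_exists am)[s [/andP[as_ sm] Gs]]; exists s; split => //; last lra.
by lra.
Qed.

Lemma ae_dense t e : 0 <= t <= T -> 0 < e -> exists2 s, G s & `|t - s| < e.
Proof.
move=> /andP[t0 tT] e0; have [tT'|] := ltP t T.
  have [s [Gs /andP[ts _] se]] := ae_near t0 tT' (lexx T) e0.
  by exists s => //; rewrite ltr_norml; apply/andP; split; lra.
move=> Tt; have tE : t = T by apply/eqP; rewrite eq_le tT.
pose a := Num.max 0 (T - e).
have a0 : 0 <= a by rewrite le_max lexx.
have aT : a < T by rewrite gt_max T0/=; lra.
have [s [Gs /andP[as_ sT] _]] := ae_near a0 aT (lexx T) ltr01.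
exists s => //; rewrite tE ltr_norml; apply/andP; split; first lra.
have : T - e <= a by rewrite le_max lexx orbT.
lra.
Qed.

Variable F : R -> R.
Hypothesis contF : forall t, 0 <= t <= T -> forall e, 0 < e ->
  exists2 d, 0 < d & forall s, G s -> `|t - s| < d -> `|F t - F s| <= e.

(** The endpoints of a cell need not belong to [G]; the continuity of [F] relative to [G] carries
    the bound to them. *)
Lemma cell_le a e m : 0 <= a -> a < e -> e <= T ->
  (forall s t, G s -> G t -> a < s -> s <= t -> t < e -> `|F t - F s| <= m) ->
  `|F e - F a| <= m.
Proof.
move=> a0 ae eT H; apply/ler_addgt0Pr => z z0.
have z2 : 0 < z / 2 by rewrite divr_gt0.
have aT : 0 <= a <= T by rewrite a0 (le_trans (ltW ae)).
have eT' : 0 <= e <= T by rewrite eT (le_trans a0 (ltW ae)).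
have [d1 d10 H1] := contF aT z2; have [d2 d20 H2] := contF eT' z2.
pose h := (a + e) / 2.
have ah : a < h by rewrite /h; lra.
have he : h < e by rewrite /h; lra.
have [s [Gs /andP[as_ sh] sd]] := ae_near a0 ah (le_trans (ltW he) eT) d10.
pose h' := Num.max h (e - d2).
have h'e : h' < e by rewrite gt_max he/=; lra.
have h'0 : 0 <= h' by rewrite le_max; apply/orP; left; lra.
have [t [Gt /andP[ht te] _]] := ae_near h'0 h'e eT ltr01.
move: ht; rewrite gt_max => /andP[ht dt].
have := H s t Gs Gt as_ (ltW (lt_trans sh ht)) te.
have := H1 s Gs; rewrite ltr_norml => /(_ ltac:(apply/andP; split; lra)).
have := H2 t Gt; rewrite ltr_norml => /(_ ltac:(apply/andP; split; lra)).
rewrite !ler_norml => /andP[? ?] /andP[? ?] /andP[? ?].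
by apply/andP; split; lra.
Qed.

Lemma cells_sum n (m : nat -> R) : (0 < n)%N ->
  (forall k, (k < n)%N -> forall s t, G s -> G t ->
     T * k%:R / n%:R < s -> s <= t -> t < T * k.+1%:R / n%:R -> `|F t - F s| <= m k) ->
  `|F T - F 0| <= \sum_(k < n) m k.
Proof.
move=> n0 H.
have n0' : 0 < n%:R :> R by rewrite ltr0n.
have Tn : 0 < T / n%:R by rewrite divr_gt0.
have E k : T * k%:R / n%:R = (T / n%:R) * k%:R by rewrite mulrAC.
have HT : T * n%:R / n%:R = T by rewrite mulfK// gt_eqF.
suff : forall j, (j <= n)%N -> `|F (T * j%:R / n%:R) - F 0| <= \sum_(k < j) m k.
  by move=> /(_ n (leqnn n)); rewrite HT.
elim=> [_|j IH jn].
  by rewrite mulr0 mul0r subrr normr0 big_ord0.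
rewrite big_ord_recr/=; have := IH (ltnW jn).
have := @cell_le (T * j%:R / n%:R) (T * j.+1%:R / n%:R) (m j).
have -> : 0 <= T * j%:R / n%:R by rewrite divr_ge0// mulr_ge0// ltW.
have -> : T * j%:R / n%:R < T * j.+1%:R / n%:R by rewrite !E ltr_pM2l// ltr_nat.
have -> : T * j.+1%:R / n%:R <= T.
  by rewrite -[leRHS]HT !E ler_pM2l// ler_nat.
move=> /(_ isT isT isT (H j jn)).
by move: (F _) (F _) (F _) => x y z; rewrite !ler_norml => /andP[? ?] /andP[? ?]; apply/andP; split; lra.
Qed.

End cells.

(** * Continuous extension from a set of times of full measure *)

Section continuous_extension.
Context {R : realType} {V : zmodType}.
Local Notation lam := (@lebesgue_measure R).
Variables (T : R) (G : set R) (Lp : V -> Prop) (b : V -> V -> R) (w : R -> V) (k : R -> R).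
Hypotheses (T0 : 0 < T) (aeG : {ae lam, forall t, 0 < t < T -> G t}).
Hypotheses (bge0 : forall u, 0 <= b u u)
  (bS : forall u v, Lp u -> Lp v -> b (u - v) (u - v) = b (v - u) (v - u))
  (b_tri : forall u v z, Lp u -> Lp v -> Lp z ->
     b (u - z) (u - z) <= 2 * b (u - v) (u - v) + 2 * b (v - z) (v - z))
  (bxx : forall u, Lp u -> b (u - u) (u - u) = 0)
  (bcomplete : forall u : nat -> V, (forall n, Lp (u n)) ->
    (forall n, b (u n.+1 - u n) (u n.+1 - u n) <= 8^-1 ^+ n) ->
    exists f, Lp f /\ b (f - u n) (f - u n) @[n --> \oo] --> (0 : R)).
Hypotheses (wLp : forall t, G t -> Lp (w t)) (kI : igr k)
  (wk : forall s t, G s -> G t -> s < t -> b (w t - w s) (w t - w s) <= itg k s t).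

Let unif e : 0 < e -> exists2 d, 0 < d & forall s t, G s -> G t -> `|s - t| < d ->
  b (w t - w s) (w t - w s) <= e.
Proof.
move=> e0; have [d d0 H] := itg_small kI e0; exists d => //.
have {}H s t : G s -> G t -> s < t -> `|s - t| < d -> b (w t - w s) (w t - w s) <= e.
  move=> Gs Gt st sd; apply: le_trans (wk Gs Gt st) _.
  rewrite distrC gtr0_norm ?subr_gt0// in sd.
  apply: le_trans (ltW (H s t (ltW st) sd)).
  apply: itg_le => //; last by move=> x _; exact: ler_norm.
  by have := integrable_abse kI; exact: eq_integrable.
move=> s t Gs Gt sd; have [st|ts|<-] := ltgtP s t; first exact: H.
- by rewrite (bS (wLp Gt) (wLp Gs)); apply: H => //; rewrite distrC.
- by rewrite (bxx (wLp Gs)) ltW.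
Qed.

(** The function [del] is chosen before [t]; this uniformity is what makes the extension itself
    uniformly continuous. *)
Lemma extension_at : exists del : R -> R, (forall e, 0 < e -> 0 < del e) /\
  forall t, 0 <= t <= T -> exists f, Lp f /\
    forall e, 0 < e -> forall s, G s -> `|t - s| < del e -> b (f - w s) (f - w s) <= e.
Proof.
have /choice[D HD] : forall e, exists d, 0 < e -> 0 < d /\
    forall s t, G s -> G t -> `|s - t| < d -> b (w t - w s) (w t - w s) <= e.
  move=> e; have [e0|e0] := ltP 0 e; last by exists 0.
  by have [d d0 H] := unif e0; exists d.
exists (fun e => D (e / 4) / 2); split.
  by move=> e e0; rewrite divr_gt0// (HD _ _).1// divr_gt0.
move=> t tT.
have p8 n : 0 < 8^-1 ^+ n :> R by rewrite exprn_gt0// invr_gt0.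
pose dl n := D (8^-1 ^+ n).
have dl0 n : 0 < dl n by exact: (HD _ (p8 n)).1.
(* Both [s n] and [s n.+1] must be within [dl n / 2] of [t], whence the minimum over two consecutive
   indices: the step between them then meets the rate asked by [bcomplete]. The last term forces
   [s n] to tend to [t]. *)
pose eta n := Num.min (Num.min (dl n) (dl n.-1) / 2) (n.+1%:R^-1).
have eta0 n : 0 < eta n.
  by rewrite lt_min invr_gt0 ltr0n andbT divr_gt0// lt_min !dl0.
have /choice[s Hs] : forall n, exists s, G s /\ `|t - s| < eta n.
  by move=> n; have [s Gs sd] := ae_dense T0 aeG tT (eta0 n); exists s.
have sn n : `|s n - s n.+1| < dl n.
  have := (Hs n).2; have := (Hs n.+1).2; rewrite /eta !lt_min => /andP[h1 _] /andP[h2 _].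
  move: h1 h2; rewrite !ltr_pdivlMr// !lt_min/= => /andP[_ h1] /andP[h2 _].
  rewrite (le_lt_trans (ler_distD t _ _))//.
  rewrite (distrC (s n) t); move: h1 h2.
  by move: (dl n) `|_| `|_| => x y z; lra.
have [f [Lf ff]] := bcomplete (fun n => wLp (Hs n).1)
  (fun n => (HD _ (p8 n)).2 _ _ (Hs n).1 (Hs n.+1).1 (sn n)).
exists f; split => // e e0 r Gr tr.
have e4 : 0 < e / 4 by rewrite divr_gt0.
have De : 0 < D (e / 4) / 2 by rewrite divr_gt0// (HD _ e4).1.
move/cvgrPdist_le : ff => /(_ _ e4) ff.
near \oo => n.
have fn : b (f - w (s n)) (f - w (s n)) <= e / 4.
  have : `|0 - b (f - w (s n)) (f - w (s n))| <= e / 4 by near: n.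
  by rewrite sub0r normrN ger0_norm.
have nn : n.+1%:R^-1 < D (e / 4) / 2 by near: n; exact: near_infty_natSinv_lt (PosNum De).
have tsn : `|t - s n| < D (e / 4) / 2.
  by have := (Hs n).2; rewrite lt_min => /andP[_ h]; exact: lt_trans h nn.
have := b_tri Lf (wLp (Hs n).1) (wLp Gr).
have := (HD _ e4).2 r (s n) Gr (Hs n).1.
rewrite (le_lt_trans (ler_distD t _ _)); last first.
  by rewrite (distrC r t); move: tr tsn; move: (D _) `|_| `|_| => x y z; lra.
move=> /(_ isT); move: fn; move: (b _ _) (b _ _) (b _ _) => x y z; lra.
Unshelve. all: by end_near.
Qed.

Lemma continuous_extension : exists W : R -> V,
  [/\ forall t, 0 <= t <= T -> Lp (W t),
    forall e, 0 < e -> exists2 d, 0 < d & forall t, 0 <= t <= T ->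
      forall s, G s -> `|t - s| < d -> b (W t - w s) (W t - w s) <= e,
    forall e, 0 < e -> exists2 d, 0 < d & forall s t, 0 <= s <= T -> 0 <= t <= T ->
      `|t - s| < d -> b (W t - W s) (W t - W s) <= e &
    forall t, 0 <= t <= T -> G t -> b (W t - w t) (W t - w t) = 0].
Proof.
have [D [D0 H]] := extension_at.
have /choice[W HW] : forall t, exists f, 0 <= t <= T -> Lp f /\
    forall e, 0 < e -> forall s, G s -> `|t - s| < D e -> b (f - w s) (f - w s) <= e.
  move=> t; have [tT|tT] := boolP (0 <= t <= T); last by exists 0.
  by have [f Hf] := H t tT; exists f.
exists W; split.
- by move=> t /HW[].
- by move=> e e0; exists (D e); [exact: D0|move=> t /HW[_ +]; apply].
- move=> e e0; have e4 : 0 < e / 4 by rewrite divr_gt0.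
  exists (D (e / 4) / 2); first by rewrite divr_gt0// D0.
  move=> s t sT tT st.
  have De : 0 < D (e / 4) / 2 by rewrite divr_gt0// D0.
  have [r Gr rt] := ae_dense T0 aeG tT De.
  have h1 := (HW t tT).2 _ e4 r Gr.
  have h2 := (HW s sT).2 _ e4 r Gr.
  have := b_tri (HW t tT).1 (wLp Gr) (HW s sT).1.
  rewrite (bS (wLp Gr) (HW s sT).1).
  move: h1; rewrite (_ : `|t - r| < _); last by move: rt De; move: (D _) `|_| => x y; lra.
  move: h2; rewrite (le_lt_trans (ler_distD t _ _)); last first.
    by rewrite (distrC s t); move: rt st; move: (D _) `|_| `|_| => x y z; lra.
  move=> /(_ isT) + /(_ isT); move: (b _ _) (b _ _) (b _ _) => x y z; lra.
- move=> t tT Gt; apply/eqP; rewrite eq_le bge0 andbT; apply/ler_addgt0Pr => e e0.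
  rewrite add0r; apply: (HW t tT).2 => //; by rewrite subrr normr0 D0.
Qed.

End continuous_extension.

(** * The energy identity *)

Section energy.
Context {R : realType} {V : zmodType}.
Local Notation lam := (@lebesgue_measure R).
Variables (T : R) (G : set R) (Lp Hp : V -> Prop) (b : V -> V -> R) (w W : R -> V)
  (Ng c : R -> R) (pf : V -> R -> R).
Hypotheses (T0 : 0 < T) (aeG : {ae lam, forall t, 0 < t < T -> G t})
  (GT : forall t, G t -> 0 < t < T).
Hypotheses (bge0 : forall u, 0 <= b u u)
  (b_sq : forall u v l, Lp u -> Lp v -> 0 < l ->
     `|b u u - b v v| <= l * b u u + (1 + l^-1) * b (u - v) (u - v)).
Hypotheses (NgI : igr Ng) (Ng0 : forall t, 0 <= Ng t) (cI : igr c)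
  (pfI : forall u, Hp u -> igr (pf u)) (pf0 : forall u t, 0 <= pf u t).
Hypotheses (WLp : forall t, 0 <= t <= T -> Lp (W t)) (wLp : forall t, G t -> Lp (w t))
  (Ww : forall e, 0 < e -> exists2 d, 0 < d & forall t, 0 <= t <= T ->
      forall s, G s -> `|t - s| < d -> b (W t - w s) (W t - w s) <= e)
  (WwG : forall t, 0 <= t <= T -> G t -> b (W t) (W t) = b (w t) (w t)).
Hypothesis energy : forall u l s t, Hp u -> 0 < l -> G s -> G t -> s <= t ->
  `|b (w t) (w t) - b (w s) (w s) - 2 * itg c s t| <=
  2 * (l * itg Ng s t) + 5 * (l^-1 * itg (pf u) s t).
Hypothesis step : forall e, 0 < e -> exists n (u : nat -> V), [/\ (0 < n)%N,
  forall k, Hp (u k) &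
  \sum_(k < n) itg (pf (u k)) (T * k%:R / n%:R) (T * k.+1%:R / n%:R) <= e].

Let F t := b (W t) (W t) - 2 * itg c 0 t.

Let itg_mono (f : R -> R) (s t a e : R) : igr f -> (forall x, 0 <= f x) -> a <= s -> s <= t -> t <= e ->
  itg f s t <= itg f a e.
Proof.
move=> If f0 as_ st te.
have e1 := itg_split If as_ (le_trans st te); have e2 := itg_split If st te.
have p1 : 0 <= itg f a s by exact: itg_ge0.
have p2 : 0 <= itg f t e by exact: itg_ge0.
by move: e1 e2 p1 p2; move: (itg f a e) (itg f a s) (itg f s e) (itg f s t) (itg f t e) => *; lra.
Qed.

Let contF t : 0 <= t <= T -> forall e, 0 < e ->
  exists2 d, 0 < d & forall s, G s -> `|t - s| < d -> `|F t - F s| <= e.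
Proof.
move=> tT e e0; pose M := b (W t) (W t).
have M0 : 0 <= M by exact: bge0.
(* In [b_sq] the weight [l] makes the term with the fixed number [M] small; the large coefficient
   left on the squared distance is then absorbed by taking [s] close to [t]. *)
pose l := e / (4 * (M + 1)).
have l0 : 0 < l by rewrite divr_gt0// mulr_gt0// ltr_wpDl.
have lM : l * M <= e / 4.
  rewrite /l mulrAC ler_pdivrMr ?mulr_gt0 ?ltr_wpDl//.
  rewrite mulrA divfK// ler_pM2l//; lra.
have h0 : 0 < e / 4 / (1 + l^-1) by rewrite !divr_gt0// addr_gt0// invr_gt0.
have [d1 d10 H1] := Ww h0.
have e4 : 0 < e / 4 by rewrite divr_gt0.
have [d2 d20 H2] := itg_small cI e4.
exists (Num.min d1 d2); first by rewrite lt_min d10.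
move=> s Gs; rewrite lt_min => /andP[s1 s2].
have /andP[s0 sT] := GT Gs; have /andP[t0 tT'] := tT.
have A : `|b (W t) (W t) - b (W s) (W s)| <= e / 2.
  rewrite (WwG _ Gs) ?(ltW s0) ?(ltW sT)//.
  apply: le_trans (b_sq (WLp tT) (wLp Gs) l0) _; rewrite -/M.
  have := H1 t tT s Gs s1; rewrite ler_pdivlMr ?addr_gt0 ?invr_gt0// mulrC.
  by move: lM; move: (l * M) (_ * b _ _) => x y; lra.
have B : `|itg c 0 t - itg c 0 s| <= e / 4.
  have [st|ts] := leP s t.
    rewrite (itg_split cI (ltW s0) st) addrAC subrr add0r.
    apply: (le_trans (itg_abs _ _ cI)); apply/ltW/H2 => //.
    by rewrite ger0_norm ?subr_ge0 in s2.
  rewrite (itg_split cI t0 (ltW ts)) opprD addrA subrr sub0r normrN.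
  apply: (le_trans (itg_abs _ _ cI)); apply/ltW/H2 => //; first exact: ltW.
  by rewrite distrC gtr0_norm ?subr_gt0 in s2.
rewrite /F; move: A B; move: (b _ _) (b _ _) (itg _ _ _) (itg _ _ _) => x y z u.
rewrite !ler_norml => /andP[? ?] /andP[? ?]; apply/andP; split; lra.
Qed.

Lemma energy_identity : b (W T) (W T) - b (W 0) (W 0) = 2 * itg c 0 T.
Proof.
suff : `|F T - F 0| <= 0.
  rewrite normr_le0 subr_eq0 /F => /eqP.
  rewrite [in RHS]/itg set_itv_ge ?bnd_simp ?ltxx// Rintegral_set0 mulr0 subr0.
  by move=> <-; rewrite opprB addrC subrK.
apply/ler_addgt0Pr => e e0; rewrite add0r.
pose N := itg Ng 0 T; have N0 : 0 <= N by exact: itg_ge0.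
pose l := e / (4 * (N + 1)).
have l0 : 0 < l by rewrite divr_gt0// mulr_gt0// ltr_wpDl.
have lN : l * N <= e / 4.
  rewrite /l mulrAC ler_pdivrMr ?mulr_gt0 ?ltr_wpDl//.
  rewrite mulrA divfK// ler_pM2l//; lra.
(* The weight [l] is fixed first, making the dual-norm part at most [2 * (e / 4)]; the partition and
   its elements are chosen afterwards, making the gradient part at most [5 * (e / 10)]. *)
have h0 : 0 < l * (e / 10) by rewrite mulr_gt0// divr_gt0.
have [n [u [n0 hu Hu]]] := step h0.
have n0' : 0 < n%:R :> R by rewrite ltr0n.
pose p (k : nat) : R := T * k%:R / n%:R.
have pS k : p k <= p k.+1 by rewrite /p ler_pM2r ?invr_gt0// ler_pM2l// ler_nat.
have p0 k : 0 <= p k by rewrite /p divr_ge0// mulr_ge0// ltW.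
apply: le_trans (@cells_sum R T G T0 aeG F contF n
  (fun k => 2 * (l * itg Ng (p k) (p k.+1)) + 5 * (l^-1 * itg (pf (u k)) (p k) (p k.+1))) n0 _) _.
  move=> k kn s t Gs Gt ks st te.
  have := energy (hu k) l0 Gs Gt st.
  have /andP[s0 sT] := GT Gs; have /andP[t0 tT] := GT Gt.
  rewrite /F (WwG _ Gs) ?(ltW s0) ?(ltW sT)// (WwG _ Gt) ?(ltW t0) ?(ltW tT)//.
  rewrite (itg_split cI (ltW s0) st).
  have h1 : l * itg Ng s t <= l * itg Ng (p k) (p k.+1).
    by rewrite ler_pM2l//; apply: itg_mono => //; exact: ltW.
  have h2 : l^-1 * itg (pf (u k)) s t <= l^-1 * itg (pf (u k)) (p k) (p k.+1).
    by rewrite ler_pM2l ?invr_gt0//; apply: itg_mono => //; [exact: pfI|exact: ltW|exact: ltW].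
  move: h1 h2; move: (l^-1 * itg _ _ _) (l^-1 * itg _ s t) (l * itg Ng _ _) (l * itg Ng s t).
  move: (b _ _) (b _ _) (itg c _ _) (itg c _ _).
  move=> x5 x6 x7 x8 x4 x3 x2 x1 h1 h2; rewrite !ler_norml => /andP[? ?].
  by apply/andP; split; lra.
rewrite big_split/= -!mulr_sumr.
have SN j : \sum_(i < j) itg Ng (p i) (p i.+1) = itg Ng 0 (p j).
  elim: j => [|j IH].
    rewrite big_ord0 /p mulr0 mul0r /itg set_itv_ge ?bnd_simp ?ltxx//.
    by rewrite Rintegral_set0.
  by rewrite big_ord_recr/= IH -itg_split.
rewrite SN (_ : p n = T); last by rewrite /p mulfK// gt_eqF.
have : l^-1 * (\sum_(k < n) itg (pf (u k)) (p k) (p k.+1)) <= e / 10.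
  by rewrite ler_pdivrMl.
rewrite -/N; move: lN; move: (l * N) (l^-1 * _) => x y; lra.
Qed.

End energy.

(** * Slices of functions on the cylinder *)

Section negligible.
Context d (X : measurableType d) (R : realType) (m : {measure set X -> \bar R}).
Import HBNNSimple.

Let nnint (f : X -> \bar R) : \bar R :=
  ereal_sup [set sintegral m h | h in [set h : {nnsfun X >-> R} | forall x, ((h x)%:E <= f x)%E]].

Let nnint_le (f g : X -> \bar R) (N : set X) : measurable N -> m N = 0%E ->
  (forall x, (0 <= g x)%E) -> (forall x, ~ N x -> f x = g x) -> (nnint f <= nnint g)%E.
Proof.
move=> mN N0 g0 fg; apply: ub_ereal_sup => _ [h hf <-].
apply: ereal_sup_ubound; exists (proj_nnsfun h (measurableC mN)).
  move=> x /=; rewrite /proj_nnsfun/= mindicE.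
  have [xN|xN] := pselect (N x); first by rewrite memNset ?mulr0//= => /(_ xN).
  by rewrite mem_set// mulr1 -fg.
have S (k : {nnsfun X >-> R}) : sintegral m k = (\int[m]_x (k x)%:E)%E.
  by rewrite integral_nnsfun// patch_setT.
rewrite !S; apply: ae_eq_integral => //.
- by apply/measurable_EFinP.
- by apply/measurable_EFinP.
- exists N; split => // x /= /not_implyP[_] ne; apply: contrapT => xN; apply: ne.
  by rewrite /proj_nnsfun/= mindicE mem_set// mulr1.
Qed.

(* No measurability: a nonnegative simple function below [f] remains one, with
   the same integral, after being set to zero on the null set. *)
Lemma ae_eq_integral_any (D : set X) (f g : X -> \bar R) :
  {ae m, forall x, D x -> f x = g x} -> (\int[m]_(x in D) f x = \int[m]_(x in D) g x)%E.
Proof.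
move=> [N [mN N0 HN]].
have fg x : ~ N x -> (f \_ D) x = (g \_ D) x.
  move=> xN; rewrite !patchE; case: ifPn => // /set_mem xD.
  by apply: contrapT => ne; apply: xN; apply: HN => /= /(_ xD).
have H (u v : X -> \bar R) : (forall x, 0 <= u x)%E -> (forall x, 0 <= v x)%E ->
    (forall x, ~ N x -> u x = v x) -> nnint u = nnint v.
  move=> u0 v0 uv; apply/eqP; rewrite eq_le (nnint_le mN N0 v0 uv)/=.
  by apply: (nnint_le mN N0 u0) => x /uv.
rewrite /integral; congr (_ - _)%E; apply: H => //.
- by move=> x /fg; rewrite !funeposE => ->.
- by move=> x /fg; rewrite !funenegE => ->.
Qed.

Lemma ae_eq_Rintegral (D : set X) (f g : X -> R) :
  {ae m, forall x, D x -> f x = g x} -> \int[m]_(x in D) f x = \int[m]_(x in D) g x.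
Proof.
move=> [N [mN N0 HN]]; rewrite /Rintegral; congr fine; apply: ae_eq_integral_any.
by exists N; split => // x /= Hx; apply: HN => /= h; apply: Hx => /h ->.
Qed.

(** Fubini's theorem yields inner integrals in the extended reals, finite almost everywhere; [fine]
    changes them on a null set only. *)
Lemma integrable_fine (D : set X) (f : X -> \bar R) : measurable D ->
  m.-integrable D f -> m.-integrable D (EFin \o (fine \o f)) /\
  \int[m]_(x in D) fine (f x) = fine (\int[m]_(x in D) f x).
Proof.
move=> mD If; have mf := measurable_int _ If; split.
  apply: (le_integrable mD _ _ If).
    by apply/measurable_EFinP; apply: measurableT_comp => //; exact: fine_measurable.
  by move=> x _ /=; case: (f x) => [r| |]//=; rewrite normr0 ?leey.
congr fine; apply: ae_eq_integral_any.
have [N [mN N0 HN]] := integrable_ae mD If; exists N; split => // x /= Hx; apply: HN => /= h.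
by apply: Hx => /h; exact: fineK.
Qed.

End negligible.

(** * Fubini's theorem for slices of a product set *)

Section fubini_slice.
Context d1 d2 (T1 : measurableType d1) (T2 : measurableType d2) (R : realType).
Variables (m1 : {sigma_finite_measure set T1 -> \bar R})
  (m2 : {sigma_finite_measure set T2 -> \bar R}) (A : set T1) (D : set T2).
Hypotheses (mA : measurable A) (mD : measurable D).
Implicit Types (f : T1 * T2 -> R).
Local Notation Q := (A `*` D).
Local Notation m12 := (m1 \x m2)%E.

Section int.
Variable f : T1 * T2 -> R.
Hypothesis If : m12.-integrable Q (EFin \o f).

Let g := (EFin \o f) \_ Q.
Let mQ : measurable Q. Proof. exact: measurableX. Qed.
Let Ig : m12.-integrable setT g. Proof. exact: (iffLR (integrable_mkcond _ mQ)). Qed.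

Let gE t : A t -> (fun y => g (t, y)) = (EFin \o (fun y => f (t, y))) \_ D.
Proof.
move=> At; apply/funext => y; rewrite /g !patchE.
case: ifPn => [/set_mem[_ Dy]|]; first by rewrite mem_set.
by move=> /negP nQ; rewrite memNset//= => Dy; apply: nQ; rewrite in_setE.
Qed.

Let gE' y : D y -> (fun t => g (t, y)) = (EFin \o (fun t => f (t, y))) \_ A.
Proof.
move=> Dy; apply/funext => t; rewrite /g !patchE.
case: ifPn => [/set_mem[At _]|]; first by rewrite mem_set.
by move=> /negP nQ; rewrite memNset//= => At; apply: nQ; rewrite in_setE.
Qed.

Let FE : fubini_F m2 g = (fun t => \int[m2]_(y in D) (f (t, y))%:E)%E \_ A.
Proof.
apply/funext => t; rewrite /fubini_F patchE; case: ifPn => [/set_mem At|At].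
  by rewrite (gE At) -integral_mkcond.
rewrite integral0_eq// => y _; rewrite /g patchE memNset// => -[At' _].
by move: At; rewrite mem_set.
Qed.

Let GE : fubini_G m1 g = (fun y => \int[m1]_(t in A) (f (t, y))%:E)%E \_ D.
Proof.
apply/funext => y; rewrite /fubini_G patchE; case: ifPn => [/set_mem Dy|Dy].
  by rewrite (gE' Dy) -integral_mkcond.
rewrite integral0_eq// => t _; rewrite /g patchE memNset// => -[_ Dy'].
by move: Dy; rewrite mem_set.
Qed.

Let IF : m1.-integrable A (fun t => \int[m2]_(y in D) (f (t, y))%:E)%E.
Proof. by apply: (iffRL (integrable_mkcond _ mA)); rewrite -FE; exact: integrable_fubini_F. Qed.

Lemma integrable_slice : m1.-integrable A (EFin \o (fun t => \int[m2]_(y in D) f (t, y))).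
Proof. by have [] := integrable_fine mA IF. Qed.

Lemma Rintegral_slice : \int[m1]_(t in A) (\int[m2]_(y in D) f (t, y)) = \int[m12]_(z in Q) f z.
Proof.
have [_ e] := integrable_fine mA IF; rewrite /Rintegral in e *; rewrite e; congr fine.
by rewrite integral_mkcond -FE integral12_prod_meas1// -integral_mkcond.
Qed.

Lemma Rintegral_swap : \int[m1]_(t in A) (\int[m2]_(y in D) f (t, y)) =
  \int[m2]_(y in D) (\int[m1]_(t in A) f (t, y)).
Proof.
rewrite Rintegral_slice.
have IG : m2.-integrable D (fun y => \int[m1]_(t in A) (f (t, y))%:E)%E.
  apply: (iffRL (integrable_mkcond _ mD)); rewrite -GE.
  have mg := measurable_int _ Ig.
  apply/integrableP; split; first exact: (measurable_fubini_G Ig).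
  have := (integrable21ltyP m1 m2 mg).1 Ig; apply: le_lt_trans.
  apply: ge0_le_integral => //.
  - by apply: measurableT_comp => //; exact: (measurable_fubini_G Ig).
  - apply: (@measurable_fun_fubini_tonelli_G _ _ _ _ _ m1 (fun z => `|g z|%E)) => //.
    exact: measurableT_comp.
  - move=> y _; apply: le_abse_integral => //; exact: measurable_fun_pair1.
have [_ e] := integrable_fine mD IG; rewrite /Rintegral in e *; rewrite e; congr fine.
by rewrite [RHS]integral_mkcond -GE integral21_prod_meas1// -integral_mkcond.
Qed.

End int.
End fubini_slice.

Section tcut.
Context {R : realType}.
Local Notation lam := (@lebesgue_measure R).
Variable T : R.

Definition tcut (f : R -> R) : R -> R := fun t => f t * \1_(`]0, T]%classic) t.

Lemma tcutE f t : 0 < t <= T -> tcut f t = f t.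
Proof. by move=> tT; rewrite /tcut indicE mem_set ?mulr1//= in_itv. Qed.

Lemma igr_tcut f : lam.-integrable `]0, T]%classic (EFin \o f) -> igr (tcut f).
Proof.
move=> If; rewrite /igr.
have mI : measurable (`]0, T]%classic : set (measurableTypeR R)) by [].
have := (iffLR (integrable_mkcond _ mI)) If.
rewrite (_ : _ \_ _ = EFin \o tcut f)//.
apply/funext => t; rewrite patchE /tcut /= indicE.
by case: ifPn => _; rewrite ?mulr1 ?mulr0.
Qed.

Lemma itg_tcut f a b : 0 <= a -> b <= T -> itg (tcut f) a b = itg f a b.
Proof.
move=> a0 bT; apply: itg_eq => x; rewrite /= in_itv/= => /andP[ax xb].
by rewrite tcutE// (le_lt_trans a0 ax) (le_trans xb bT).
Qed.

Lemma itg_cells f n : 0 <= T -> (0 < n)%N -> igr f ->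
  itg f 0 T = \sum_(k < n) itg f (T * k%:R / n%:R) (T * k.+1%:R / n%:R).
Proof.
move=> T0 n0 If; have n0' : 0 < n%:R :> R by rewrite ltr0n.
pose p (k : nat) : R := T * k%:R / n%:R.
have SN j : itg f 0 (p j) = \sum_(i < j) itg f (p i) (p i.+1).
  elim: j => [|j IH].
    rewrite big_ord0 /p mulr0 mul0r /itg set_itv_ge ?bnd_simp ?ltxx//.
    by rewrite Rintegral_set0.
  rewrite big_ord_recr/= -IH -itg_split// /p.
    by rewrite divr_ge0// mulr_ge0.
  by rewrite ler_pM2r ?invr_gt0// ler_wpM2l// ler_nat.
by rewrite -SN /p mulfK// gt_eqF.
Qed.

End tcut.

Lemma igr_sum {R : realType} (I : Type) (s : seq I) (f : I -> R -> R) :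
  (forall i, igr (f i)) -> igr (fun t => \sum_(i <- s) f i t).
Proof.
move=> If; elim: s => [|i s IH].
  under eq_fun do rewrite big_nil.
  have := igrZ 0 (igr_indic (0 : R) 0); rewrite (_ : (fun x => _) = fun=> 0)//.
  by apply/funext => x; rewrite mul0r.
by under eq_fun do rewrite big_cons; exact: igrD.
Qed.

Lemma itg_sum {R : realType} (I : Type) (s : seq I) (f : I -> R -> R) a b :
  (forall i, igr (f i)) -> itg (fun t => \sum_(i <- s) f i t) a b = \sum_(i <- s) itg (f i) a b.
Proof.
move=> If; elim: s => [|i s IH].
  rewrite big_nil (@itg_eq _ _ (fun=> 0)); last by move=> x _; rewrite big_nil.
  by rewrite /itg Rintegral_cst// mul0r.
rewrite big_cons -IH -[itg (f i) a b]mul1r -itg_comb//; last exact: igr_sum.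
by apply: itg_eq => x _; rewrite big_cons mul1r.
Qed.

(** * Density of functions that are piecewise constant in time *)

Section step.
Context {R : realType} d (X : measurableType d).
Local Notation lam := (@lebesgue_measure R).
Variables (m2 : {sigma_finite_measure set X -> \bar R}) (D : set X) (T : R).
Hypotheses (mD : measurable D) (fD : (m2 D < +oo)%E) (T0 : 0 < T).
Local Notation I := `]0, T]%classic.
Local Notation Q := (I `*` D).
Local Notation m12 := (lam \x m2)%E.

Let mI : measurable (I : set (measurableTypeR R)). Proof. by []. Qed.

Lemma measurable_Q : measurable (Q : set (measurableTypeR R * X)).
Proof. exact: measurableX. Qed.
Let mQ := measurable_Q.

Lemma finite_Q : (m12 Q < +oo)%E.
Proof.
rewrite product_measure1E//; apply: lte_mul_pinfty => //.
have := @lebesgue_measure_itv R `]0, T] => /= ->.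
by case: ifP.
Qed.
Let fQ := finite_Q.

Definition rays : set (set (measurableTypeR R * X)) :=
  [set S | exists c A, measurable A /\ S = `]c, +oo[%classic `*` A].

Lemma setI_rays : setI_closed rays.
Proof.
move=> _ _ [c [A [mA ->]]] [c' [A' [mA' ->]]].
exists (Num.max c c'), (A `&` A'); split; first exact: measurableI.
apply/seteqP; split=> -[t x] /=; rewrite !in_itv/= !andbT gt_max.
  by move=> [[-> Ax] [-> A'x]].
by move=> [/andP[-> ->] [Ax A'x]].
Qed.

(** Rectangles generate the product structure. For a fixed side [A], the sets [B] whose rectangle
    with [A] is generated by [rays] form a sigma-algebra containing the open rays, hence all Borel
    sets. *)
Lemma rays_measurableE : @measurable _ (measurableTypeR R * X)%type = <<s rays >>.
Proof.
apply/seteqP; split; last first.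
  apply: smallest_sub; first exact: sigma_algebra_measurable.
  by move=> _ [c [A [mA ->]]]; apply: measurableX.
rewrite measurable_prod_measurableType.
apply: smallest_sub; first exact: smallest_sigma_algebra.
move=> _ [B mB [A mA <-]]; move: B mB.
have sT : <<s rays >> (setT `*` A).
  rewrite (_ : _ `*` _ = \bigcup_n (`](- n%:R), +oo[%classic `*` A)).
    apply: sigma_algebra_bigcup => n; apply: sub_sigma_algebra.
    by exists (- n%:R), A.
  apply/seteqP; split=> -[t x] /=; last by move=> [n _ [_ Ax]].
  move=> [_ Ax]; exists (Num.truncn `|t|).+1 => //; split => //=.
  rewrite in_itv/= andbT ltrNl (le_lt_trans (ler_norm _))// normrN.
  exact: truncnS_gt.
rewrite RGenOInfty.measurableE => B mB.
suff : <<s @RGenOInfty.G R >> `<=` [set B | <<s rays >> (B `*` A)] by apply.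
apply: smallest_sub; last first.
  by move=> _ [c ->]; apply: sub_sigma_algebra; exists c, A.
split => /=.
- by rewrite set0X; exact: sigma_algebra0.
- move=> C sC; rewrite setTD.
  rewrite (_ : _ `*` _ = (setT `*` A) `\` (C `*` A)); last first.
    apply/seteqP; split=> -[t x] /=; first by move=> [nC Ax]; split => // -[].
    by move=> [[_ Ax] nCA]; split => // Ct; apply: nCA.
  rewrite setDE; apply: (@measurableI _ (g_sigma_algebraType rays)) => //.
  exact: (@measurableC _ (g_sigma_algebraType rays)).
- move=> F sF; rewrite (_ : _ `*` _ = \bigcup_i (F i `*` A)); last first.
    apply/seteqP; split=> -[t x] /=; first by move=> [[i _ Fi] Ax]; exists i.
    by move=> [i _ [Fi Ax]]; split => //; exists i.
  exact: sigma_algebra_bigcup.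
Qed.

Definition cell n k : set R := `](T * k%:R / n%:R), (T * k.+1%:R / n%:R)]%classic.

Definition step n (a : nat -> X -> R) : R * X -> R :=
  fun z => \sum_(k < n) \1_(cell n k) z.1 * a k z.2.

Lemma step_cell n a k t x : (k < n)%N -> cell n k t -> step n a (t, x) = a k x.
Proof.
move=> kn tk; have n0 : 0 < n%:R :> R by rewrite ltr0n (leq_trans _ kn).
rewrite /step (bigD1 (Ordinal kn))//= indicE mem_set// mul1r big1 ?addr0// => i ik.
rewrite indicE memNset ?mul0r//.
move: tk; rewrite /cell /= !in_itv/= !ltr_pdivrMr// !ler_pdivlMr// => /andP[h1 h2] /andP[h3 h4].
have A := lt_le_trans h1 h4; have B := lt_le_trans h3 h2.
rewrite !ltr_pM2l// !ltr_nat !ltnS in A B.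
by move/eqP: ik; apply; apply/val_inj => /=; apply/eqP; rewrite eqn_leq B A.
Qed.

Lemma cellP n t : (0 < n)%N -> 0 < t <= T -> exists2 k, (k < n)%N & cell n k t.
Proof.
move=> n0 /andP[t0 tT]; have n0' : 0 < n%:R :> R by rewrite ltr0n.
have ex : exists k, t <= T * k.+1%:R / n%:R.
  by exists n.-1; rewrite prednK// mulfK// gt_eqF.
case: (ex_minnP ex) => k tk kmin; exists k.
  rewrite -ltnS -[n]prednK// ltnS ltnS; apply: kmin.
  by rewrite prednK// mulfK// gt_eqF.
rewrite /cell /= in_itv/= tk andbT; case: k kmin {tk} => [|k] kmin.
  by rewrite mulr0 mul0r.
by rewrite ltNge; apply/negP => /kmin; rewrite ltnn.
Qed.

(** Asking for an approximation on every sufficiently fine partition, not on one only, lets the two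
    terms of a linear combination, and later all components of a vector field, share a partition. *)
Let P (f : R * X -> R) := forall e, 0 < e -> exists n0, forall n, (n0 <= n)%N ->
  exists a : nat -> X -> R, [/\ forall k, L2 m2 D (a k), L2 m12 Q (step n a) &
    dot m12 Q (f \- step n a) (f \- step n a) <= e].

Lemma step_comb n c a a' : step n (fun k x => c * a k x + a' k x) =
  (fun z => c * step n a z + step n a' z).
Proof.
apply/funext => z; rewrite /step mulr_sumr -big_split/=; apply: eq_bigr => k _.
by ring.
Qed.

Lemma measurable_step n a : (forall k, measurable_fun setT (a k)) ->
  measurable_fun Q (step n a).
Proof.
move=> ma; rewrite /step; apply: measurable_sum => k; apply: measurable_funTS.
apply: measurable_funM; last exact: (measurableT_comp (ma k) (@measurable_snd _ _ _ _)).
have mc : measurable_fun setT (\1_(cell n k) : measurableTypeR R -> R).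
  by apply: measurable_indic; rewrite /cell.
exact: (measurableT_comp mc (@measurable_fst _ _ _ _)).
Qed.

(** The coefficients keep the cells that start at or after [c]. At a time [t] beyond [c] this agrees
    with the indicator once the mesh [T / n] is below [t - c], and at the other times on every
    partition; dominated convergence does the rest. *)
Let P_ray c A : measurable A -> P (\1_(`]c, +oo[%classic `*` A)).
Proof.
move=> mA e e0.
pose f : R * X -> R := \1_(`]c, +oo[%classic `*` A).
pose a (n k : nat) (x : X) : R := (nat_of_bool (c <= T * k%:R / n%:R)%R)%:R * \1_A x.
pose h n := step n (a n).
have La n k : L2 m2 D (a n k) by apply: (L2_Z mD); exact: L2_indic.
have mh n : measurable_fun Q (h n).
  apply: measurable_step => k; rewrite /a.
  by apply: measurable_funM; [exact: measurable_cst|apply: measurable_indic].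
have hb n z : Q z -> `|h n z| <= 1.
  case: z => t x [/=]; rewrite in_itv/= => tT Dx.
  have [->|n0] := posnP n; first by rewrite /h /step big_ord0 normr0.
  have [k kn tk] := cellP n0 tT; rewrite /h (step_cell _ _ kn tk) /a indicE.
  by rewrite -natrM mulnb normr_nat lern1 leq_b1.
have Lh n : L2 m12 Q (h n) by exact: (L2_le mQ (mh n) (L2_cst mQ fQ 1) (hb n)).
have ch z : Q z -> h ^~ z @ \oo --> f z.
  case: z => t x [/=]; rewrite in_itv/= => tT Dx.
  have ev : \forall n \near \oo, (0 < n)%N && ((c < t) ==> (T < (t - c) * n%:R)).
    have [ct|ct] := ltP c t; last by exists 1%N => // n /= ->.
    have ct0 : 0 < t - c by rewrite subr_gt0.
    near=> n; apply/andP; split; first by near: n; exact: nbhs_infty_gt.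
    by rewrite mulrC -ltr_pdivrMr//; near: n; exact: nbhs_infty_gtr.
  apply: cvg_near_cst; apply: filterS ev => n /andP[n0 /implyP ct].
  have n0' : 0 < n%:R :> R by rewrite ltr0n.
  have [k kn tk] := cellP n0 tT; rewrite /h (step_cell _ _ kn tk) /a /f !indicE.
  rewrite in_setX/= mem_setE in_itv/= andbT -natrM mulnb; congr ((nat_of_bool (_ && _))%:R).
  move: tk; rewrite /cell/= in_itv/= => /andP[kt tk].
  have [{}/ct ct|tc] := ltP c t; last by apply/negbTE; rewrite -ltNge (lt_le_trans kt).
  move: tk; rewrite -[k.+1]addn1 natrD mulrDr mulr1 !mulrDl => tk.
  have : T / n%:R < t - c by rewrite ltr_pdivrMr.
  by move: tk; move: (T * _ / _) (T / _) => u v; lra.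
have L1 : L2 m12 Q (fun=> 1) by exact: (L2_cst mQ fQ).
have mf : measurable_fun Q f.
  by apply: measurable_funTS; apply: measurable_indic; exact: measurableX.
have /cvgrPdist_le/(_ _ e0)[N _ HN] := L2_dominated_cvg mQ L1 mh mf ch hb.
exists N => n Nn; exists (a n); split; [exact: La|exact: Lh|].
have := HN n Nn; rewrite /= sub0r normrN (ger0_norm (dot_ge0 _ _ _)).
Unshelve. all: by end_near.
Qed.

Let P_all f : L2 m12 Q f -> P f.
Proof.
move: f; apply: (@L2_ind _ _ _ m12 Q mQ fQ rays P rays_measurableE).
- exact: setI_rays.
- move=> e e0; exists 1%N => n n0; exists (fun _ _ => 1).
  have E z : Q z -> 1 = step n (fun _ _ => 1) z.
    case: z => t x [/=]; rewrite in_itv/= => tT Dx.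
    by have [k kn tk] := cellP n0 tT; rewrite (step_cell _ _ kn tk).
  have Ls : L2 m12 Q (step n (fun _ _ => 1)).
    apply: (L2_le mQ _ (L2_cst mQ fQ 1)).
      by apply: measurable_step => k.
    by move=> z Qz; rewrite -E// normr1.
  split => //; first by move=> _; exact: L2_cst.
  suff -> : dot m12 Q ((fun=> 1) \- step n (fun _ _ => 1)) ((fun=> 1) \- step n (fun _ _ => 1)) =
      \int[m12]_(z in Q) 0 by rewrite Rintegral_cst// mul0r ltW.
  by apply: eq_Rintegral => z /set_mem Qz /=; rewrite -(E z Qz) subrr mul0r.
- by move=> _ [c [A [mA ->]]]; exact: P_ray.
- move=> k f g Lf Lg Pf Pg e e0.
  have k0 : 0 < 2 * k ^+ 2 + 1 by rewrite ltr_wpDl// mulr_ge0// sqr_ge0.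
  have e1 : 0 < e / 2 / (2 * k ^+ 2 + 1) by rewrite !divr_gt0.
  have e2 : 0 < e / 4 by rewrite divr_gt0.
  have [N1 H1] := Pf _ e1; have [N2 H2] := Pg _ e2.
  exists (maxn N1 N2) => n; rewrite geq_max => /andP[n1 n2].
  have [a [La Lsa Ha]] := H1 n n1; have [a' [La' Lsa' Ha']] := H2 n n2.
  exists (fun i x => k * a i x + a' i x); rewrite step_comb; split.
  + by move=> i; exact: L2_comb.
  + exact: L2_comb.
  have Lfa := L2_B mQ Lf Lsa; have Lga := L2_B mQ Lg Lsa'.
  rewrite (_ : _ \- _ = fun z => k * (f \- step n a) z + (g \- step n a') z); last first.
    by apply/funext => z /=; ring.
  apply: le_trans (dot_sq_comb_le mQ k Lfa Lga) _.
  move: (dot_ge0 m12 Q (f \- step n a)) Ha Ha'; rewrite ler_pdivlMr//.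
  by move: (dot _ _ _ _) (dot _ _ _ _) (k ^+ 2) => u v w h1 h2 h3; lra.
- move=> f Lf H e e0.
  have e4 : 0 < e / 4 by rewrite divr_gt0.
  have [h [Lh Ph fh]] := H _ e4.
  have [N HN] := Ph _ e4; exists N => n Nn.
  have [a [La Ls Ha]] := HN n Nn; exists a; split => //.
  apply: le_trans (dot_tri mQ Lf Lh Ls) _; move: fh Ha.
  by move: (dot _ _ _ _) (dot _ _ _ _) => u v; lra.
Qed.

Lemma L2_snd a : L2 m2 D a -> L2 m12 Q (fun z => a z.2).
Proof.
move=> [ma Ia].
have m2D : measurable_fun Q (fun z => a z.2).
  apply: (measurable_comp mD _ ma); first by move=> _ [z [_ Dz] <-].
  exact: measurable_funTS.
split => //.
have mg : measurable_fun setT ((fun z => (a z.2 ^+ 2)%:E) \_ Q).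
  apply: (iffLR (measurable_restrictT _ mQ)).
  by apply/measurable_EFinP; exact: measurable_funX.
apply: (iffRL (integrable_mkcond _ mQ)).
apply: (iffRL (integrable12ltyP lam m2 mg)).
pose c : \bar R := (\int[m2]_(y in D) (a y ^+ 2)%:E)%E.
have E t : (\int[m2]_y `|((fun z => (a z.2 ^+ 2)%:E) \_ Q) (t, y)| =
    (fun=> c) \_ I t)%E.
  rewrite patchE; case: ifPn => tI; last first.
    apply: integral0_eq => y _; rewrite patchE memNset ?abse0// => -[/mem_set tI' _].
    by rewrite tI' in tI.
  rewrite /c [RHS]integral_mkcond; apply: eq_integral => y _; rewrite !patchE.
  rewrite in_setX/= tI/=; case: ifPn => _; rewrite ?abse0//.
  by rewrite gee0_abs// lee_fin sqr_ge0.
under eq_integral do rewrite E.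
rewrite -integral_mkcond integral_cst//.
have c0 : (0 <= c)%E by apply: integral_ge0 => y _; rewrite lee_fin sqr_ge0.
apply: lte_mul_pinfty => //; first by apply: integrable_fin_num.
have := @lebesgue_measure_itv R `]0, T] => /= ->.
by case: ifP => _; rewrite -?EFinD ltry.
Qed.

Lemma step_approx (k : finType) (F : k -> R * X -> R) e : (forall i, L2 m12 Q (F i)) -> 0 < e ->
  exists n (a : nat -> k -> X -> R), [/\ (0 < n)%N, forall j i, L2 m2 D (a j i) &
    \sum_(j < n) itg (tcut T (fun t => \sum_i dot m2 D (fun x => F i (t, x) - a j i x)
      (fun x => F i (t, x) - a j i x))) (T * j%:R / n%:R) (T * j.+1%:R / n%:R) <= e].
Proof.
move=> LF e0.
pose e' := e / #|k|.+1%:R.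
have e'0 : 0 < e' by rewrite divr_gt0.
have /choice[N HN] : forall i, exists N, forall n, (N <= n)%N ->
  exists a : nat -> X -> R, [/\ forall j, L2 m2 D (a j), L2 m12 Q (step n a) &
    dot m12 Q (F i \- step n a) (F i \- step n a) <= e'].
  by move=> i; exact: P_all (LF i) _ e'0.
pose n := (\max_i N i).+1.
have Nn i : (N i <= n)%N by rewrite leqW// leq_bigmax.
have /choice[a Ha] := fun i => HN i n (Nn i).
exists n, (fun j i => a i j); split => //; first by move=> j i; have [] := Ha i.
pose h i t := dot m2 D (fun x => (F i \- step n (a i)) (t, x)) (fun x => (F i \- step n (a i)) (t, x)).
have Ls i : L2 m12 Q (F i \- step n (a i)) by apply: L2_B => //; have [] := Ha i.
have Ih i : lam.-integrable I (EFin \o h i).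
  exact: (integrable_slice mI mD (L2_mul mQ (Ls i) (Ls i))).
have hE i : itg (tcut T (h i)) 0 T = dot m12 Q (F i \- step n (a i)) (F i \- step n (a i)).
  rewrite itg_tcut//; exact: (Rintegral_slice mI mD (L2_mul mQ (Ls i) (Ls i))).
apply: (@le_trans _ _ (\sum_i itg (tcut T (h i)) 0 T)); last first.
  apply: (@le_trans _ _ (\sum_(i : k) e')).
    by apply: ler_sum => i _; rewrite hE; have [] := Ha i.
  rewrite sumr_const -mulr_natl /e' mulrCA ler_piMr ?(ltW e0)//.
  by rewrite ler_pdivrMr// mul1r ler_nat.
have cE t j : (j < n)%N -> cell n j t -> 0 < t <= T.
  move=> jn; rewrite /cell/= in_itv/= => /andP[t1 t2].
  rewrite (le_lt_trans _ t1) ?divr_ge0 ?mulr_ge0 ?(ltW T0)//=.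
  by rewrite (le_trans t2)// ler_pdivrMr ?ltr0n// ler_pM2l// ler_nat.
have -> : \sum_i itg (tcut T (h i)) 0 T =
    \sum_i \sum_(j < n) itg (tcut T (h i)) (T * j%:R / n%:R) (T * j.+1%:R / n%:R).
  by apply: eq_bigr => i _; apply: itg_cells => //; [exact: ltW|exact: igr_tcut].
rewrite [leRHS]exchange_big/=; apply: ler_sum => j _.
rewrite -itg_sum; last by move=> i; exact: igr_tcut.
rewrite le_eqVlt; apply/orP; left; apply/eqP; apply: itg_eq => t tj.
have tT := cE t j (ltn_ord j) tj.
rewrite tcutE//; apply: eq_bigr => i _; rewrite tcutE// /h.
by apply: eq_Rintegral => x _ /=; rewrite (step_cell _ _ (ltn_ord j) tj).
Qed.

End step.

(** * Du Bois-Reymond lemma in time *)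

Section du_bois_reymond.
Context {R : realType}.
Local Notation lam := (@lebesgue_measure R).
Variable T : R.
Hypothesis T0 : 0 < T.
Local Notation I := `]0, T]%classic.
Local Notation J := `]0, T[%classic.

Let mI : measurable (I : set (measurableTypeR R)). Proof. by []. Qed.
Let fI : (lam I < +oo)%E.
Proof.
have := @lebesgue_measure_itv R `]0, T] => /= ->.
by case: ifP => _; rewrite -?EFinD ltry.
Qed.

Lemma Rintegral_JI (f : R -> R) : \int[lam]_(t in J) f t = \int[lam]_(t in I) f t.
Proof.
rewrite Rintegral_mkcond [RHS]Rintegral_mkcond; apply: ae_eq_Rintegral.
exists [set T]; split => //; first exact: lebesgue_measure_set1.
move=> t /= Ht; apply: contrapT => tT; apply: Ht => _; rewrite !patchE.
congr (if _ then _ else _); apply/idP/idP => /set_mem; rewrite /= !in_itv/= => /andP[t0 h];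
  apply/mem_set; rewrite /= in_itv/= t0/=; first exact: ltW.
by rewrite lt_neqAle h andbT; apply/eqP.
Qed.

Lemma test_time_derive eta : test_time T eta -> forall t : R, is_derive t (1 : R) eta (derive1 eta t).
Proof.
by move=> [d _ _] t; split; [exact: (d 0%N)|rewrite derive1E].
Qed.

Lemma test_time_continuous eta : test_time T eta -> continuous (derive1 eta).
Proof.
by move=> [d _ _] t; apply/differentiable_continuous/derivable1_diffP; exact: (d 1%N).
Qed.

Lemma test_time_out eta t : test_time T eta -> ~ J t -> eta t = 0.
Proof.
move=> [_ _ H] nJ; apply/eqP; apply: contra_notT nJ => e; apply: H.
exact: subset_closure.
Qed.

Lemma continuous_bounded_itv (f : R -> R) : continuous f ->
  exists M, forall t, I t -> `|f t| <= M.
Proof.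
move=> cf; have cn : {within `[0, T], continuous (fun t => `|f t|)}.
  by apply: continuous_subspaceT => t; apply: continuous_comp; [exact: cf|exact: norm_continuous].
have [c _ H] := EVT_max (ltW T0) cn; exists `|f c| => t; rewrite /= in_itv/= => /andP[t0 tT].
by apply: H; rewrite in_itv/= (ltW t0).
Qed.

Lemma continuous_L2 (f : R -> R) : continuous f -> L2 lam I f.
Proof.
move=> cf; have [M HM] := continuous_bounded_itv cf.
apply: (L2_le mI _ (L2_cst mI fI M)) => //.
by apply: measurable_funTS; exact: continuous_measurable_fun.
Qed.

Lemma test_time_L2 eta : test_time T eta -> L2 lam I eta.
Proof.
move=> te; apply: continuous_L2 => t; apply/differentiable_continuous/derivable1_diffP.
by have [] := test_time_derive te t.
Qed.

(** Fubini on the triangle [s <= t]: the inner integral of [derive1 eta] over [[s, T]] is [- eta s],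
    because [eta] vanishes at [T]. *)
Lemma test_time_primitive eta k : test_time T eta -> L2 lam I k ->
  \int[lam]_(t in I) (derive1 eta t * itg k 0 t) = - \int[lam]_(t in I) (eta t * k t).
Proof.
move=> te Lk; have ce := test_time_continuous te.
have [M HM] := continuous_bounded_itv ce.
have mQ := @measurable_Q R _ (measurableTypeR R) I T mI.
have fQ := @finite_Q R _ (measurableTypeR R) lam I T mI fI.
pose r (z : measurableTypeR R * measurableTypeR R) : R := derive1 eta z.1 * (z.2 <= z.1)%R%:R.
have mr : @measurable_fun _ _ (measurableTypeR R * measurableTypeR R)%type R (I `*` I) r.
  apply: measurable_funTS; apply: measurable_funM.
    have me : measurable_fun setT (derive1 eta) by exact: continuous_measurable_fun.
    exact: (measurableT_comp me (@measurable_fst _ _ _ _)).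
  rewrite (_ : (fun _ => _) = \1_[set z : measurableTypeR R * measurableTypeR R | z.2 <= z.1 :> R]).
    apply: measurable_indic; rewrite -[X in measurable X]setTI.
    exact: measurable_fun_le.
  apply/funext => z; rewrite indicE; congr ((nat_of_bool _)%:R).
  by apply/idP/idP => [h|/set_mem//]; apply/mem_set.
have rM z : (I `*` I) z -> `|r z| <= M.
  case: z => [t s] [/= It _]; rewrite /r normrM normr_nat.
  by apply: le_trans (HM t It); rewrite ler_piMr// lern1 leq_b1.
have LM := @L2_cst R _ _ (lam \x lam)%E (I `*` I) mQ fQ M.
have Lr := @L2_le R _ (measurableTypeR R * measurableTypeR R)%type (lam \x lam)%E (I `*` I) mQ r _ mr LM rM.
have Lk2 := @L2_snd R _ (measurableTypeR R) lam I T mI k Lk.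
have Irk := L2_mul mQ Lr Lk2.
have Ik : lam.-integrable I (EFin \o k).
  have := L2_mul mI (L2_cst mI fI 1) Lk; apply: eq_integrable => // x _ /=; by rewrite mul1r.
transitivity (\int[lam]_(t in I) \int[lam]_(s in I) (r (t, s) * k s)).
  apply: eq_Rintegral.
  move=> t /set_mem It /=; have /andP[t0 tT] : 0 < t <= T by move: It; rewrite /= in_itv.
  rewrite /itg -RintegralZl//; last first.
    by apply: integrableS Ik => // x; rewrite /= !in_itv/= => /andP[-> /le_trans->].
  rewrite [LHS]Rintegral_mkcond [RHS]Rintegral_mkcond; apply: esym; apply: eq_Rintegral => s _.
  rewrite !patchE /r/=; case: ifPn => /= [/set_mem|sI]; rewrite /= ?in_itv/=.
    move=> /andP[s0 sT]; case: ifPn => [/set_mem/=|]; first by rewrite in_itv/= => /andP[_ ->]; rewrite mulr1.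
    move=> /negP h; rewrite (_ : (s <= t) = false) ?mulr0 ?mul0r//; apply/negP => st.
    by apply: h; apply/mem_set; rewrite /= in_itv/= s0.
  case: ifPn => // /set_mem; rewrite /= in_itv/= => /andP[s0 st]; move/negP: sI; case.
  by apply/mem_set; rewrite /= in_itv/= s0 (le_trans st).
apply: (etrans (Rintegral_swap mI mI Irk)); rewrite -[RHS]mulN1r -RintegralZl//; last exact: (L2_mul mI (test_time_L2 te) Lk).
apply: eq_Rintegral => s /set_mem Is /=; have /andP[s0 sT] : 0 < s <= T by move: Is; rewrite /= in_itv.
have eT : eta T = 0 by apply: (test_time_out te); rewrite /= in_itv/= ltxx andbF.
transitivity (\int[lam]_(t in `[s, T]) derive1 eta t * k s).
  rewrite -RintegralZr//; last first.
    apply: continuous_compact_integrable; first exact: segment_compact.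
    exact: continuous_subspaceT.
  rewrite [LHS]Rintegral_mkcond [RHS]Rintegral_mkcond; apply: eq_Rintegral => t _.
  rewrite !patchE /r/=; case: ifPn => /= [/set_mem|tI]; rewrite /= ?in_itv/=.
    move=> /andP[t0 tT]; case: ifPn => [/set_mem/=|]; first by rewrite in_itv/= => /andP[-> _]; rewrite mulr1.
    move=> /negP h; rewrite (_ : (s <= t) = false) ?mulr0 ?mul0r//; apply/negP => st.
    by apply: h; apply/mem_set; rewrite /= in_itv/= st.
  case: ifPn => // /set_mem; rewrite /= in_itv/= => /andP[st tT]; move/negP: tI; case.
  by apply/mem_set; rewrite /= in_itv/= (lt_le_trans s0 st).
rewrite mulrA mulN1r; congr (_ * _).
move: sT; rewrite le_eqVlt => /predU1P[->|sT].
  by rewrite set_itv1 Rintegral_set1 eT oppr0.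
by rewrite /Rintegral (FTC2_everywhere sT (test_time_derive te) ce) eT sub0r.
Qed.

End du_bois_reymond.

Section primitive.
Context {R : realType}.
Local Notation lam := (@lebesgue_measure R).
Variables (T : R) (zeta : R -> R) (a b : R).
Hypotheses (ez : elem zeta) (a0 : 0 < a) (bT : b < T)
  (z0 : forall t, ~~ (a < t < b) -> zeta t = 0) (zT : \int[lam]_t zeta t = 0).

Let Iz : lam.-integrable setT (EFin \o zeta).
Proof.
have mI : measurable (`[a, b]%classic : set (measurableTypeR R)) by [].
have Iab : lam.-integrable `[a, b]%classic (EFin \o zeta).
  apply: continuous_compact_integrable; first exact: segment_compact.
  by apply: continuous_subspaceT; exact: elem_continuous.
have := (iffLR (integrable_mkcond _ mI)) Iab.
rewrite (_ : _ \_ _ = EFin \o zeta)//.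
apply/funext => t; rewrite patchE /=; case: ifPn => // h.
rewrite z0//; apply: contra h => /andP[h1 h2]; apply/mem_set.
by rewrite /= in_itv/= !ltW.
Qed.

(** The primitive from minus infinity vanishes before [a], and after [b] because [zeta] has zero
    mean; its support is therefore compact in the open interval. *)
Lemma test_time_of : exists2 eta, test_time T eta & derive1 eta = zeta.
Proof.
pose eta t := \int[lam]_(x in [set` Interval -oo%O (BRight t)]) zeta x.
have D t : derivable eta t 1 /\ derive1 eta t = zeta t.
  have tt : t < t + 1 by rewrite ltrDl.
  have It : lam.-integrable [set` Interval -oo%O (BRight (t + 1))] (EFin \o zeta) by exact: integrableS Iz.
  apply: (@continuous_FTC1 R zeta -oo%O t (t + 1) tt It _ (@elem_continuous _ _ ez t)).
  by rewrite ltNyr.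
have dE : derive1 eta = zeta by apply/funext => t; have [] := D t.
have sub : closure [set t | eta t != 0] `<=` `[a, b]%classic.
  have cI : closed (`[a, b]%classic : set R) by exact: interval_closed.
  rewrite [X in _ `<=` X](iffLR (closure_id _) cI); apply: closureS => t /=; apply: contraNP => nt.
  apply/eqP; move: nt; rewrite in_itv/= => /negP; rewrite negb_and -!ltNge => /orP[ta|bt].
    rewrite /eta (@eq_Rintegral _ _ _ _ _ (fun=> 0)) ?Rintegral_cst ?mul0r//.
    move=> x /set_mem; rewrite /= in_itv/= => xt; apply: z0.
    by rewrite negb_and -!leNgt (le_trans xt (ltW ta)).
  rewrite -zT /eta Rintegral_mkcond; apply: eq_Rintegral => x _.
  rewrite patchE; case: ifPn => // /negP h; rewrite z0//; apply/negP => /andP[_ xb].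
  by apply: h; apply/mem_set; rewrite /= in_itv/= ltW// (lt_trans xb).
exists eta => //; split.
- case=> [t|n t]; first by have [] := D t.
  by rewrite derive1Sn dE; exact: elem_smooth.
- apply: (subclosed_compact _ (@segment_compact R a b) sub); exact: closed_closure.
- move=> t /sub; rewrite /= !in_itv/= => /andP[h1 h2].
  by rewrite (lt_le_trans a0)// (le_lt_trans h2).
Qed.

End primitive.

Section du_bois_reymond.
Context {R : realType}.
Local Notation lam := (@lebesgue_measure R).
Variable T : R.
Hypothesis T0 : 0 < T.
Local Notation I := `]0, T]%classic.

Let mI : measurable (I : set (measurableTypeR R)). Proof. by []. Qed.
Let fI : (lam I < +oo)%E.
Proof.
have := @lebesgue_measure_itv R `]0, T] => /= ->.
by case: ifP => _; rewrite -?EFinD ltry.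
Qed.

Let S (f : R -> R) := \int[lam]_(t in I) f t.

Let L2i (f : R -> R) : L2 lam I f -> lam.-integrable I (EFin \o f).
Proof.
move=> Lf; have := L2_mul mI (L2_cst mI fI 1) Lf.
by apply: eq_integrable => // x _ /=; rewrite mul1r.
Qed.

Let Lp a b n : L2 lam I (plateau a b n).
Proof. by apply: continuous_L2 => //; apply: elem_continuous; exact: elem_plateau. Qed.

Let plateau_abs a b n (x : R) : `|plateau a b n x| <= 1.
Proof. by rewrite ger0_norm ?plateau_ge0// plateau_le1. Qed.

Let S_limit (h : R -> R) (f_ : nat -> R -> R) (f : R -> R) : L2 lam I h -> (forall n, @measurable_fun _ _ (measurableTypeR R) R setT (f_ n)) ->
  (forall n x, `|f_ n x| <= 1) -> (forall x, I x -> f_ ^~ x @ \oo --> f x) ->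
  (fun n => S (fun t => f_ n t * h t)) @ \oo --> S (fun t => f t * h t).
Proof.
move=> Lh mf f1 cf.
apply: (@Rintegral_dominated _ _ _ lam I mI (fun n t => f_ n t * h t) (fun t => f t * h t) (fun t => `|h t|)).
- move=> n; apply: measurable_funM; last by case: Lh.
  exact: measurable_funTS.
- by move=> x Ix; apply: cvgM; [exact: cf|exact: cvg_cst].
- exact/L2i/L2_norm.
- by move=> n x _; rewrite normrM ler_piMl.
Qed.

(** Taking the middle third keeps the support away from 0 and [T], so that this plateau can correct
    the mean of another one. *)
Let theta_ex : exists n, 0 < S (plateau (T / 3) (T * 2 / 3) n).
Proof.
have c : (fun n => S (fun t => plateau (T / 3) (T * 2 / 3) n t * 1)) @ \oo -->
    S (fun t => \1_(`]T / 3, T * 2 / 3[%classic) t * 1).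
  apply: S_limit => //; first exact: L2_cst.
  - by move=> n; apply: continuous_measurable_fun; apply: elem_continuous; exact: elem_plateau.
  - by move=> x _; exact: plateau_cvg.
have E : S (fun t => \1_(`]T / 3, T * 2 / 3[%classic) t * 1) = T / 3.
  rewrite /S; under eq_Rintegral do rewrite mulr1.
  rewrite /Rintegral integral_indic//= setIC.
  rewrite (_ : I `&` _ = `]T / 3, T * 2 / 3[%classic); last first.
    by apply/seteqP; split=> x /=; rewrite !in_itv/= ?[X in X -> _]andbC; [move=> [] _ ->|move=> /andP[? ?]; split; [|lra]; apply/andP; split; lra].
  have := @lebesgue_measure_itv R `]T / 3, T * 2 / 3[ => /= ->.
  have tt : T / 3 < T * 2 / 3 by move: T0; lra.
  by rewrite lte_fin tt -EFinD/=; field.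
have T3 : 0 < T / 3 by rewrite divr_gt0.
move/cvgrPdist_lt : c => /(_ _ T3)[N _ /(_ N (leqnn N))/=].
rewrite E => H; exists N; move: H; rewrite ltr_norml => /andP[_].
rewrite (_ : S (fun t => _) = S (plateau (T / 3) (T * 2 / 3) N)).
  by move: (S _) => x; lra.
by apply: eq_Rintegral => t _; rewrite mulr1.
Qed.

Lemma dot_eq0_limit {disp} {X : measurableType disp} (mu : {measure set X -> \bar R}) (D : set X) h f :
  measurable D -> L2 mu D h -> L2 mu D f ->
  (forall e, 0 < e -> exists g, [/\ L2 mu D g, dot mu D h g = 0 & dot mu D (f \- g) (f \- g) <= e]) ->
  dot mu D h f = 0.
Proof.
move=> mD Lh Lf H; apply/eqP; rewrite -sqrf_eq0; apply/eqP/le_anti.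
rewrite sqr_ge0 andbT; apply/ler_addgt0Pr => e e0; rewrite add0r.
have C0 : 0 < dot mu D h h + 1 by rewrite ltr_wpDl ?dot_ge0.
have [g [Lg hg fg]] := H _ (divr_gt0 e0 C0).
have Lfg := L2_B mD Lf Lg.
have -> : dot mu D h f = dot mu D h (f \- g) by rewrite (dotBr mD Lf Lg Lh) hg subr0.
apply: le_trans (dot_CS mD Lh Lfg) _.
move: fg; rewrite ler_pdivlMr// => fg; apply: le_trans fg.
rewrite mulrC ler_wpM2l ?dot_ge0// lerDl//.
Qed.

(** Two limits prepare the induction on generators: plateaus give the intervals compactly inside
    []0, T[], and an exhaustion by these gives the rays cut at [T]. Then [h] is orthogonal to all of
    L^2, in particular to itself. *)
Let rays_ae0 h : L2 lam I h ->
  (forall a b n, 0 < a -> b < T -> S (fun t => plateau a b n t * h t) = 0) ->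
  {ae lam, forall t, I t -> h t = 0}.
Proof.
move=> Lh H0.
have Hoo a b : 0 < a -> b < T -> S (fun t => \1_(`]a, b[%classic) t * h t) = 0.
  move=> a0 bT; have := @S_limit h (plateau a b) (\1_(`]a, b[%classic)) Lh.
  move=> /(_ (fun n => continuous_measurable_fun (elem_continuous (elem_plateau a b n)))
    (plateau_abs a b) (fun x _ => @plateau_cvg R a b x)) c.
  apply: (@cvg_unique _ (@Rhausdorff R) _ _ _ _ c).
  rewrite (_ : (fun n => _) = fun=> 0); first exact: cvg_cst.
  by apply/funext => n; exact: H0.
have Hray q : S (fun t => \1_(`]q, T[%classic) t * h t) = 0.
  pose A (n : nat) : set R := `](Num.max q 0 + n.+1%:R^-1), (T - n.+1%:R^-1)[%classic.
  have ni n : 0 < n.+1%:R^-1 :> R by rewrite invr_gt0.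
  have q0 : 0 <= Num.max q 0 by rewrite le_max lexx orbT.
  have cA x : I x -> (fun n => \1_(A n) x : R) @ \oo --> (\1_(`]q, T[%classic) x : R).
    rewrite /= in_itv/= => /andP[x0 xT].
    apply: cvg_near_cst.
    have [/andP[qx xT']|nx] := boolP (q < x < T).
      have mx : 0 < x - Num.max q 0 by rewrite subr_gt0 gt_max qx.
      have Tx : 0 < T - x by rewrite subr_gt0.
      near=> n.
      have h1 : n.+1%:R^-1 < x - Num.max q 0 by near: n; exact: near_infty_natSinv_lt (PosNum mx).
      have h2 : n.+1%:R^-1 < T - x by near: n; exact: near_infty_natSinv_lt (PosNum Tx).
      have xA : A n x.
        rewrite /A /= in_itv/=.
        by apply/andP; split; move: h1 h2; move: (n.+1%:R^-1) (Num.max q 0) => u v; lra.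
      have xq : `]q, T[%classic x by rewrite /= in_itv/= qx.
      by rewrite !indicE (mem_set xA) (mem_set xq).
    near=> n.
    have xq : ~ `]q, T[%classic x by rewrite /= in_itv/=; exact/negP.
    have xA : ~ A n x.
      rewrite /A /= in_itv/= => /andP[h1 h2]; apply: xq; rewrite /= in_itv/=.
      have h3 : q <= Num.max q 0 by rewrite le_max lexx.
      by have := ni n; move: h1 h2 h3; move: (n.+1%:R^-1) (Num.max q 0) => u v *; apply/andP; split; lra.
    by rewrite !indicE (memNset xA) (memNset xq).
  have mA n : @measurable_fun _ _ (measurableTypeR R) R setT (\1_(A n)).
    by apply: measurable_indic; rewrite /A.
  have A1 n x : `|\1_(A n) x : R| <= 1 by rewrite indicE normr_nat lern1 leq_b1.
  have c := @S_limit h (fun n => \1_(A n)) (\1_(`]q, T[%classic)) Lh mA A1 cA.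
  apply: (@cvg_unique _ (@Rhausdorff R) _ _ _ _ c).
  rewrite (_ : (fun n => _) = fun=> 0); first exact: cvg_cst.
  apply/funext => n; apply: Hoo.
    by rewrite ltr_wpDl.
  by rewrite ltrBlDr ltrDl.
have aeT (f g : R -> R) : (forall t, I t -> t != T -> f t = g t) -> S f = S g.
  move=> fg; apply: ae_eq_Rintegral; exists [set T]; split => //; first exact: lebesgue_measure_set1.
  move=> t /= Ht; apply: contrapT => tT; apply: Ht => It; apply: fg => //; exact/eqP.
apply: dot_eq0 => //.
apply: (@L2_ind R _ (measurableTypeR R) lam I mI fI (@RGenOInfty.G R) (fun f => dot lam I h f = 0)) => //.
- exact: RGenOInfty.measurableE.
- move=> _ _ [a ->] [b ->]; exists (Num.max a b).
  apply/seteqP; split=> x /=; rewrite !in_itv/= !andbT gt_max; first by move=> [-> ->].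
  by move=> /andP[].
- have := Hray 0; apply: etrans; apply: aeT => x; rewrite /= in_itv/= => /andP[x0 xT] nT.
  by rewrite indicE mem_set/= ?in_itv/= ?x0 ?lt_neqAle ?nT// mulrC.
- move=> _ [q ->]; have := Hray q; apply: etrans; apply: aeT => x.
  rewrite /= in_itv/= => /andP[x0 xT] nT; rewrite mulrC; congr (_ * _).
  rewrite !indicE; congr ((nat_of_bool _)%:R); apply/idP/idP => /set_mem; rewrite /= in_itv/= => qx;
    apply/mem_set; rewrite /= in_itv/=; last by case/andP: qx => ->.
  by move: qx; rewrite andbT => ->; rewrite lt_neqAle nT xT.
- by move=> c f g Lf Lg Pf Pg; rewrite (dot_combr mI)// Pf Pg mulr0 addr0.
- by move=> f Lf Hf; exact: dot_eq0_limit.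
Unshelve. all: by end_near.
Qed.

(** The difference [h0] of [F] and the primitive of [k] is orthogonal to the derivatives of test
    functions, in particular to the zero-mean functions of [test_time_of]. A plateau becomes such a
    function after subtracting a multiple of the fixed plateau [th], so [h0] acts on plateaus as the
    constant [c], its average against [th]. *)
Lemma du_bois_reymond (F k : R -> R) : L2 lam I F -> L2 lam I k ->
  (forall eta, test_time T eta ->
    \int[lam]_(t in I) (derive1 eta t * F t) = - \int[lam]_(t in I) (eta t * k t)) ->
  exists c, {ae lam, forall t, I t -> F t = c + itg k 0 t}.
Proof.
move=> LF Lk H.
have Ik := L2i Lk.
have LK : L2 lam I (fun t => itg k 0 t).
  have Ic := igr_tcut Ik.
  have I0T : lam.-integrable `[0, T]%classic (EFin \o tcut T k) by exact: igrS.
  have cK := parameterized_integral_continuous (ltW T0) I0T.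
  have mK := subspace_continuous_measurable_fun (measurable_itv `[0, T]) cK.
  have KE t : I t -> parameterized_integral lam 0 t (tcut T k) = itg k 0 t.
    rewrite /= in_itv/= => /andP[_ tT]; rewrite -(@itg_tcut _ T k 0 t)//.
    by rewrite /parameterized_integral -Rintegral_itv_obnd_cbnd//; exact: igrS.
  have IaT : igr (fun x => `|tcut T k x|) by have := integrable_abse Ic; exact: eq_integrable.
  apply: (L2_le mI _ (L2_cst mI fI (itg (fun x => `|tcut T k x|) 0 T))).
    have m1 : measurable_fun I (fun t => parameterized_integral lam 0 t (tcut T k)).
      apply: measurable_funS mK => // x; rewrite /= !in_itv/= => /andP[x0 ->].
      by rewrite ltW.
    by apply: eq_measurable_fun m1 => t /set_mem; exact: KE.
  move=> t; rewrite /= in_itv/= => /andP[t0 tT].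
  rewrite -(@itg_tcut _ T k 0 t)//; apply: (le_trans (itg_abs _ _ Ic)).
  by rewrite (itg_split IaT (ltW t0) tT) lerDl; exact: itg_ge0.
pose h0 t := F t - itg k 0 t.
have Lh0 : L2 lam I h0 by exact: L2_B.
have Hh eta : test_time T eta -> S (fun t => derive1 eta t * h0 t) = 0.
  move=> te; have L1 := continuous_L2 T0 (test_time_continuous te).
  rewrite /S (_ : (fun t => _) = (fun t => derive1 eta t * F t - derive1 eta t * itg k 0 t)); last first.
    by apply/funext => t; rewrite mulrBr.
  rewrite (RintegralB mI (L2_mul mI L1 LF) (L2_mul mI L1 LK)).
  by rewrite (H _ te) (test_time_primitive T0 te Lk) subrr.
have [m m0] := theta_ex.
pose th := plateau (T / 3) (T * 2 / 3) m.
pose c := S (fun t => th t * h0 t) / S th.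
exists c; pose h t := h0 t - c.
have Lh : L2 lam I h by apply: L2_B => //; exact: L2_cst.
suff : {ae lam, forall t, I t -> h t = 0}.
  by apply: lam_aeS => t Ht It; have /eqP := Ht It; rewrite /h /h0 subr_eq0 subr_eq addrC => /eqP.
apply: rays_ae0 => // a b n a0 bT.
pose al := S (plateau a b n) / S th.
pose z := plateau a b n + cst (- al) * th.
have zE t : z t = plateau a b n t - al * th t by rewrite /z /= /cst/= mulNr.
have ez : elem z by apply: elem_D; [exact: elem_plateau|apply: elem_M; [exact: elem_cst|exact: elem_plateau]].
pose a' := Num.min a (T / 3); pose b' := Num.max b (T * 2 / 3).
have a'0 : 0 < a' by rewrite lt_min a0 divr_gt0.
have T13 : T / 3 < T by move: T0; lra.
have T23 : T * 2 / 3 < T by move: T0; lra.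
have a'T : a' < T by rewrite gt_min T13 orbT.
have b'T : b' < T by rewrite gt_max bT.
have z0 t : ~~ (a' < t < b') -> z t = 0.
  move=> nt.
  have o1 : ~~ (a < t < b).
    by apply: contra nt => /andP[h1 h2]; rewrite !lt_max gt_min h1 h2.
  have o2 : ~~ (T / 3 < t < T * 2 / 3).
    by apply: contra nt => /andP[h1 h2]; rewrite !lt_max gt_min h1 h2 !orbT.
  by rewrite zE (plateau_out _ o1) /th (plateau_out _ o2) mulr0 subrr.
have SE u v : S (fun t => u * plateau a b n t + v * th t) = u * S (plateau a b n) + v * S th.
  rewrite /S RintegralD//; last 2 first.
  - exact: (L2i (L2_Z mI u (Lp a b n))).
  - exact: (L2i (L2_Z mI v (Lp _ _ m))).
  by rewrite (RintegralZl u mI (L2i (Lp a b n))) (RintegralZl v mI (L2i (Lp _ _ m))).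
have zT : \int[lam]_t z t = 0.
  transitivity (S z).
    rewrite /S [RHS]Rintegral_mkcond; apply: eq_Rintegral => t _; rewrite patchE.
    case: ifPn => // /negP tI; apply: z0; apply/negP => /andP[h1 h2]; apply: tI.
    by apply/mem_set; rewrite /= in_itv/= (lt_trans a'0)// ltW// (lt_trans h2).
  have := SE 1 (- al); rewrite mul1r mulNr /al divfK ?gt_eqF// subrr => <-.
  by apply: eq_Rintegral => t _; rewrite zE mul1r mulNr.
have [eta te de] := test_time_of ez a'0 b'T z0 zT.
have := Hh _ te; rewrite de.
rewrite (_ : S _ = S (fun t => plateau a b n t * h0 t) - al * S (fun t => th t * h0 t)); last first.
  have L1 := L2_mul mI (Lp a b n) Lh0; have L2 := L2_mul mI (Lp (T / 3) (T * 2 / 3) m) Lh0.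
  rewrite /S -(RintegralZl al mI L2) -RintegralB//.
    by apply: eq_Rintegral => t _; rewrite zE mulrBl mulrA.
  by have := integrableZl mI al L2; apply: eq_integrable.
move=> E; rewrite (_ : S _ = S (fun t => plateau a b n t * h0 t) - c * S (plateau a b n)); last first.
  have L1 := L2_mul mI (Lp a b n) Lh0; have L2 := L2i (Lp a b n).
  rewrite /S -(RintegralZl c mI L2) -RintegralB//.
    by apply: eq_Rintegral => t _; rewrite /h mulrBr (mulrC c).
  by have := integrableZl mI c L2; apply: eq_integrable.
rewrite -[RHS]E; congr (_ - _); rewrite /c /al; move: (S _) (S _) (S _) => x y w; ring.
Qed.

End du_bois_reymond.

(** * L^2(0,T;H^1_0) and the weak time derivative *)

Section bochner.
Context {R : realType} {d : nat} (Omega : set 'rV[R]_d).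
Hypotheses (oO : open Omega) (bO : bounded_set Omega).
Variable T : R.
Hypothesis T0 : 0 < T.
Local Notation E := 'rV[R]_d.
Local Notation mu := (@lebesgue_rV R d).
Local Notation lam := (@lebesgue_measure R).
Local Notation J := `]0, T[%classic.
Local Notation I := `]0, T]%classic.
Local Notation dotv := (dotL2v Omega).
Local Notation ip := (ip Omega).
Local Notation N := (dualnorm Omega).
Local Notation H10 := (H10 Omega).

Let mO : measurable Omega := domain_measurable oO.
Let fO : (mu Omega < +oo)%E := domain_finite oO bO.
Let mI : measurable (I : set (measurableTypeR R)). Proof. by []. Qed.
Let mJ : measurable (J : set (measurableTypeR R)). Proof. by []. Qed.
Let mQ := @measurable_Q R _ E Omega T mO.

Lemma L2Q_dot_integrable (F G : R * E -> R) : L2Q Omega T F -> L2Q Omega T G ->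
  lam.-integrable I (EFin \o (fun t => dotL2 Omega (slice F t) (slice G t))).
Proof. by move=> LF LG; exact: (integrable_slice mI mO (L2_mul mQ LF LG)). Qed.

Lemma integrable_sum_fin (D : set R) (f : 'I_d -> R -> R) :
  measurable (D : set (measurableTypeR R)) ->
  (forall i, lam.-integrable D (EFin \o f i)) ->
  lam.-integrable D (EFin \o (fun t => \sum_i f i t)).
Proof.
move=> mD If; have := @integrable_sum _ _ _ lam D mD 'I_d (index_enum 'I_d) xpredT (fun i => EFin \o f i) (fun i _ => If i).
 apply: eq_integrable => // t _ /=.
by rewrite sumEFin.
Qed.

Lemma L2Qv_dot_integrable (F G : 'I_d -> R * E -> R) :
  (forall i, L2Q Omega T (F i)) -> (forall i, L2Q Omega T (G i)) ->
  lam.-integrable I (EFin \o (fun t => dotv (fun i => slice (F i) t) (fun i => slice (G i) t))).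
Proof. by move=> LF LG; apply: integrable_sum_fin => // i; exact: L2Q_dot_integrable. Qed.

Lemma L2Q_fst (u : E -> R) : L2 mu Omega u -> L2Q Omega T (fun z => u z.2).
Proof. by move=> Lu; exact: (@L2_snd R _ E mu Omega T mO u Lu). Qed.

(** A version of the squared gradient norm of v(t) - u that is integrable in [t], being built from a
    gradient measurable on the cylinder; the slicewise [grad] comes with no measurability in time.
    The two agree at good times, by [gdistE]. *)
Definition gdist (Gr : 'I_d -> R * E -> R) (u : E -> R) : R -> R := tcut T (fun t =>
  dotv (fun i => slice (Gr i) t \- grad Omega u i) (fun i => slice (Gr i) t \- grad Omega u i)).

Lemma gdist_ge0 Gr u t : 0 <= gdist Gr u t.
Proof. by rewrite /gdist /tcut mulr_ge0 ?dotv_ge0// indicE. Qed.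

Lemma gdist_igr Gr u : (forall i, L2Q Omega T (Gr i)) -> H1 Omega u -> igr (gdist Gr u).
Proof.
move=> LG Hu; apply: igr_tcut.
have Lu i : L2Q Omega T (fun z => grad Omega u i z.2) by apply: L2Q_fst; exact: grad_L2v.
have LD i : L2Q Omega T (Gr i \- (fun z => grad Omega u i z.2)) by exact: (L2_B mQ (LG i) (Lu i)).
exact: (L2Qv_dot_integrable LD LD).
Qed.

Lemma gdistE Gr (v : R * E -> R) u t : 0 < t <= T -> H1 Omega u -> L2 mu Omega (slice v t) ->
  is_weak_grad Omega (slice v t) (fun i => slice (Gr i) t) ->
  gdist Gr u t = ip (slice v t \- u) (slice v t \- u).
Proof.
move=> tT Hu Lv wv; rewrite /gdist tcutE// ipE.
have wu := grad_weak Hu.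
have := weak_grad_comb oO bO (-1) Hu.1 Lv wu wv; rewrite -subE => w1.
rewrite (dotv_grad oO bO w1 w1); congr (dotL2v _ _ _); apply/funext => i; exact: subE.
Qed.

Lemma igr_indicM (D : set R) f : measurable (D : set (measurableTypeR R)) ->
  lam.-integrable D (EFin \o f) -> igr (fun t => f t * \1_D t).
Proof.
move=> mD If; rewrite /igr.
have := (iffLR (integrable_mkcond _ mD)) If.
rewrite (_ : _ \_ _ = EFin \o (fun t => f t * \1_D t))//.
apply/funext => t; rewrite patchE /= indicE.
by case: ifPn => _; rewrite ?mulr1 ?mulr0.
Qed.

Lemma dualnorm_igr g : L2Hm1 Omega T g -> igr (fun t => N (g t) ^+ 2 * \1_J t).
Proof.
move=> [_ _ Ig]; apply: igr_indicM => //.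
by apply: eq_integrable Ig => // t _ /=; rewrite dualnormE.
Qed.

Section good.
Variables (v : R * E -> R) (Gr : 'I_d -> R * E -> R).
Hypotheses (vH : L2H10 Omega T v) (vG : is_gradQ Omega T v Gr).

(** The exceptional times are exhibited as a measurable set, not just through an almost-everywhere
    statement, because its indicator serves to build measurable functions. *)
Lemma good_set : exists2 Z : set R, measurable (Z : set (measurableTypeR R)) /\ lam Z = 0%E &
  forall t, 0 < t < T -> ~ Z t ->
    H10 (slice v t) /\ is_weak_grad Omega (slice v t) (fun i => slice (Gr i) t).
Proof.
have [_ ae1 _] := vH; have [_ ae2] := vG.
have [Z [mZ Z0 HZ]] : {ae lam, forall t, J t ->
    H10 (slice v t) /\ is_weak_grad Omega (slice v t) (fun i => slice (Gr i) t)}.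
  by apply: (lam_aeS2 _ ae1 ae2) => t h1 h2 Jt; split; [exact: h1|exact: h2].
exists Z => // t tT nZ; apply: contrapT => H; apply: nZ; apply: HZ => /= h; apply: H.
by apply: h; rewrite /= in_itv.
Qed.

(** [measurable_Hm1_pairing] asks for elements of H^1_0 at every time, so bad slices are replaced by
    0. Integrability comes from Young's inequality: the pairing is dominated by the squared dual
    norm plus [gdist] at [u = 0]. *)
Lemma pairing (g : R -> (E -> R) -> R) : L2Hm1 Omega T g ->
  exists2 c, igr c & {ae lam, forall t, J t -> c t = g t (slice v t)}.
Proof.
move=> [gJ mg Ig].
have [Z [mZ Z0] HZ] := good_set.
pose phi t : E -> R := if t \in ~` Z then slice v t else fun=> 0.
have phiH t : J t -> H10 (phi t).
  rewrite /= in_itv/= /phi => tT; case: ifPn => [/set_mem tZ|_]; last exact: H10_0.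
  by have [] := HZ t tT tZ.
have LG i : L2Q Omega T (Gr i) by have [] := vG.
have nuphi u : H10 u -> measurable_fun J (fun t => nu Omega (phi t \- u)).
  move=> Hu; have Hu1 := H10_H1 Hu.
  (* At good times the distance is the square root of [gdist], and on the null set it is a constant;
     in this form measurability in [t] is visible. *)
  pose h t := Num.sqrt (gdist Gr u t) * \1_(~` Z) t + nu Omega ((fun=> 0) \- u) * \1_Z t.
  have mh : measurable_fun J h.
    have mg1 : measurable_fun setT (gdist Gr u).
      by have := gdist_igr LG Hu1 => /measurable_int/measurable_EFinP.
    apply: measurable_funTS; apply: measurable_funD; apply: measurable_funM.
    + apply: (@measurableT_comp _ _ _ _ _ _ (@Num.sqrt R)) => //.
      by apply: continuous_measurable_fun; exact: sqrt_continuous.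
    + by apply: measurable_indic; exact: measurableC.
    + exact: measurable_cst.
    + exact: measurable_indic.
  apply: eq_measurable_fun mh => t /set_mem; rewrite /= in_itv/= => tT.
  rewrite /h /phi !indicE; case: ifPn => [/set_mem tZ|].
    rewrite memNset// mulr1 mulr0 addr0.
  have [H1t wt] := HZ t tT tZ.
    rewrite (gdistE _ Hu1 (H10_L2 H1t) wt); last by case/andP: tT => -> /ltW.
    by rewrite -nu_sqr sqrtr_sqr ger0_norm// nu_ge0.
  rewrite in_setC negbK => tZ; rewrite tZ mulr0 mulr1 add0r.
  by [].
have mp := measurable_Hm1_pairing oO bO mJ gJ mg phiH nuphi.
have H0 : H10 (fun=> 0) := H10_0 oO bO.
have Ip : lam.-integrable J (EFin \o (fun t => g t (phi t))).
  pose K t := N (g t) ^+ 2 * \1_J t + gdist Gr (fun=> 0) t.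
  have IK : igr K by apply: igrD; [exact: dualnorm_igr|exact: (gdist_igr LG (H10_H1 H0))].
  apply: (@le_integrable _ _ _ lam J mJ _ (EFin \o K)).
  - exact/measurable_EFinP.
  - move=> t Jt /=; rewrite lee_fin.
    apply: (@le_trans _ _ (K t)); last exact: ler_norm.
    have gt := gJ t Jt; have pt := phiH t Jt.
    have Y := Hm1_young oO bO ltr01 gt pt; rewrite invr1 !mul1r in Y.
    have ph : ip (phi t) (phi t) <= gdist Gr (fun=> 0) t.
      move: (Jt); rewrite /= in_itv/= /phi => tT; case: ifPn => [/set_mem tZ|_].
        have [H1t wt] := HZ t tT tZ.
        rewrite (gdistE _ (H10_H1 H0) (H10_L2 H1t) wt); last by case/andP: tT => -> /ltW.
        rewrite (_ : slice v t \- _ = slice v t)//.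
        by apply/funext => x /=; rewrite subr0.
      apply: (le_trans _ (gdist_ge0 _ _ _)); rewrite -nu_sqr (nu_trivial oO bO H0) ?expr0n//.
      by apply; apply: aeW.
    rewrite /K indicE mem_set// mulr1; move: Y ph (ip_ge0 Omega (phi t)) (normr_ge0 (g t (phi t))).
    by move: `|_| (ip _ _) (N _ ^+ 2) (gdist _ _ _) => x1 x2 x3 x4; lra.
  - exact: igrS.
exists (fun t => g t (phi t) * \1_J t); first exact: igr_indicM.
exists Z; split => // t /= Ht; apply: contrapT => tZ; apply: Ht => Jt.
by rewrite indicE mem_set// mulr1 /phi mem_set.
Qed.

End good.
End bochner.

Lemma le_half_sq {R : realType} (x B l : R) : 0 <= x -> 0 <= B -> 0 <= l ->
  x ^+ 2 <= B * l ^+ 2 -> x <= l * (B + 1) / 2.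
Proof.
move=> x0 B0 l0 h; rewrite -(@ler_pXn2r _ 2) ?nnegrE ?divr_ge0 ?mulr_ge0 ?addr_ge0//.
apply: (le_trans h); rewrite -subr_ge0.
have -> : (l * (B + 1) / 2) ^+ 2 - B * l ^+ 2 = (2^-1 * (B - 1) * l) ^+ 2 by field.
exact: sqr_ge0.
Qed.

(** * The weak equation between almost all pairs of times *)

Section time_weak.
Context {R : realType} {d : nat} (Omega : set 'rV[R]_d).
Hypotheses (oO : open Omega) (bO : bounded_set Omega).
Variable T : R.
Hypothesis T0 : 0 < T.
Local Notation E := 'rV[R]_d.
Local Notation mu := (@lebesgue_rV R d).
Local Notation lam := (@lebesgue_measure R).
Local Notation J := `]0, T[%classic.
Local Notation I := `]0, T]%classic.
Local Notation ip := (ip Omega).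
Local Notation N := (dualnorm Omega).
Local Notation H10 := (H10 Omega).
Local Notation dotO := (dotL2 Omega).

Let mO : measurable Omega := domain_measurable oO.
Let fO : (mu Omega < +oo)%E := domain_finite oO bO.
Let mI : measurable (I : set (measurableTypeR R)). Proof. by []. Qed.
Let mJ : measurable (J : set (measurableTypeR R)). Proof. by []. Qed.
Let fI : (lam I < +oo)%E.
Proof.
have := @lebesgue_measure_itv R `]0, T] => /= ->.
by case: ifP => _; rewrite -?EFinD ltry.
Qed.

Variable g : R -> (E -> R) -> R.
Hypothesis gH : L2Hm1 Omega T g.

Definition gfun (g : R -> (E -> R) -> R) u t := g t u * \1_J t.

Lemma gfunE u t : 0 < t < T -> gfun g u t = g t u.
Proof. by move=> tT; rewrite /gfun indicE mem_set ?mulr1//= in_itv. Qed.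

Lemma gfun_measurable u : H10 u -> @measurable_fun _ _ (measurableTypeR R) R setT (gfun g u).
Proof.
have [_ mg _] := gH; move=> Hu.
have := (iffLR (measurable_restrictT _ mJ)) (mg u Hu).
rewrite (_ : _ \_ _ = gfun g u)//.
apply/funext => t; rewrite patchE /gfun indicE.
by case: ifPn => _; rewrite ?mulr1 ?mulr0.
Qed.

Lemma gfun_L2 u : H10 u -> L2 lam I (gfun g u).
Proof.
move=> Hu; have mg := gfun_measurable Hu; have [gJ _ _] := gH.
have IN := igrZ (ip u u) (dualnorm_igr gH).
split; first exact: measurable_funTS.
apply: (@le_integrable _ _ _ lam I mI _ (EFin \o (fun t => ip u u * (N (g t) ^+ 2 * \1_J t)))).
- by apply/measurable_EFinP; apply: measurable_funTS; exact: measurable_funX.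
- move=> t _ /=; rewrite lee_fin; apply: le_trans (ler_norm _).
  rewrite normrX /gfun indicE; case: (boolP (t \in J)) => [/set_mem Jt|_].
    rewrite !mulr1 -nu_sqr -exprMn mulrC.
    by rewrite lerXn2r ?nnegrE ?mulr_ge0 ?nu_ge0 ?(normHm1_ge0 oO bO (gJ t Jt))// (Hm1_abs oO bO (gJ t Jt) Hu).
  by rewrite !mulr0 normr0 expr0n.
- exact: igrS.
Qed.

Lemma gfun_igr u : H10 u -> igr (gfun g u).
Proof.
move=> Hu; have If : lam.-integrable I (EFin \o gfun g u).
  have := L2_mul mI (gfun_L2 Hu) (L2_cst mI fI 1); apply: eq_integrable => // x _ /=.
  by rewrite mulr1.
have := igr_tcut If.
rewrite (_ : tcut T (gfun g u) = gfun g u)//; apply/funext => t.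
rewrite /tcut /gfun -mulrA; congr (_ * _); rewrite !indicE -natrM mulnb; congr ((nat_of_bool _)%:R).
apply/idP/idP => [/andP[]//|tJ]; rewrite tJ/=; apply/mem_set; move/set_mem : tJ.
by rewrite /= !in_itv/= => /andP[-> /ltW].
Qed.

Variables (v : R * E -> R) (Gr : 'I_d -> R * E -> R).
Hypotheses (vH : L2H10 Omega T v) (vG : is_gradQ Omega T v Gr) (vg : is_dt Omega T v g).

Lemma weak_ae u : H10 u ->
  exists c, {ae lam, forall t, J t -> dotO (slice v t) u = c + itg (gfun g u) 0 t}.
Proof.
move=> Hu; have Lu := H10_L2 Hu; have Lv : L2Q Omega T v by case: vH.
have [Z [mZ Z0] HZ] := good_set vH vG.
pose F t := dotO (slice v t) u.
have IF : lam.-integrable I (EFin \o F).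
  exact: (L2Q_dot_integrable oO Lv (L2Q_fst oO T Lu)).
have Ivv := L2Q_dot_integrable oO Lv Lv.
pose FZ t := F t * \1_(~` (Z `|` [set T])) t.
have FZE t : J t -> ~ Z t -> FZ t = F t.
  move=> Jt nZ; rewrite /FZ indicE mem_set ?mulr1// => -[//|/= tT].
  by move: Jt; rewrite /= in_itv/= tT ltxx andbF.
have LF : L2 lam I FZ.
  have mF : measurable_fun I FZ.
    apply: measurable_funM; first by have := IF => /measurable_int/measurable_EFinP.
    by apply: measurable_funTS; apply: measurable_indic; apply: measurableC; exact: measurableU.
  split => //.
  apply: (@le_integrable _ _ _ lam I mI _ (EFin \o (fun t => dotO u u * dotO (slice v t) (slice v t)))).
  - by apply/measurable_EFinP; exact: measurable_funX.
  - move=> t It /=; rewrite lee_fin; apply: le_trans (ler_norm _).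
    rewrite normrX /FZ indicE; case: (boolP (t \in ~` (Z `|` [set T]))) => [/set_mem h|_].
      have tT : 0 < t < T.
        move: It; rewrite /= in_itv/= => /andP[-> tT]; rewrite lt_neqAle tT andbT.
        by apply/eqP => tE; apply: h; right.
      have nZ : ~ Z t by move=> Zt; apply: h; left.
      have [Ht _] := HZ t tT nZ.
      rewrite mulr1 real_normK ?num_real// mulrC.
      exact: (dot_CS mO (H10_L2 Ht) Lu).
    by rewrite mulr0 normr0 expr0n mulr_ge0// dot_ge0.
  - exact: (integrableZl mI (dotO u u) Ivv).
have aeF : {ae lam, forall t, J t -> FZ t = F t}.
  exists Z; split => // t /= Ht; apply: contrapT => nZ; apply: Ht => Jt; exact: FZE.
have [_ H] := vg.
have H' eta : test_time T eta ->
    \int[lam]_(t in I) (derive1 eta t * FZ t) = - \int[lam]_(t in I) (eta t * gfun g u t).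
  move=> te; rewrite -!Rintegral_JI.
  transitivity (\int[lam]_(t in J) (derive1 eta t * F t)).
    by apply: ae_eq_Rintegral; apply: (lam_aeS _ aeF) => t h Jt; rewrite h.
  rewrite (H eta u te Hu); congr (- _); apply: eq_Rintegral => t /set_mem; rewrite /= in_itv/= => tT.
  by rewrite gfunE.
have [c Hc] := du_bois_reymond T0 LF (gfun_L2 Hu) H'.
exists c; apply: (lam_aeS2 _ aeF Hc) => t h1 h2 Jt.
rewrite -/(F t) -(h1 Jt); apply: h2; move: Jt; rewrite /= !in_itv/= => /andP[-> /ltW].
by [].
Qed.

(** The exceptional set of [weak_ae] depends on [u]. It is discarded for the countably many [D j] at
    once, the constants [cc j] cancel between two times, and density gives every [u]: at fixed good
    times the left side is continuous in the L^2 norm of [u] and the right side in its gradient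
    norm. *)
Lemma evolution_set : exists2 G : set R,
  (forall t, G t -> 0 < t < T) /\ {ae lam, forall t, 0 < t < T -> G t} &
  (forall t, G t -> H10 (slice v t) /\ is_weak_grad Omega (slice v t) (fun i => slice (Gr i) t)) /\
  forall s t u, G s -> G t -> s < t -> H10 u ->
    dotO (slice v t \- slice v s) u = itg (gfun g u) s t.
Proof.
have [Z [mZ Z0] HZ] := good_set vH vG.
have [K [D [DH Dd]]] := H10_separable oO bO.
have /choice[cc Hcc] : forall j : K, exists c,
    {ae lam, forall t, J t -> dotO (slice v t) (D j) = c + itg (gfun g (D j)) 0 t}.
  by move=> j; exact: weak_ae.
have aeD : {ae lam, forall t, forall j : K, J t -> dotO (slice v t) (D j) = cc j + itg (gfun g (D j)) 0 t}.
  exact: ae_forall_count.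
pose G t := [/\ 0 < t < T, ~ Z t & forall j : K, dotO (slice v t) (D j) = cc j + itg (gfun g (D j)) 0 t].
exists G.
  split; first by move=> t [].
  have aeZ : {ae lam, forall t, ~ Z t}.
    by exists Z; split => // t /= /contrapT.
  apply: (lam_aeS2 _ aeZ aeD) => t h1 h2 tT; split => // j; apply: h2.
  by rewrite /= in_itv.
split; first by move=> t [tT nZ _]; exact: HZ.
move=> s t u [sT nZs Hs] [tT nZt Ht] st Hu.
have [Hvs _] := HZ s sT nZs; have [Hvt _] := HZ t tT nZt.
have Ls := H10_L2 Hvs; have Lt := H10_L2 Hvt; have Lst := L2_B mO Lt Ls.
have s0 : 0 <= s by case/andP: sT => /ltW.
have HD j : dotO (slice v t \- slice v s) (D j) = itg (gfun g (D j)) s t.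
  have e1 : dot mu Omega (slice v t) (D j) = _ := Ht j.
  have e2 : dot mu Omega (slice v s) (D j) = _ := Hs j.
  apply: (etrans (dotBl mO Lt Ls (H10_L2 (DH j)))); rewrite e1 e2.
  by rewrite (itg_split (gfun_igr (DH j)) s0 (ltW st)); move: (itg _ _ _) (itg _ _ _) => x y; ring.
have [gJ _ _] := gH.
set B := dotO (slice v t \- slice v s) (slice v t \- slice v s).
have B0 : 0 <= B by exact: dot_ge0.
pose NN := itg (fun t => N (g t) ^+ 2 * \1_J t) s t.
have IN := dualnorm_igr gH.
have NN0 : 0 <= NN by apply: itg_ge0 => x; rewrite mulr_ge0 ?sqr_ge0// indicE.
apply/eqP; rewrite -subr_eq0 -normr_eq0 eq_le normr_ge0 andbT.
apply/ler_addgt0Pr => e e0; rewrite add0r.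
(* [C] collects the constants of the two error bounds [A1] and [A2], so that their total with
   [l = e / C] is at most [e]. *)
pose C := B + NN + 1 + (t - s).
have C0 : 0 < C by rewrite /C; move: (st) B0 NN0; rewrite -subr_gt0; lra.
pose l := e / C; have l0 : 0 < l by rewrite divr_gt0.
have l20 : 0 < l ^+ 2 by rewrite exprn_gt0.
have [j Hj] := Dd u Hu _ l20.
have Huj := H10_B oO bO Hu (DH j); have Luj := H10_L2 Huj.
have E1 : dotO (slice v t \- slice v s) u - dotO (slice v t \- slice v s) (D j) =
    dotO (slice v t \- slice v s) (u \- D j).
  by apply: esym; exact: (dotBr mO (H10_L2 Hu) (H10_L2 (DH j)) Lst).
have E2 : itg (gfun g u) s t - itg (gfun g (D j)) s t = itg (gfun g (u \- D j)) s t.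
  have ee := itg_comb (-1) s t (gfun_igr (DH j)) (gfun_igr Hu).
  transitivity (-1 * itg (gfun g (D j)) s t + itg (gfun g u) s t).
    by move: (itg _ _ _) (itg _ _ _) => x y; ring.
  rewrite -ee.
  apply: itg_eq => x; rewrite /= in_itv/= => /andP[sx xt].
  have xT : 0 < x < T by rewrite (le_lt_trans s0 sx) (le_lt_trans xt)//; case/andP: tT.
  have Jx : J x by rewrite /= in_itv.
  rewrite !gfunE// (Hm1_B (gJ x Jx) Hu (DH j)).
  by move: (g _ _) (g _ _) => y z; ring.
have D1 : dotO (u \- D j) (u \- D j) <= l ^+ 2.
  by apply: le_trans Hj; rewrite /H10_dist lerDl ip_ge0.
have D2 : ip (u \- D j) (u \- D j) <= l ^+ 2.
  by apply: le_trans Hj; rewrite /H10_dist lerDr dot_ge0.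
have A1 : `|dotO (slice v t \- slice v s) (u \- D j)| <= l * (B + 1) / 2.
  have := dot_CS mO Lst Luj; rewrite -/B -(real_normK (num_real (dot _ _ _ _))).
  move=> h; apply: (le_half_sq (normr_ge0 _) B0 (ltW l0)).
  by apply: (le_trans h); rewrite ler_wpM2l.
have A2 : 2 * `|itg (gfun g (u \- D j)) s t| <= l * (NN + (t - s)).
  have Ig := gfun_igr Huj.
  have Iga : igr (fun x => `|gfun g (u \- D j) x|).
    by have := integrable_abse Ig; exact: eq_integrable.
  apply: (@le_trans _ _ (2 * itg (fun x => `|gfun g (u \- D j) x|) s t)).
    by rewrite ler_pM2l//; exact: itg_abs.
  have Ic := igrZ l (igr_indic s t).
  rewrite -(itgZ 2 _ _ Iga) mulrDr -[l * (t - s)]itg_cst ?(ltW st)//.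
  have -> : itg (fun=> l) s t = itg (fun x => l * \1_(`]s, t]%classic) x) s t.
    by apply: itg_eq => x xst; rewrite indicE mem_set// mulr1.
  rewrite -itg_comb//; apply: itg_le; [exact: igrZ|exact: igrD (igrZ _ _) _|].
  move=> x xst; have xT : 0 < x < T.
    move: xst; rewrite /= in_itv/= => /andP[sx xt].
    by rewrite (le_lt_trans s0 sx) (le_lt_trans xt)//; case/andP: tT.
  have Jx : J x by rewrite /= in_itv.
  rewrite gfunE// !indicE !mem_set// !mulr1.
  have Y := Hm1_young oO bO l0 (gJ x Jx) Huj.
  apply: (le_trans Y); rewrite lerD2l.
  rewrite ler_pdivrMl//; move: D2; by rewrite expr2.
have HDj := HD j.
have lC : l * C = e by rewrite /l divfK// gt_eqF.
have -> : dotO (slice v t \- slice v s) u - itg (gfun g u) s t =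
    dotO (slice v t \- slice v s) (u \- D j) - itg (gfun g (u \- D j)) s t.
  by rewrite -E1 -E2 HDj; move: (itg _ _ _) (itg _ _ _) (dotO _ _) => *; ring.
apply: (le_trans (ler_normB _ _)); rewrite -lC /C.
move: A1 A2; move: `|_| `|_| => x y A1 A2.
have : 0 < l * (t - s) by rewrite mulr_gt0// subr_gt0.
have : 0 <= l * B by rewrite mulr_ge0// ltW.
have : 0 <= l * NN by rewrite mulr_ge0// ltW.
move: A1 A2; rewrite !mulrDr mulr1; move: (l * B) (l * NN) (l * (t - s)) => *; lra.
Qed.

End time_weak.

(** * Continuous representatives *)

Section representative.
Context {R : realType} {d : nat} (Omega : set 'rV[R]_d).
Hypotheses (oO : open Omega) (bO : bounded_set Omega).
Variable T : R.
Hypothesis T0 : 0 < T.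
Local Notation E := 'rV[R]_d.
Local Notation mu := (@lebesgue_rV R d).
Local Notation lam := (@lebesgue_measure R).
Local Notation J := `]0, T[%classic.
Local Notation I := `]0, T]%classic.
Local Notation dotv := (dotL2v Omega).
Local Notation ip := (ip Omega).
Local Notation N := (dualnorm Omega).
Local Notation H10 := (H10 Omega).
Local Notation dotO := (dotL2 Omega).
Local Notation L2O := (L2 mu Omega).

Let mO : measurable Omega := domain_measurable oO.
Let fO : (mu Omega < +oo)%E := domain_finite oO bO.

Variables (v : R * E -> R) (Gr : 'I_d -> R * E -> R) (g : R -> (E -> R) -> R).
Hypotheses (vH : L2H10 Omega T v) (vG : is_gradQ Omega T v Gr) (vg : is_dt Omega T v g).

Let LG i : L2Q Omega T (Gr i). Proof. by have [] := vG. Qed.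

Let pf := gdist Omega T Gr.

Section step.
Variable G : set R.
Hypotheses (aeG : {ae lam, forall t, 0 < t < T -> G t})
  (GH : forall t, G t -> H10 (slice v t) /\ is_weak_grad Omega (slice v t) (fun i => slice (Gr i) t)).

Let aeGT a b : 0 <= a -> b <= T -> {ae lam, forall x, `]a, b]%classic x -> G x}.
Proof.
move=> a0 bT.
have aeT : {ae lam, forall x, x != T}.
  by exists [set T]; split => //; [exact: lebesgue_measure_set1|move=> x /= /negP; rewrite negbK => /eqP].
apply: (lam_aeS2 _ aeG aeT) => x h1 h2; rewrite /= in_itv/= => /andP[ax xb].
by apply: h1; rewrite (le_lt_trans a0 ax) lt_neqAle h2 (le_trans xb bT).
Qed.

(** The fields produced by [step_approx] need not be gradients. They are replaced by the gradient of
    a slice of [v] at a mean-value time [r] of the cell. Comparing [Gr] at times [t] and [r] through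
    [a] costs twice the integral plus twice the mean, hence the factor 4. *)
Let cell_approx (a : 'I_d -> E -> R) s e : (forall i, L2O (a i)) -> 0 <= s -> s < e -> e <= T ->
  exists2 u, H10 u & itg (pf u) s e <= 4 * itg (tcut T (fun t => \sum_i dot mu Omega
    (fun x => Gr i (t, x) - a i x) (fun x => Gr i (t, x) - a i x))) s e.
Proof.
move=> La s0 se eT; set f := tcut T _.
have fE t : 0 < t <= T -> f t = dotv (fun i => slice (Gr i) t \- a i) (fun i => slice (Gr i) t \- a i).
  by move=> tT; rewrite /f tcutE.
have If : igr f.
  apply: igr_tcut.
  have mQ := @measurable_Q R _ E Omega T mO.
  have LD i : L2Q Omega T (Gr i \- (fun z => a i z.2)).
    by apply: (L2_B mQ (LG i)); exact: L2Q_fst.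
  exact: (L2Qv_dot_integrable oO LD LD).
have [r [sre Gr_ hr]] := itg_mean se If (aeGT s0 eT).
have [Hr wr] := GH Gr_; exists (slice v r) => //.
have Hr1 := H10_H1 Hr.
have Ip := gdist_igr oO LG Hr1.
have TT t : s < t <= e -> 0 < t <= T.
  by move=> /andP[st te]; rewrite (le_lt_trans s0 st) (le_trans te eT).
have I1 : igr (fun x => f r * \1_(`]s, e]%classic) x) by apply: igrZ; exact: igr_indic.
have key : itg (pf (slice v r)) s e <= itg (fun x => 2 * f x + 2 * (f r * \1_(`]s, e]%classic) x)) s e.
  apply: (@itg_le_ae _ _ _ _ _ G) => //; first by apply: igrD; exact: igrZ.
    exact: aeGT.
  move=> t tse Gt; rewrite indicE mem_set// mulr1.
  have tT : 0 < t <= T by apply: TT; move: tse; rewrite /= in_itv.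
  have [Ht wt] := GH Gt.
  rewrite /pf (gdistE oO bO tT Hr1 (H10_L2 Ht) wt) ipE.
  have := weak_grad_comb oO bO (-1) (H10_L2 Hr) (H10_L2 Ht) wr wt; rewrite -subE => w1.
  rewrite (dotv_grad oO bO w1 w1) (fE t tT) (fE r (TT r sre)).
  have Lt i : L2O (slice (Gr i) t \- a i) by apply: (L2_B mO _ (La i)); have [] := wt.
  have Lr i : L2O (slice (Gr i) r \- a i) by apply: (L2_B mO _ (La i)); have [] := wr.
  apply: le_trans (dotv_le2 mO Lt Lr); rewrite le_eqVlt; apply/orP; left; apply/eqP.
  by congr (dotL2v _ _ _); apply/funext => i; apply/funext => x /=; ring.
apply: (le_trans key).
rewrite (itg_comb 2 s e If (igrZ 2 I1)) (itgZ 2 _ _ I1).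
have -> : itg (fun x => f r * \1_(`]s, e]%classic) x) s e = f r * (e - s).
  by rewrite -itg_cst ?(ltW se)//; apply: itg_eq => x xse; rewrite indicE mem_set// mulr1.
by move: hr; rewrite mulrC; move: (itg _ _ _) (f r * _) => x y; lra.
Qed.

Lemma gdist_step e : 0 < e -> exists n (u : nat -> E -> R), [/\ (0 < n)%N,
  forall k, H10 (u k) &
  \sum_(k < n) itg (pf (u k)) (T * k%:R / n%:R) (T * k.+1%:R / n%:R) <= e].
Proof.
move=> e0; have e4 : 0 < e / 4 by rewrite divr_gt0.
have [n [a [n0 La Ha]]] := step_approx mO fO T0 LG e4.
have n0' : 0 < n%:R :> R by rewrite ltr0n.
have /choice[u Hu] : forall k, exists u, H10 u /\ ((k < n)%N ->
    itg (pf u) (T * k%:R / n%:R) (T * k.+1%:R / n%:R) <= 4 * itg (tcut T (fun t => \sum_i dot mu Omega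
    (fun x => Gr i (t, x) - a k i x) (fun x => Gr i (t, x) - a k i x))) (T * k%:R / n%:R) (T * k.+1%:R / n%:R)).
  move=> k; have [kn|nk] := boolP (k < n)%N; last by exists (fun=> 0); split; [exact: H10_0|].
  have s0 : 0 <= T * k%:R / n%:R by rewrite divr_ge0// mulr_ge0// ltW.
  have se : T * k%:R / n%:R < T * k.+1%:R / n%:R by rewrite ltr_pM2r ?invr_gt0// ltr_pM2l// ltr_nat.
  have eT : T * k.+1%:R / n%:R <= T by rewrite ler_pdivrMr// ler_pM2l// ler_nat.
  by have [u Hu hu] := cell_approx (La k) s0 se eT; exists u.
exists n, u; split => //; first by move=> k; have [] := Hu k.
apply: (@le_trans _ _ (4 * (e / 4))); last by rewrite mulrC divfK.
apply: (le_trans _ (ler_wpM2l _ Ha)) => //; rewrite mulr_sumr.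
by apply: ler_sum => k _; have [_] := Hu k; apply.
Qed.

End step.

Lemma dot_sq_diff u w l : L2O u -> L2O w -> 0 < l ->
  `|dotO u u - dotO w w| <= l * dotO u u + (1 + l^-1) * dotO (u \- w) (u \- w).
Proof.
move=> Lu Lw l0; have Ld := L2_B mO Lu Lw.
have Y := young_of_CS (dot_ge0 mu Omega u) (dot_ge0 mu Omega (u \- w)) l0 (dot_CS mO Lu Ld).
have E1 := dot_sqB mO Lu Lw; have E2 := dotBr mO Lu Lw Lu.
have D0 := dot_ge0 mu Omega (u \- w).
change (`|dot mu Omega u u - dot mu Omega w w| <=
  l * dot mu Omega u u + (1 + l^-1) * dot mu Omega (u \- w) (u \- w)).
move: Y E1 E2 D0.
move: (dot mu Omega u (u \- w)) (dot mu Omega (u \- w) (u \- w)) (dot mu Omega u u) (dot mu Omega w w) (dot mu Omega u w).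
move=> x1 x2 x3 x4 x5 + E1 E2 x20; rewrite (mulrDl 1 l^-1 x2) (mul1r x2).
have := normr_ge0 x1; have := ler_norm x1; have := lerNnormlW (lexx `|x1|).
move: `|x1| (l * x3) (l^-1 * x2) => y1 y2 y3 h1 h2 h3 Y.
by rewrite ler_norml; apply/andP; split; lra.
Qed.

Lemma evolution_rep : exists (W : R -> E -> R) (c : R -> R),
  [/\ igr c, {ae lam, forall t, J t -> c t = g t (slice v t)},
      is_continuous_rep Omega T v W &
      dotO (W T) (W T) - dotO (W 0) (W 0) = 2 * itg c 0 T].
Proof.
have gH : L2Hm1 Omega T g by case: vg.
have [gJ _ _] := gH.
have [G1 [G1T aeG1] [G1H G1w]] := evolution_set oO bO T0 gH vH vG vg.
have [c Ic aec] := pairing oO bO vH vG gH.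
pose G : set R := [set t | G1 t /\ c t = g t (slice v t)].
have GT t : G t -> 0 < t < T by move=> [/G1T].
have aeG : {ae lam, forall t, 0 < t < T -> G t}.
  apply: (lam_aeS2 _ aeG1 aec) => t h1 h2 tT; split; first exact: h1.
  by apply: h2; rewrite /= in_itv.
have GH t : G t -> H10 (slice v t) /\ is_weak_grad Omega (slice v t) (fun i => slice (Gr i) t).
  by move=> [/G1H].
have GJ t : G t -> J t by move=> /GT; rewrite /= in_itv.
pose w : R -> (E -> R : zmodType) := slice v.
pose Ng t := N (g t) ^+ 2 * \1_J t.
have NgI : igr Ng := dualnorm_igr gH.
have Ng0 t : 0 <= Ng t by rewrite mulr_ge0 ?sqr_ge0// indicE.
have LpB (u u' : E -> R : zmodType) : L2O u -> L2O u' -> L2O (u - u') by exact: (L2_B mO).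
have HpLp (u : E -> R : zmodType) : H10 u -> L2O u := @H10_L2 _ _ _ u.
have Hp0 : H10 (0 : (E -> R : zmodType)) by exact: (H10_0 oO bO).
have HpB (u u' : E -> R : zmodType) : H10 u -> H10 u' -> H10 (u - u') by exact: (H10_B oO bO).
have HpD (u u' : E -> R : zmodType) : H10 u -> H10 u' -> H10 (u + u') by exact: (H10_D oO bO).
have bC (u u' : E -> R : zmodType) : dotO u u' = dotO u' u by exact: dotC.
have bB (u u' z : E -> R : zmodType) : L2O u -> L2O u' -> L2O z -> dotO (u - u') z = dotO u z - dotO u' z.
  exact: (dotBl mO).
have bge0 (u : E -> R : zmodType) : 0 <= dotO u u by exact: dot_ge0.
have bCS (u u' : E -> R : zmodType) : L2O u -> L2O u' -> dotO u u' ^+ 2 <= dotO u u * dotO u' u'.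
  exact: (dot_CS mO).
have qB (u u' : E -> R : zmodType) : H10 u -> H10 u' -> ip (u - u') (u - u') <= 2 * ip u u + 2 * ip u' u'.
  by move=> /H10_H1 Hu /H10_H1 Hu'; exact: (ip_sqB_le oO bO Hu Hu').
have qD (u u' : E -> R : zmodType) : H10 u -> H10 u' -> ip (u + u') (u + u') <= 2 * ip u u + 2 * ip u' u'.
  move=> /H10_H1 Hu /H10_H1 Hu'; have := ip_sq_comb_le oO bO 1 Hu Hu'.
  rewrite expr1n mulr1 (_ : (fun x => _) = u + u')//.
  by apply/funext => x /=; rewrite mul1r.
have wHp t : G t -> H10 (w t) by move=> /GH[].
have pfI (u : E -> R : zmodType) : H10 u -> igr (pf u).
  by move=> /H10_H1; exact: (gdist_igr oO LG).
have pf0 (u : E -> R : zmodType) t : 0 <= pf u t by exact: gdist_ge0.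
have pfE (u : E -> R : zmodType) t : H10 u -> G t -> pf u t = ip (w t - u) (w t - u).
  move=> Hu Gt; have [Ht wt] := GH t Gt.
  apply: (gdistE oO bO _ (H10_H1 Hu) (H10_L2 Ht) wt).
  by have /andP[-> /ltW] := GT t Gt.
have gfI (u : E -> R : zmodType) : H10 u -> igr (gfun T g u) by exact: (gfun_igr oO bO gH).
have gfE (u : E -> R : zmodType) t : H10 u -> G t -> gfun T g u t = g t u.
  by move=> _ /GT; exact: gfunE.
have cE t : G t -> c t = g t (w t) by case.
have gB t (u u' : E -> R : zmodType) : G t -> H10 u -> H10 u' -> g t (u - u') = g t u - g t u'.
  by move=> Gt; exact: (Hm1_B (gJ t (GJ t Gt))).
have gyoung t (u : E -> R : zmodType) l : G t -> H10 u -> 0 < l ->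
    2 * `|g t u| <= l * Ng t + l^-1 * ip u u.
  move=> Gt Hu l0; rewrite /Ng indicE mem_set ?mulr1; last exact: GJ.
  exact: (Hm1_young oO bO l0 (gJ t (GJ t Gt)) Hu).
have weak s t (u : E -> R : zmodType) : G s -> G t -> s < t -> H10 u ->
    dotO (w t - w s) u = itg (gfun T g u) s t.
  by move=> [Gs _] [Gt _]; exact: G1w.
have bcomp (u : nat -> (E -> R : zmodType)) : (forall n, L2O (u n)) ->
    (forall n, dotO (u n.+1 - u n) (u n.+1 - u n) <= 8^-1 ^+ n) ->
    exists f : (E -> R : zmodType), L2O f /\ dotO (f - u n) (f - u n) @[n --> \oo] --> (0 : R).
  exact: (L2_complete mO).
have wLp t : G t -> L2O (w t) by move=> /wHp/HpLp.
have Wk := w_modulus LpB HpLp Hp0 HpB HpD bC bB bge0 bCS qB qD GT aeG wHp pfI pf0 pfE gfI gfE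
  NgI Ng0 gyoung weak.
have kI : igr (modulus Ng pf).
  by apply: igrZ; apply: igrD => //; exact: pfI.
have bS (u u' : E -> R : zmodType) : L2O u -> L2O u' -> dotO (u - u') (u - u') = dotO (u' - u) (u' - u).
  move=> Lu Lu'; have e1 := dot_sqB mO Lu Lu'; have e2 := dot_sqB mO Lu' Lu.
  by apply: (etrans e1); apply: (etrans _ (esym e2)); rewrite (dotC _ _ u' u); ring.
have btri (u u' z : E -> R : zmodType) : L2O u -> L2O u' -> L2O z ->
    dotO (u - z) (u - z) <= 2 * dotO (u - u') (u - u') + 2 * dotO (u' - z) (u' - z).
  exact: (dot_tri mO).
have bxx (u : E -> R : zmodType) : L2O u -> dotO (u - u) (u - u) = 0.
  move=> Lu; have e1 := dot_sqB mO Lu Lu; apply: (etrans e1).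
  by move: (dot _ _ _ _) => x; ring.
have [W [WL Ww Wc W0]] := continuous_extension T0 aeG bge0 bS btri bxx bcomp wLp kI Wk.
have en := energy_le LpB HpLp Hp0 HpB HpD bC bB qD GT aeG wHp pfI pf0 pfE gfI gfE NgI Ng0 Ic cE
  gB gyoung weak.
have Wae t : G t -> {ae mu, forall x, Omega x -> W t x = v (t, x)}.
  move=> Gt; have tT : 0 <= t <= T by have /andP[/ltW-> /ltW] := GT t Gt.
  have := W0 t tT Gt => /(dot_eq0 mO (LpB _ _ (WL t tT) (wLp t Gt))).
  by apply: filterS => x h Ox; have /eqP := h Ox; rewrite subr_eq0 => /eqP.
have WwG t : 0 <= t <= T -> G t -> dotO (W t) (W t) = dotO (w t) (w t).
  move=> tT Gt; apply: (dot_ae mO (WL t tT) (wLp t Gt) (WL t tT) (wLp t Gt)); exact: Wae.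
have bsq (u u' : E -> R : zmodType) l : L2O u -> L2O u' -> 0 < l ->
    `|dotO u u - dotO u' u'| <= l * dotO u u + (1 + l^-1) * dotO (u - u') (u - u').
  exact: dot_sq_diff.
have st := gdist_step aeG GH.
have EN := energy_identity T0 aeG GT bge0 bsq NgI Ng0 Ic pfI pf0 WL wLp Ww WwG en st.
exists W, c; split => //; split.
- by move=> t; rewrite in_itv/=; exact: WL.
- move=> t; rewrite in_itv/= => tT; apply/cvgrPdist_le => e e0.
  have e20 : 0 < e ^+ 2 by rewrite exprn_gt0.
  have [dl dl0 H] := Wc _ e20.
  rewrite near_withinE; near=> r; rewrite /= in_itv/= => rT; rewrite sub0r normrN ger0_norm ?sqrtr_ge0//.
  rewrite /normL2 -(ger0_norm (ltW e0)) -sqrtr_sqr ler_sqrt ?sqr_ge0//.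
  apply: H => //; near: r; exact: nbhsx_ballx.
- apply: (lam_aeS _ aeG) => t h Jt; apply: Wae; apply: h.
  by move: Jt; rewrite /= in_itv.
Unshelve. all: by end_near.
Qed.

End representative.

(** * The space V: differences, representatives and traces *)

Section space_V.
Context {R : realType} {d : nat} (Omega : set 'rV[R]_d).
Hypotheses (oO : open Omega) (bO : bounded_set Omega).
Variable T : R.
Hypothesis T0 : 0 < T.
Local Notation E := 'rV[R]_d.
Local Notation mu := (@lebesgue_rV R d).
Local Notation lam := (@lebesgue_measure R).
Local Notation J := `]0, T[%classic.
Local Notation I := `]0, T]%classic.
Local Notation dotv := (dotL2v Omega).
Local Notation ip := (ip Omega).
Local Notation N := (dualnorm Omega).
Local Notation H10 := (H10 Omega).
Local Notation dotO := (dotL2 Omega).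
Local Notation L2O := (L2 mu Omega).

Let mO : measurable Omega := domain_measurable oO.
Let fO : (mu Omega < +oo)%E := domain_finite oO bO.
Let mI : measurable (I : set (measurableTypeR R)). Proof. by []. Qed.
Let mJ : measurable (J : set (measurableTypeR R)). Proof. by []. Qed.
Let mQ := @measurable_Q R _ E Omega T mO.

Lemma dualnorm_sub (g h : (E -> R) -> R) : Hm1 Omega g -> Hm1 Omega h ->
  N (fun u => g u - h u) <= N g + N h.
Proof.
move=> Hg Hh; rewrite [leLHS]dualnorm_sup.
set S := [set _ | _ in _].
have NN : 0 <= N g + N h by rewrite addr_ge0// normHm1_ge0.
have [->|/set0P S0] := eqVneq S set0; first by rewrite sup0.
apply: ge_sup => // _ [u [Hu _] <-].
have [n0|n0] := eqVneq (nu Omega u) 0; first by rewrite n0 invr0 mulr0.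
have np : 0 < nu Omega u by rewrite lt_neqAle eq_sym n0 nu_ge0.
rewrite ler_pdivrMr//; apply: le_trans (ler_norm _) _; apply: le_trans (ler_normB _ _) _.
by rewrite mulrDl lerD// (Hm1_abs oO bO).
Qed.

(** The norm of a difference does not inherit measurability in time from the two norms;
    [measurable_normHm1] supplies it, and the squared sum of the norms is an integrable majorant. *)
Lemma L2Hm1_sub g h : L2Hm1 Omega T g -> L2Hm1 Omega T h -> L2Hm1 Omega T (fun t u => g t u - h t u).
Proof.
move=> gH hH; have [gJ mg Ig] := gH; have [hJ mh Ih] := hH.
have dJ t : J t -> Hm1 Omega (fun u => g t u - h t u).
  by move=> Jt; apply: Hm1_sub; [exact: gJ|exact: hJ].
have md u : H10 u -> measurable_fun J (fun t => g t u - h t u).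
  by move=> Hu; apply: measurable_funB; [exact: mg|exact: mh].
split => //.
have mN := measurable_normHm1 oO bO mJ dJ md.
pose K t := 2 * (N (g t) ^+ 2 * \1_J t) + 2 * (N (h t) ^+ 2 * \1_J t).
have IK : igr K by apply: igrD; apply: igrZ; exact: dualnorm_igr.
apply: (@le_integrable _ _ _ lam J mJ _ (EFin \o K)).
- apply/measurable_EFinP; apply: measurable_funX.
  by apply: eq_measurable_fun mN => t _; rewrite dualnormE.
- move=> t Jt /=; rewrite lee_fin; apply: le_trans (ler_norm _).
  rewrite normrX -dualnormE ger0_norm; last by apply: (normHm1_ge0 oO bO); exact: dJ.
  have D := dualnorm_sub (gJ t Jt) (hJ t Jt).
  have D0 := normHm1_ge0 oO bO (dJ t Jt).
  rewrite /K indicE mem_set// !mulr1; move: D D0.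
  move: (N _) (N (g t)) (N (h t)) => x y z xyz x0.
  have : x ^+ 2 <= (y + z) ^+ 2 by rewrite lerXn2r// ?nnegrE// (le_trans x0).
  by have := sqr_ge0 (y - z); rewrite !expr2; lra.
- exact: igrS.
Qed.

Lemma gradt_P v : (exists G, is_gradQ Omega T v G) ->
  is_gradQ Omega T v (get [set G | is_gradQ Omega T v G]).
Proof. by move=> [G HG]; exact: (@getPex _ [set G | is_gradQ Omega T v G] (ex_intro _ G HG)). Qed.

Lemma dt_P v : H1Hm1 Omega T v -> is_dt Omega T v (dt Omega T v).
Proof. by move=> [_ [g Hg]]; exact: (@getPex _ [set g | is_dt Omega T v g] (ex_intro _ g Hg)). Qed.

Lemma test_mul_integrable (f F : R -> R) : continuous f ->
  lam.-integrable I (EFin \o F) -> lam.-integrable I (EFin \o (fun t => f t * F t)).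
Proof.
move=> cf IF; have [M HM] := continuous_bounded_itv T0 cf.
have mF : measurable_fun I F by have := IF => /measurable_int/measurable_EFinP.
apply: (@le_integrable _ _ _ lam I mI _ (EFin \o (fun t => M * F t))).
- apply/measurable_EFinP; apply: measurable_funM => //.
  by apply: measurable_funTS; exact: continuous_measurable_fun.
- move=> t It /=; rewrite lee_fin !normrM ler_wpM2r//.
  by apply: le_trans (HM t It) _; exact: ler_norm.
- by have := integrableZl mI M IF; exact: eq_integrable.
Qed.

(** The slices lie in L^2 at almost every time only, so the product with [u] is split under the time
    integral, not at each time. *)
Lemma is_dt_sub v w g h : spaceV Omega T v -> spaceV Omega T w ->
  is_dt Omega T v g -> is_dt Omega T w h ->
  is_dt Omega T (v \- w) (fun t u => g t u - h t u).
Proof.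
move=> [[Lv aev _] _] [[Lw aew _] _] [gH Hg] [hH Hh]; split; first exact: L2Hm1_sub.
move=> eta u te Hu; have Lu := H10_L2 Hu.
have ce := test_time_continuous te.
have Iv := L2Q_dot_integrable oO Lv (L2Q_fst oO T Lu).
have Iw := L2Q_dot_integrable oO Lw (L2Q_fst oO T Lu).
transitivity (\int[lam]_(t in I) (derive1 eta t * dotO (slice v t) u - derive1 eta t * dotO (slice w t) u)).
  rewrite -Rintegral_JI; apply: ae_eq_Rintegral.
  apply: (lam_aeS2 _ aev aew) => t h1 h2 Jt; rewrite -mulrBr; congr (_ * _).
  exact: (dotBl mO (H10_L2 (h1 Jt)) (H10_L2 (h2 Jt)) Lu).
rewrite RintegralB//; [|exact: test_mul_integrable|exact: test_mul_integrable].
rewrite -!Rintegral_JI (Hg _ _ te Hu) (Hh _ _ te Hu).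
have GE k : \int[lam]_(t in J) (eta t * k t u) = \int[lam]_(t in I) (eta t * gfun T k u t).
  rewrite -Rintegral_JI; apply: eq_Rintegral => t /set_mem; rewrite /= in_itv/= => tT.
  by rewrite gfunE.
rewrite !GE.
have L1 := L2_mul mI (test_time_L2 T0 te) (gfun_L2 oO bO gH Hu).
have L2 := L2_mul mI (test_time_L2 T0 te) (gfun_L2 oO bO hH Hu).
transitivity (- (\int[lam]_(t in I) (eta t * gfun T g u t) - \int[lam]_(t in I) (eta t * gfun T h u t))).
  by move: (\int[lam]_(t in I) _) (\int[lam]_(t in I) _) => x y; ring.
congr (- _); rewrite -RintegralB//.
have -> : \int[lam]_(t in J) (eta t * (g t u - h t u)) =
    \int[lam]_(t in J) (eta t * gfun T g u t - eta t * gfun T h u t).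
  apply: eq_Rintegral => t /set_mem; rewrite /= in_itv/= => tT.
  by rewrite !gfunE// mulrBr.
by rewrite Rintegral_JI.
Qed.

Lemma L2H10_sub v w : L2H10 Omega T v -> L2H10 Omega T w -> L2H10 Omega T (v \- w).
Proof.
move=> [Lv aev [G [LG aeG]]] [Lw aew [H [LH aeH]]]; split.
- exact: (L2_B mQ Lv Lw).
- by apply: (lam_aeS2 _ aev aew) => t h1 h2 Jt; exact: (H10_B oO bO (h1 Jt) (h2 Jt)).
- exists (fun i z => -1 * H i z + G i z); split; first by move=> i; exact: (L2_comb mQ (-1) (LH i) (LG i)).
  have aevw := lam_aeS2 (fun t (h1 : J t -> H10 (slice v t)) (h2 : J t -> H10 (slice w t)) (Jt : J t) =>
    conj (h1 Jt) (h2 Jt)) aev aew.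
  have aeGH := lam_aeS2 (fun t (h1 : J t -> is_weak_grad Omega (slice v t) (fun i => slice (G i) t))
     (h2 : J t -> is_weak_grad Omega (slice w t) (fun i => slice (H i) t)) (Jt : J t) =>
    conj (h1 Jt) (h2 Jt)) aeG aeH.
  apply: (lam_aeS2 _ aevw aeGH) => t h1 h2 Jt.
  have [Hv Hw] := h1 Jt; have [wv ww] := h2 Jt.
  have := weak_grad_comb oO bO (-1) (H10_L2 Hw) (H10_L2 Hv) ww wv.
  by rewrite -subE.
Qed.

Lemma spaceV_sub v w : spaceV Omega T v -> spaceV Omega T w -> spaceV Omega T (v \- w).
Proof.
move=> Vv Vw; have [Hv Tv] := Vv; have [Hw Tw] := Vw; split; first exact: L2H10_sub.
split; first by have [Lv _ _] := Hv; have [Lw _ _] := Hw; exact: (L2_B mQ Lv Lw).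
by exists (fun t u => dt Omega T v t u - dt Omega T w t u); exact: (is_dt_sub Vv Vw (dt_P Tv) (dt_P Tw)).
Qed.

Lemma spaceV_rep v : spaceV Omega T v -> exists (W : R -> E -> R) (c : R -> R),
  [/\ igr c, {ae lam, forall t, J t -> c t = dt Omega T v t (slice v t)},
      is_continuous_rep Omega T v W &
      dotO (W T) (W T) - dotO (W 0) (W 0) = 2 * itg c 0 T].
Proof.
move=> [Hv Tv]; have [_ _ eG] := Hv.
exact: (evolution_rep oO bO T0 Hv (gradt_P eG) (dt_P Tv)).
Qed.

Lemma trace_rep v : spaceV Omega T v -> is_continuous_rep Omega T v (trace Omega T v).
Proof.
move=> /spaceV_rep[W [_ [_ _ HW _]]].
exact: (@getPex _ [set W | is_continuous_rep Omega T v W] (ex_intro _ W HW)).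
Qed.

Lemma rep_eps v W t e : is_continuous_rep Omega T v W -> 0 <= t <= T -> 0 < e ->
  exists2 dl, 0 < dl & forall r, 0 <= r <= T -> `|t - r| < dl -> dotO (W r \- W t) (W r \- W t) <= e.
Proof.
move=> [_ cW _] tT e0; have se : 0 < Num.sqrt e by rewrite sqrtr_gt0.
have tI : t \in `[0, T] by rewrite in_itv.
have /cvgrPdist_le/(_ _ se) := cW t tI.
rewrite near_withinE => -[dl /= dl0 H]; exists dl => // r rT tr.
have rI : `[0, T]%classic r by rewrite /= in_itv.
have := H r tr rI; rewrite sub0r normrN ger0_norm ?sqrtr_ge0// /normL2.
by rewrite ler_sqrt// ltW.
Qed.

Lemma rep_sub v w V W : is_continuous_rep Omega T v V -> is_continuous_rep Omega T w W ->
  is_continuous_rep Omega T (v \- w) (fun t => V t \- W t).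
Proof.
move=> RV RW; have [LV _ aeV] := RV; have [LW _ aeW'] := RW; split.
- by move=> t tI; apply: (L2_B mO); [exact: LV|exact: LW].
- move=> t tI; apply/cvgrPdist_le => e e0.
  have tT : 0 <= t <= T by move: tI; rewrite in_itv.
  have e4 : 0 < e ^+ 2 / 4 by rewrite divr_gt0// exprn_gt0.
  have [d1 d10 H1] := rep_eps RV tT e4; have [d2 d20 H2] := rep_eps RW tT e4.
  have dm : 0 < Num.min d1 d2 by rewrite lt_min d10.
  rewrite near_withinE; near=> r; rewrite /= in_itv/= => rT.
  rewrite sub0r normrN ger0_norm ?sqrtr_ge0// /normL2.
  rewrite -(ger0_norm (ltW e0)) -sqrtr_sqr ler_sqrt ?sqr_ge0//.
  have : `|t - r| < Num.min d1 d2 by near: r; exact: nbhsx_ballx.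
  rewrite lt_min => /andP[r1 r2].
  have rI : r \in `[0, T] by rewrite in_itv.
  have LVd := L2_B mO (LV r rI) (LV t tI); have LWd := L2_B mO (LW r rI) (LW t tI).
  rewrite (_ : _ \- _ = (V r \- V t) \- (W r \- W t)); last by apply/funext => x /=; ring.
  apply: le_trans (dot_le2 mO LVd LWd) _.
  have := H1 r rT r1; have := H2 r rT r2; rewrite /dotL2 /dot.
  by move: (\int[mu]_(x in Omega) _) (\int[mu]_(x in Omega) _) => x y; lra.
- apply: (lam_aeS2 _ aeV aeW') => t h1 h2 Jt.
  by apply: filterS2 (h1 Jt) (h2 Jt) => x g1 g2 Ox /=; rewrite g1// g2.
Unshelve. all: by end_near.
Qed.

(** Both representatives are continuous into L^2 and agree with [v] at almost every time, hence with
    each other at a dense set of times. This identifies the chosen [trace] with the representative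
    that carries the energy identity, and the trace of a difference with the difference of the
    traces. *)
Lemma rep_unique v V W t : is_continuous_rep Omega T v V -> is_continuous_rep Omega T v W ->
  0 <= t <= T -> {ae mu, forall x, Omega x -> V t x = W t x}.
Proof.
move=> RV RW tT; have [LV _ aeV] := RV; have [LW _ aeW'] := RW.
have tI : t \in `[0, T] by rewrite in_itv.
have LVW r : r \in `[0, T] -> L2O (V r \- W r) by move=> rI; apply: (L2_B mO); [exact: LV|exact: LW].
suff D0 : dotO (V t \- W t) (V t \- W t) = 0.
  have := dot_eq0 mO (LVW t tI) D0.
  by apply: filterS => x h Ox; have /eqP := h Ox; rewrite subr_eq0 => /eqP.
apply/eqP; rewrite eq_le [X in _ && X]dot_ge0 andbT; apply/ler_addgt0Pr => e e0; rewrite add0r.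
(* Two nested squared triangle inequalities give [2 * (2 * (e / 8) + 2 * (e / 8))], which is [e]. *)
have e8 : 0 < e / 8 by rewrite divr_gt0.
have [d1 d10 H1] := rep_eps RV tT e8; have [d2 d20 H2] := rep_eps RW tT e8.
have dm : 0 < Num.min d1 d2 by rewrite lt_min d10.
pose G (r : R) := 0 < r < T /\ {ae mu, forall x, Omega x -> V r x = W r x}.
have aeG : {ae lam, forall r, 0 < r < T -> G r}.
  apply: (lam_aeS2 _ aeV aeW') => r h1 h2 rT.
  have Jr : J r by rewrite /= in_itv.
  split => //; apply: filterS2 (h1 Jr) (h2 Jr) => x g1 g2 Ox /=; by rewrite g1// g2.
have [r [r0T rE]] := ae_dense T0 aeG tT dm.
rewrite lt_min => /andP[r1 r2].
have rT : 0 <= r <= T by case/andP: r0T => /ltW-> /ltW.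
have rI : r \in `[0, T] by rewrite in_itv.
have LVd := L2_B mO (LV r rI) (LV t tI); have LWd := L2_B mO (LW r rI) (LW t tI).
have Z0 : dot mu Omega (V r \- W r) (V r \- W r) = 0.
  transitivity (\int[mu]_(x in Omega) 0); last by rewrite Rintegral_cst// mul0r.
  by apply: ae_eq_Rintegral; apply: filterS rE => x h Ox /=; rewrite h// subrr mul0r.
have A := dot_le2 mO (LVW r rI) (L2_B mO LVd LWd).
have B := dot_le2 mO LVd LWd.
have -> : V t \- W t = (V r \- W r) \- ((V r \- V t) \- (W r \- W t)).
  by apply/funext => x /=; ring.
apply: (le_trans A); rewrite Z0 mulr0 add0r.
have h1 : dot mu Omega (V r \- V t) (V r \- V t) <= e / 8 := H1 r rT r1.
have h2 : dot mu Omega (W r \- W t) (W r \- W t) <= e / 8 := H2 r rT r2.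
move: B h1 h2; move: (dot _ _ _ _) (dot _ _ _ _) (dot _ _ _ _) => x y z; lra.
Qed.

End space_V.

(** * The estimators *)

(** Minkowski's inequality in the plane. [x] and [y] stand for dual norms, whose sign as suprema is
    not established; only their squares occur in the estimators, so a comparison of absolute values
    suffices. *)
Lemma sqrt_add_tri {R : realType} (x y m p q r : R) : 0 <= m -> 0 <= p -> 0 <= q -> 0 <= r ->
  `|x| <= `|y| + m -> p <= q + r ->
  Num.sqrt (x ^+ 2 + p ^+ 2) <= Num.sqrt (y ^+ 2 + q ^+ 2) + Num.sqrt (m ^+ 2 + r ^+ 2).
Proof.
move=> m0 p0 q0 r0; rewrite -(real_normK (num_real x)) -(real_normK (num_real y)).
move: (normr_ge0 x) (normr_ge0 y); move: `|x| `|y| => {}x {}y x0 y0 xym pqr.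
have S0 u v : 0 <= u ^+ 2 + v ^+ 2 :> R by rewrite addr_ge0 ?sqr_ge0.
rewrite -(@ler_pXn2r _ 2) ?nnegrE ?addr_ge0 ?sqrtr_ge0// sqr_sqrtr// sqrrD !sqr_sqrtr//.
have h1 : x ^+ 2 <= (y + m) ^+ 2 by rewrite lerXn2r ?nnegrE ?addr_ge0.
have h2 : p ^+ 2 <= (q + r) ^+ 2 by rewrite lerXn2r ?nnegrE ?addr_ge0.
have h3 : y * m + q * r <= Num.sqrt (y ^+ 2 + q ^+ 2) * Num.sqrt (m ^+ 2 + r ^+ 2).
  rewrite -sqrtrM// -[leLHS]ger0_norm ?addr_ge0 ?mulr_ge0// -sqrtr_sqr ler_sqrt ?mulr_ge0//.
  (* Lagrange's identity, which gives Cauchy-Schwarz in the plane. *)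
  have -> : (y ^+ 2 + q ^+ 2) * (m ^+ 2 + r ^+ 2) = (y * m + q * r) ^+ 2 + (y * r - q * m) ^+ 2 by ring.
  by rewrite lerDl sqr_ge0.
apply: (le_trans (lerD h1 h2)).
have -> : (y + m) ^+ 2 + (q + r) ^+ 2 = y ^+ 2 + q ^+ 2 + (y * m + q * r) *+ 2 + (m ^+ 2 + r ^+ 2) by ring.
by rewrite lerD2r lerD2l lerMn2r/=.
Qed.

(* If one of the images is not bounded above then neither is the other, and
   both [sup]s are the junk value 0. *)
Lemma sup_dist_le {R : realType} {X : Type} (S : set X) (F K : X -> R) D : 0 <= D ->
  (forall x, S x -> `|F x - K x| <= D) -> sup (F @` S) <= sup (K @` S) + D.
Proof.
move=> D0 FK; have [->|/set0P S0] := eqVneq S set0.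
  by rewrite !image_set0 !sup0 add0r.
have FK1 x : S x -> F x <= K x + D /\ K x <= F x + D.
  by move=> /FK; rewrite ler_norml => /andP[h1 h2]; split; lra.
have nF : F @` S !=set0 by case: S0 => x Sx; exists (F x), x.
have [uK|nuK] := pselect (has_ubound (K @` S)).
  apply: ge_sup => // _ [x Sx <-].
  apply: le_trans (FK1 x Sx).1 _; rewrite lerD2r.
  by apply: sup_upper_bound; [split => //; case: S0 => y Sy; exists (K y), y|exists x].
have nuF : ~ has_ubound (F @` S).
  move=> [M HM]; apply: nuK; exists (M + D) => _ [x Sx <-].
  by apply: le_trans (FK1 x Sx).2 _; rewrite lerD2r; apply: HM; exists x.
rewrite (sup_out (_ : ~ has_sup (F @` S))); last by case.
by rewrite (sup_out (_ : ~ has_sup (K @` S))) ?add0r//; case.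
Qed.

(** Young's inequality is read with the sign that leaves [2 * y], twice the pairing of dt w with w,
    on the right. Integrated, it becomes ||w(T)||^2 - ||w(0)||^2, whose first term completes
    ||w||_V^2. *)
Lemma young_expand {R : realType} (l n a b p x y : R) :
  2 * `|- l * x + y| <= n + ((- l) ^+ 2 * p + 2 * - l * b + a) ->
  2 * l * x + 2 * l * b <= n + a + (l ^+ 2 * p + 2 * y).
Proof.
have := lerNnormlW (lexx `|- l * x + y|); move: `|_| => z.
rewrite sqrrN mulNr mulrN mulNr -!mulrA.
by move: (l * x) (l * b) (l ^+ 2 * p) => x1 b1 p1; lra.
Qed.

Lemma energy_expand {R : realType} (l A B S P C w0 wT : R) : wT - w0 = 2 * C ->
  2 * l * A + 2 * l * B <= S + (l ^+ 2 * P + 2 * C) ->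
  2 * l * (A + B) <= S + wT - w0 + l ^+ 2 * P.
Proof. by move=> e; rewrite -e mulrDr; move: (2 * l * A) (2 * l * B) (l ^+ 2 * P) => *; lra. Qed.

(** * Dual bound for the heat residual *)

Section heat_bound.
Context {R : realType} {d : nat} (Omega : set 'rV[R]_d).
Hypotheses (oO : open Omega) (bO : bounded_set Omega).
Variable T : R.
Hypothesis T0 : 0 < T.
Local Notation E := 'rV[R]_d.
Local Notation mu := (@lebesgue_rV R d).
Local Notation lam := (@lebesgue_measure R).
Local Notation J := `]0, T[%classic.
Local Notation I := `]0, T]%classic.
Local Notation dotv := (dotL2v Omega).
Local Notation ip := (ip Omega).
Local Notation N := (dualnorm Omega).
Local Notation H10 := (H10 Omega).
Local Notation dotO := (dotL2 Omega).
Local Notation gradt := (gradt Omega T).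

Let mO : measurable Omega := domain_measurable oO.
Let mI : measurable (I : set (measurableTypeR R)). Proof. by []. Qed.
Let mJ : measurable (J : set (measurableTypeR R)). Proof. by []. Qed.

Lemma gradt_integrable v w : L2H10 Omega T v -> L2H10 Omega T w ->
  lam.-integrable I (EFin \o (fun t => dotv (gradt v t) (gradt w t))).
Proof.
move=> [_ _ /gradt_P[LG _]] [_ _ /gradt_P[LH _]].
exact: (L2Qv_dot_integrable oO LG LH).
Qed.

Lemma normV_sqr w : spaceV Omega T w -> normV Omega T w ^+ 2 =
  itg (fun t => N (dt Omega T w t) ^+ 2 * \1_J t + tcut T (fun t => dotv (gradt w t) (gradt w t)) t) 0 T +
  dotO (trace Omega T w T) (trace Omega T w T).
Proof.
move=> Vw; rewrite /normV.
have -> : \int[lam]_(t in J) (normL2v Omega (gradt w t) ^+ 2 + normHm1 Omega (dt Omega T w t) ^+ 2) =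
  itg (fun t => N (dt Omega T w t) ^+ 2 * \1_J t + tcut T (fun t => dotv (gradt w t) (gradt w t)) t) 0 T.
  rewrite /itg -Rintegral_JI; apply: eq_Rintegral => t /set_mem Jt.
  rewrite indicE (mem_set Jt) mulr1 tcutE ?normL2v_sqr ?dualnormE 1?addrC//.
  by move: Jt; rewrite /= in_itv/= => /andP[-> /ltW].
have E1 : normL2 Omega (trace Omega T w T) ^+ 2 = dotO (trace Omega T w T) (trace Omega T w T).
  by rewrite sqr_sqrtr// dot_ge0.
rewrite E1 sqr_sqrtr// addr_ge0 ?dot_ge0//; apply: itg_ge0 => t.
apply: addr_ge0; first by rewrite mulr_ge0 ?sqr_ge0// indicE.
by rewrite /tcut mulr_ge0 ?dotv_ge0// indicE.
Qed.

(** Two values of [l] are used: 0, which shows that ||w(0)|| is at most ||w||_V, and the residual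
    itself, which bounds the residual on unit test functions. *)
Lemma heat_bound w phi l : spaceV Omega T w -> L2H10 Omega T phi ->
  2 * l * resH Omega T w phi <= normV Omega T w ^+ 2 -
    dotO (trace Omega T w 0) (trace Omega T w 0) +
    l ^+ 2 * \int[lam]_(t in J) normL2v Omega (gradt phi t) ^+ 2.
Proof.
move=> Vw Hphi; have [Hw Tw] := Vw.
have [_ _ eGw] := Hw; have [_ _ eGp] := Hphi.
have Gw := gradt_P eGw; have Gp := gradt_P eGp.
have [gH _] := dt_P Tw; have [gJ _ _] := gH.
have [W [c [Ic aec RW EW]]] := spaceV_rep oO bO T0 Vw.
have [cp Icp aecp] := pairing oO bO Hphi Gp gH.
have Rt := trace_rep oO bO T0 Vw.
have tr t : 0 <= t <= T -> dotO (trace Omega T w t) (trace Omega T w t) = dotO (W t) (W t).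
  move=> tT; have tI : t \in `[0, T] by rewrite in_itv.
  have L1 : L2 mu Omega (trace Omega T w t) by case: Rt => H _ _; exact: H.
  have L2 : L2 mu Omega (W t) by case: RW => H _ _; exact: H.
  have ae := rep_unique oO T0 Rt RW tT.
  exact: (dot_ae mO L1 L2 L1 L2 ae ae).
pose a := tcut T (fun t => dotv (gradt w t) (gradt w t)).
pose bb := tcut T (fun t => dotv (gradt w t) (gradt phi t)).
pose p := tcut T (fun t => dotv (gradt phi t) (gradt phi t)).
pose n t := N (dt Omega T w t) ^+ 2 * \1_J t.
have Ia : igr a by apply: igr_tcut; exact: gradt_integrable.
have Ib : igr bb by apply: igr_tcut; exact: gradt_integrable.
have Ip : igr p by apply: igr_tcut; exact: gradt_integrable.
have In : igr n := dualnorm_igr gH.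
have E1 : \int[lam]_(t in J) normL2v Omega (gradt phi t) ^+ 2 = itg p 0 T.
  rewrite itg_tcut// /itg -Rintegral_JI; apply: eq_Rintegral => t _; exact: normL2v_sqr.
have E2 : resH Omega T w phi = itg cp 0 T + itg bb 0 T.
  rewrite /resH; congr (_ + _).
    rewrite /itg -Rintegral_JI; apply: ae_eq_Rintegral.
    by apply: (lam_aeS _ aecp) => t h Jt; rewrite h.
  by rewrite itg_tcut// /itg -Rintegral_JI.
have [Zw [mZw Zw0] Hzw] := good_set Hw Gw.
have [Zp [mZp Zp0] Hzp] := good_set Hphi Gp.
have aeZw : {ae lam, forall t, ~ Zw t} by exists Zw; split => // t /= /contrapT.
have aeZp : {ae lam, forall t, ~ Zp t} by exists Zp; split => // t /= /contrapT.
have aeT : {ae lam, forall x, x != T}.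
  by exists [set T]; split => //; [exact: lebesgue_measure_set1|move=> x /= /negP; rewrite negbK => /eqP].
pose G t := [/\ J t, ~ Zw t, ~ Zp t, c t = dt Omega T w t (slice w t) & cp t = dt Omega T w t (slice phi t)].
have aeG : {ae lam, forall t, `]0, T]%classic t -> G t}.
  have ae1 : {ae lam, forall t, ~ Zw t /\ ~ Zp t} by apply: (lam_aeS2 _ aeZw aeZp).
  have ae2 : {ae lam, forall t, J t -> c t = dt Omega T w t (slice w t) /\ cp t = dt Omega T w t (slice phi t)}.
    by apply: (lam_aeS2 _ aec aecp) => t h1 h2 Jt; split; [exact: h1|exact: h2].
  have ae3 := lam_aeS2 (fun t h1 h2 => conj h1 h2) ae1 ae2.
  apply: (lam_aeS2 _ ae3 aeT) => t [[h1 h2] h3] tT; rewrite /= in_itv/= => /andP[t0 tT'].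
  have Jt : J t by rewrite /= in_itv/= t0 lt_neqAle tT.
  by have [h4 h5] := h3 Jt.
have key : itg (fun x => 2 * l * cp x + 2 * l * bb x) 0 T <=
    itg (fun x => 1 * (n x + a x) + (l ^+ 2 * p x + 2 * c x)) 0 T.
  apply: (@itg_le_ae _ _ _ _ _ G) => //.
  - by apply: igrD; exact: igrZ.
  - by apply: igrD; [apply: igrZ|]; apply: igrD => //; exact: igrZ.
  move=> t It [Jt nZw nZp ct cpt].
  have tT : 0 < t < T by move: Jt; rewrite /= in_itv.
  have tT' : 0 < t <= T by move: It; rewrite /= in_itv.
  have [Hwt wwt] := Hzw t tT nZw; have [Hpt wpt] := Hzp t tT nZp.
  have gt := gJ t Jt; have [glin _] := gt.
  have Hz := H10_comb oO bO (- l) Hpt Hwt.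
  have Y := Hm1_young oO bO ltr01 gt Hz.
  have gz := glin (- l) _ _ Hpt Hwt.
  have iz := ip_sq_comb oO bO (- l) (H10_H1 Hpt) (H10_H1 Hwt).
  have e1 : ip (slice phi t) (slice phi t) = p t.
    by rewrite ipE (dotv_grad oO bO wpt wpt) /p tcutE.
  have e2 : ip (slice phi t) (slice w t) = bb t.
    rewrite ipE (dotv_grad oO bO wpt wwt) /bb (tcutE _ tT'); exact: dotvC.
  have e3 : ip (slice w t) (slice w t) = a t.
    by rewrite ipE (dotv_grad oO bO wwt wwt) /a tcutE.
  rewrite ct cpt /n indicE mem_set// !mulr1.
  by move: Y; rewrite gz iz e1 e2 e3 invr1 !mul1r; exact: young_expand.
move: key.
rewrite (itg_comb (2 * l) 0 T Icp (igrZ (2 * l) Ib)) (itgZ (2 * l) _ _ Ib).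
rewrite (itg_comb 1 0 T (igrD In Ia) (igrD (igrZ (l ^+ 2) Ip) (igrZ 2 Ic))).
rewrite (itg_comb (l ^+ 2) 0 T Ip (igrZ 2 Ic)) (itgZ 2 _ _ Ic).
have T00 : 0 <= T <= T by rewrite lexx ltW.
have T01 : 0 <= (0 : R) <= T by rewrite lexx ltW.
rewrite (normV_sqr Vw) E1 E2 (tr T T00) (tr 0 T01) mul1r.
exact: (energy_expand EW).
Qed.

End heat_bound.

Lemma sqr_le_of_double {R : realType} (x y : R) : 2 * x * x <= y + x ^+ 2 -> x ^+ 2 <= y.
Proof. by rewrite -mulrA expr2; lra. Qed.

Lemma normr_le_add {R : realType} (x y m : R) : x <= y + m -> y <= x + m -> `|x| <= `|y| + m.
Proof.
move=> h1 h2; rewrite ler_norml; have := ler_norm y; have := lerNnormlW (lexx `|y|).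
by move: `|y| => u h3 h4; apply/andP; split; lra.
Qed.

Theorem theorem4p1 (R : realType) (d : nat) (hd : (0 < d)%N)
    (Omega : set 'rV[R]_d) (hOmega : lipschitz_domain Omega)
    (T : R) (hT : 0 < T)
    (b B : R -> R)
    (hb0 : b 0 = 0)
    (hb_mono : {homo b : r s / r <= s}) (hB_mono : {homo B : r s / r <= s})
    (hb_lip : forall s r, `|b s - b r| <= `|s - r|)
    (hB_lip : forall s r, `|B s - B r| <= `|s - r|)
    (hbB : forall s r, r <= s -> s - r <= (b s + B s) - (b r + B r))
    (f : R * 'rV[R]_d -> R) (hf : L2Q Omega T f)
    (u0 s0 : 'rV[R]_d -> R)
    (hu0 : L2 (lebesgue_rV d) Omega u0) (hs0 : L2 (lebesgue_rV d) Omega s0)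
    (hbs0 : {ae lebesgue_rV d, forall x, Omega x -> b (s0 x) = u0 x})
    (L : R) (hL : 1 < L < 2)
    (si : R * 'rV[R]_d -> R)
    (hsiS : spaceS Omega T b B si) (hsiV : spaceV Omega T si)
    (si1 : R * 'rV[R]_d -> R) (hsi1V : spaceV Omega T si1)
    (hsi1_init : {ae lebesgue_rV d, forall x, Omega x ->
       trace Omega T si1 0 x = s0 x})
    (hsi1_lin : forall phi, L2H10 Omega T phi ->
       reslin Omega T b B f L si1 si phi = 0)
    (sht : R * 'rV[R]_d -> R) (hsht : spaceV Omega T sht) :
  est Omega T b B f s0 L si <=
    est_disc Omega T b B f s0 L si sht + L * est_lin Omega T si sht /\
  est_disc Omega T b B f s0 L si sht <=
    est Omega T b B f s0 L si + L * est_lin Omega T si sht.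
Proof.
have [_ oO _ bO _] := hOmega.
have mO := domain_measurable oO.
have L0 : 0 < L by case/andP: hL => /(lt_trans ltr01).
pose w := sht \- si.
have Vw : spaceV Omega T w := spaceV_sub oO bO hT hsht hsiV.
pose tr0 := dotL2 Omega (trace Omega T w 0) (trace Omega T w 0).
pose M2 := normV Omega T w ^+ 2 - tr0.
have tr00 : 0 <= tr0 by exact: dot_ge0.
(* This is the case [l = 0], where any test function will do; [w] is the one at hand. *)
have M20 : 0 <= M2.
  have [Hw _] := Vw; have := heat_bound oO bO hT 0 Vw Hw.
  by rewrite mulr0 mul0r expr0n/= mul0r addr0.
pose S := [set phi | L2H10 Omega T phi /\
  \int[lebesgue_measure]_(t in `]0, T[) normL2v Omega (gradt Omega T phi t) ^+ 2 = 1].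
have hw phi : S phi -> `|resH Omega T w phi| <= Num.sqrt M2.
  move=> [Hphi p1]; have := heat_bound oO bO hT (resH Omega T w phi) Vw Hphi.
  rewrite p1 mulr1 -/tr0 -/M2 => h.
  by rewrite -sqrtr_sqr ler_sqrt//; exact: sqr_le_of_double.
pose m := L * Num.sqrt M2.
have m0 : 0 <= m by rewrite mulr_ge0 ?sqrtr_ge0// ltW.
pose F := res Omega T b B f si; pose K := reslin Omega T b B f L sht si.
have KF phi : K phi - F phi = L * resH Omega T w phi by rewrite /K /reslin addrK.
have FK1 phi : S phi -> `|F phi - K phi| <= m.
  by move=> /hw h; rewrite distrC KF normrM gtr0_norm// ler_pM2l.
have FK2 phi : S phi -> `|K phi - F phi| <= m by move=> /FK1; rewrite distrC.
have s1 : normL2Hm1 Omega T F <= normL2Hm1 Omega T K + m := sup_dist_le m0 FK1.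
have s2 : normL2Hm1 Omega T K <= normL2Hm1 Omega T F + m := sup_dist_le m0 FK2.
have T00 : (0 : R) \in `[0, T] by rewrite in_itv/= lexx ltW.
have T01 : 0 <= (0 : R) <= T by rewrite lexx ltW.
have Ri := trace_rep oO bO hT hsiV; have Rh := trace_rep oO bO hT hsht.
have Rw := trace_rep oO bO hT Vw.
have Li : L2 (lebesgue_rV d) Omega (trace Omega T si 0) by case: Ri => H _ _; exact: H.
have Lh : L2 (lebesgue_rV d) Omega (trace Omega T sht 0) by case: Rh => H _ _; exact: H.
have Lw : L2 (lebesgue_rV d) Omega (trace Omega T w 0) by case: Rw => H _ _; exact: H.
pose z := trace Omega T sht 0 \- trace Omega T si 0.
have Lz : L2 (lebesgue_rV d) Omega z := L2_B mO Lh Li.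
(* [trace] is chosen separately for each function, so it is additive only up to a null set, through
   the uniqueness of representatives. *)
have zw := rep_unique oO hT (rep_sub oO Rh Ri) Rw T01.
have dz : dot (lebesgue_rV d) Omega z z = tr0 := dot_ae mO Lz Lw Lz Lw zw zw.
pose A := trace Omega T si 0 \- s0; pose C := trace Omega T sht 0 \- s0.
have LA : L2 (lebesgue_rV d) Omega A := L2_B mO Li hs0.
have LC : L2 (lebesgue_rV d) Omega C := L2_B mO Lh hs0.
pose r := normL2 Omega (trace Omega T w 0).
have r2 : r ^+ 2 = tr0 by rewrite sqr_sqrtr.
have q_le : normL2 Omega C <= normL2 Omega A + r.
  have := sqrt_dot_tri mO LA Lz; rewrite dz.
  by rewrite (_ : A \+ z = C)//; apply/funext => x; rewrite /A /C /z /=; ring.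
have p_le : normL2 Omega A <= normL2 Omega C + r.
  have Lz' := L2_Z mO (-1) Lz; have := sqrt_dot_tri mO LC Lz'.
  rewrite (_ : C \+ _ = A); last by apply/funext => x; rewrite /A /C /z /=; ring.
  rewrite (_ : dot _ _ (fun x => -1 * z x) _ = tr0)//.
  by rewrite -dz; apply: eq_Rintegral => x _; rewrite !mulN1r mulrNN.
(* [Num.sqrt M2] and [r] are the legs of a right triangle with hypotenuse [normV Omega T w], since
   [M2 + tr0] is its square. *)
have lin : L * est_lin Omega T si sht = Num.sqrt (m ^+ 2 + (L * r) ^+ 2).
  rewrite !exprMn sqr_sqrtr// r2 -mulrDr subrK -exprMn sqrtr_sqr ger0_norm//.
  by rewrite mulr_ge0 ?sqrtr_ge0// ltW.
have eF : est Omega T b B f s0 L si =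
    Num.sqrt (normL2Hm1 Omega T F ^+ 2 + (L * normL2 Omega A) ^+ 2) by rewrite /est exprMn.
have eK : est_disc Omega T b B f s0 L si sht =
    Num.sqrt (normL2Hm1 Omega T K ^+ 2 + L ^+ 2 * normL2 Omega C ^+ 2) by [].
have L0' := ltW L0.
rewrite lin eF eK -(exprMn _ L (normL2 Omega C)); split; apply: sqrt_add_tri; rewrite ?mulr_ge0 ?sqrtr_ge0//.
- exact: normr_le_add.
- by rewrite -mulrDr (ler_pM2l L0); exact: p_le.
- exact: normr_le_add.
- by rewrite -mulrDr (ler_pM2l L0); exact: q_le.
Qed.
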